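(* Let $S$ be a closed orientable surface of genus $g\ge 2$ and let $X\in\mathcal{T}(S)$. The hyperbolic metric $\rho_X$ of $X$ is not an extremal metric for any weighted multi-curve on $X$.
   Context: $X$ is regarded both as a marked hyperbolic surface and as a marked Riemann surface; $\rho_X$ is the hyperbolic metric in its conformal class. A multi-curve is a finite family of (simple or non-simple) closed curves; closed curves are taken to be homotopically nontrivial. A weighted multi-curve is a finite combination $\sum a_i\gamma_i$ of closed curves with positive weights $a_i$. An allowable conformal metric on $X$ is $\rho(z)|dz|$ with $\rho$ Borel measurable, non-negative, locally $L^2$, and with $\mathrm{Area}(\rho):=\int_X\rho^2\,dx\,dy$ neither $0$ nor $\infty$. For a path $\gamma$, $L_\rho(\gamma):=\int_\gamma\rho|dz|$. For a closed curve $\gamma$, $\ell_\rho(\gamma):=\inf L_\rho(\gamma')$ over $\gamma'$ freely homotopic to $\gamma$; for a weighted multi-curve, $\ell_\rho(\sum a_i\gamma_i)=\sum a_i\ell_\rho(\gamma_i)$. The extremal length of a weighted multi-curve $c$ is $\mathrm{Ext}_X(c):=\sup_\rho \ell_\rho(c)^2/\mathrm{Area}(\rho)$ over all allowable conformal metrics. A conformal metric $\rho$ is called an extremal metric for $c$ if $\mathrm{Ext}_X(c)=\ell_\rho(c)^2/\mathrm{Area}(\rho)$. *)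

(* Defs.v *)
From Stdlib Require Import Relation_Operators.
From HB Require Import structures.
From mathcomp Require Import all_boot all_order all_algebra.
From mathcomp Require Import all_classical all_reals all_analysis.

Set Implicit Arguments.
Unset Strict Implicit.
Unset Printing Implicit Defensive.

Import Order.TTheory GRing.Theory Num.Theory.
Import numFieldNormedType.Exports.

Local Open Scope classical_set_scope.
Local Open Scope ring_scope.

(* The complex plane is R * R, with (x, y) standing for x + iy: this carries
   both the topology and the product measure.  The library norm on R * R is the
   sup norm, so the modulus is defined separately. *)
Section Plane.
Variable R : realType.
Implicit Types (f : R * R -> R * R) (z w : R * R).

Definition modulus z : R := Num.sqrt (z.1 ^+ 2 + z.2 ^+ 2).

Definition cmul z w : R * R :=
  (z.1 * w.1 - z.2 * w.2, z.1 * w.2 + z.2 * w.1).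

(* The complex derivative is the value at 1 of the real differential. *)
Definition cderiv f z : R * R := 'd f z (1, 0).

Definition holomorphic_at f z : Prop :=
  differentiable f z /\ forall h, 'd f z h = cmul (cderiv f z) h.

Definition plane_measure :
    {measure set (measurableTypeR R * measurableTypeR R) -> \bar R} :=
  (@lebesgue_measure R \x @lebesgue_measure R)%E.

End Plane.

(* Closed orientable surface of genus g >= 1: the closed disc, its boundary
   circle cut into 4g equal sides glued along the word
   [a_1, b_1] ... [a_g, b_g]; the sides numbered k and k + 2, for k = 0, 1
   modulo 4, are identified with reversed orientation.  A continuous surjection
   from the (compact) disc onto a Hausdorff space is a quotient map, so S is
   homeomorphic to the glued polygon. *)
Section ClosedSurface.
Variable R : realType.

Definition closed_disc : set (R * R) := [set z | modulus z <= 1].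

Definition circle_pt (t : R) : R * R := (cos (2 * pi * t), sin (2 * pi * t)).

Definition side_gluing (g : nat) (z w : R * R) : Prop :=
  exists k : nat, exists u : R,
    [/\ (k < 4 * g)%N, (k %% 4 < 2)%N, 0 <= u <= 1,
        z = circle_pt ((k%:R + u) / (4 * g)%:R) &
        w = circle_pt ((k%:R + 3 - u) / (4 * g)%:R)].

Definition closed_orientable_surface (g : nat) (S : topologicalType) : Prop :=
  hausdorff_space S /\
  exists q : R * R -> S,
    [/\ {within closed_disc, continuous q},
        q @` closed_disc = [set: S] &
        forall z w, closed_disc z -> closed_disc w ->
          (q z = q w <-> clos_refl_sym_trans _ (side_gluing g) z w)].

End ClosedSurface.

Definition homeomorphism (S T : topologicalType) (f : S -> T) : Prop :=
  continuous f /\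
  exists h : T -> S, [/\ continuous h, cancel f h & cancel h f].

(* Only closed surfaces are considered, so the complex structure is given by a
   finite atlas; [param i] is the inverse of the chart [chart i], and both
   functions are relevant only on [dom i] and on its image. *)
Record riemannSurface (R : realType) := RiemannSurface {
  surface :> topologicalType;
  nb_charts : nat;
  dom : 'I_nb_charts -> set surface;
  chart : 'I_nb_charts -> surface -> R * R;
  param : 'I_nb_charts -> R * R -> surface;
  surface_hausdorff : hausdorff_space surface;
  surface_connected : connected [set: surface];
  dom_open : forall i, open (dom i);
  dom_cover : forall x, exists i, dom i x;
  chart_image_open : forall i, open (chart i @` dom i);
  chartK : forall i x, dom i x -> param i (chart i x) = x;
  chart_continuous : forall i, {within dom i, continuous (chart i)};
  param_continuous :
    forall i, {within chart i @` dom i, continuous (param i)};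
  transition_holomorphic : forall i j x, dom i x -> dom j x ->
    holomorphic_at (chart j \o param i) (chart i x)
}.

(* A point of Teichmueller space is represented by a marked Riemann surface.
   S carries no preferred orientation, so the marking is an arbitrary
   homeomorphism: it transports the orientation of the Riemann surface to S. *)
Record teichmuller (R : realType) (S : topologicalType) := Teichmuller {
  marked_surface :> riemannSurface R;
  marking : S -> marked_surface;
  marking_homeo : homeomorphism marking
}.

Section ExtremalLength.
Variables (R : realType) (X : riemannSurface R).

Definition chart_image (i : 'I_(nb_charts X)) : set (R * R) :=
  chart i @` dom i.

(* The cells partition X into Borel sets, each inside one chart domain.
   Integrals over X or along a path are sums of integrals over the cells,
   computed in the corresponding charts. *)
Definition cell (i : 'I_(nb_charts X)) : set X :=
  [set x | dom i x /\ forall j : 'I_(nb_charts X), (j < i)%N -> ~ dom j x].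

(* [density rho i] is the factor of |dz| in the chart i. *)
Record conformalMetric := ConformalMetric {
  density :> 'I_(nb_charts X) -> R * R -> R;
  density_change : forall i j x, dom i x -> dom j x ->
    density i (chart i x) =
    density j (chart j x) * modulus (cderiv (chart j \o param i) (chart i x))
}.

Definition area (rho : conformalMetric) : \bar R :=
  (\sum_(i < nb_charts X)
     \int[@plane_measure R]_(z in chart i @` cell i) ((rho i z) ^+ 2)%:E)%E.

Definition borel_density (D : set (R * R)) (f : R * R -> R) : Prop :=
  @measurable_fun _ _ (measurableTypeR R * measurableTypeR R)%type
    (measurableTypeR R) D f.

Definition allowable (rho : conformalMetric) : Prop :=
  [/\ forall i, borel_density (chart_image i) (rho i),
      forall i z, chart_image i z -> 0 <= rho i z,
      forall i K, compact K -> K `<=` chart_image i ->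
        (\int[@plane_measure R]_(z in K) ((rho i z) ^+ 2)%:E < +oo)%E &
      (0 < area rho < +oo)%E].

(* Maps from the circle R / Z. *)
Definition closed_curve (c : R -> X) : Prop :=
  continuous c /\ forall t, c (t + 1) = c t.

Definition freely_homotopic (c0 c1 : R -> X) : Prop :=
  exists H : R * R -> X,
    [/\ {within `[0, 1]%classic `*` setT, continuous H},
        forall s t, 0 <= s <= 1 -> H (s, t + 1) = H (s, t),
        forall t, H (0, t) = c0 t &
        forall t, H (1, t) = c1 t].

Definition nontrivial (c : R -> X) : Prop :=
  ~ exists x : X, freely_homotopic c (cst x).

(* Lengths are measured on Lipschitz parametrizations; every rectifiable curve
   has one, proportional to arc length, in its free homotopy class. *)
Definition lipschitz_curve (c : R -> X) : Prop :=
  forall i t, dom i (c t) ->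
    exists k : R, \forall s \near t & u \near t,
      `|chart i (c s) - chart i (c u)| <= k * `|s - u|.

(* \int_c rho |dz|; a Lipschitz function is derivable almost everywhere, and
   the remaining null set is left out of the domain of integration. *)
Definition curve_length (rho : conformalMetric) (c : R -> X) : \bar R :=
  (\sum_(i < nb_charts X)
     \int[@lebesgue_measure R]_(t in
         [set t | [/\ `[0%R, 1%R]%classic t, cell i (c t) &
                      derivable ((chart i \o c) : R^o -> _) t 1%R]])
       (rho i (chart i (c t)) *
        modulus ('D_1%R ((chart i \o c) : R^o -> _) t))%:E)%E.

Definition class_length (rho : conformalMetric) (c : R -> X) : \bar R :=
  ereal_inf [set curve_length rho c' | c' in
    [set c' | [/\ closed_curve c', lipschitz_curve c' &
                  freely_homotopic c c']]].

(* At least one component, so that the weighted multi-curve is not zero. *)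
Record weightedMulticurve := WeightedMulticurve {
  last_index : nat;
  weight : 'I_last_index.+1 -> R;
  component : 'I_last_index.+1 -> R -> X;
  weight_gt0 : forall k, 0 < weight k;
  component_closed : forall k, closed_curve (component k);
  component_nontrivial : forall k, nontrivial (component k)
}.

Definition multicurve_length (rho : conformalMetric) (c : weightedMulticurve) :
    \bar R :=
  (\sum_(k < (last_index c).+1)
     (weight k)%:E * class_length rho (component k))%E.

Definition extremal_ratio (rho : conformalMetric) (c : weightedMulticurve) :
    \bar R :=
  (multicurve_length rho c * multicurve_length rho c / area rho)%E.

Definition Ext (c : weightedMulticurve) : \bar R :=
  ereal_sup [set extremal_ratio rho c | rho in allowable].

Definition extremal_metric (rho : conformalMetric) (c : weightedMulticurve) :
    Prop :=
  allowable rho /\ Ext c = extremal_ratio rho c.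

(* Locally the pull-back of |dw| / Im w, the metric of curvature -1 on the
   upper half plane, under a locally injective holomorphic map (completeness is
   automatic on a closed surface). *)
Definition hyperbolic_metric (rho : conformalMetric) : Prop :=
  forall i x, dom i x ->
    exists f : R * R -> R * R, \forall z \near chart i x,
      [/\ holomorphic_at f z, cderiv f z != 0, 0 < (f z).2 &
          rho i z = modulus (cderiv f z) / (f z).2].

End ExtremalLength.

(* Main.v *)
(* On a closed surface the hyperbolic metric is locally isometric to the upper
   half plane, uniformly at some scale. Each class of the multi-curve has positive
   length l_i, almost attained by geodesic polygons with a bounded number of
   vertices. Two almost shortest polygons of one class with corresponding vertices
   close to each other are homotopic to the polygon of midpoints, so convexity of
   the distance is almost an equality and the two polygons nearly run along the
   same geodesic. Since a horocycle meets a geodesic at most twice, compactness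
   then shows that almost shortest curves cannot pass near all points of a
   horocycle arc: there are p and delta > 0 such that every curve in class i
   through the delta-ball at p has length at least l_i + delta. Multiplying the
   metric near p by a factor k < 1 close to 1 shortens no class but decreases the
   area, so the hyperbolic metric does not maximise length^2 / area. *)
From HB Require Import structures.
From mathcomp Require Import all_boot all_order all_algebra.
From mathcomp Require Import all_classical all_reals all_analysis.
From mathcomp Require Import measurable_realfun.
From mathcomp Require Import ring lra.
Require Import Defs.
Set Implicit Arguments.
Unset Strict Implicit.
Unset Printing Implicit Defensive.
Import Order.TTheory GRing.Theory Num.Theory.
Import numFieldNormedType.Exports.
Local Open Scope classical_set_scope.
Local Open Scope ring_scope.

(** Two things shape the proof. The hyperbolic metric is known only through germs of maps that are
    differentiable at each point, with no continuity of the derivative; inverting them takes a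
    Cauchy estimate, which makes a holomorphic map strictly differentiable. And there is neither a
    universal cover nor a geodesic representative: all comparisons take place at one scale, where
    distances and midpoints do not depend on the ball chart, and a minimiser is replaced by polygons
    with a fixed number of vertices. Compactness is then the pigeonhole principle for the positions
    of the vertices in a finite net. Only vertex 0 is prescribed, at a point of the horocycle; for
    three polygons of the same colour the determinant of the three prescribed vertices is a
    Vandermonde product, bounded below, whereas near-minimality makes it small. Lengths are
    integrals over the points of differentiability, so bounding a distance by a length requires that
    a Lipschitz function be the integral of its derivative. *)

(** * Continuity induction, a pigeonhole principle, integrals over segments *)

(** The supremum of the t such that P holds on [0, t] belongs to this set by the first hypothesis
    and cannot be below 1 by the second. At t = 0 the first hypothesis is the base case. *)
Lemma real_induction (R : realType) (P : R -> Prop) :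
  (forall t, 0 <= t <= 1 -> (forall s, 0 <= s < t -> P s) -> P t) ->
  (forall t, 0 <= t < 1 -> (forall s, 0 <= s <= t -> P s) ->
    exists2 e, 0 < e & forall s, t < s < t + e -> P s) ->
  forall t, 0 <= t <= 1 -> P t.
Proof.
move=> Pclosed Popen.
pose S := [set t : R | 0 <= t <= 1 /\ forall s, 0 <= s <= t -> P s].
have S0 : S 0.
  split=> [|s s0]; first by rewrite lexx ler01.
  have -> : s = 0 by apply/eqP; rewrite eq_le andbC.
  by apply: Pclosed => [|u u0]; [rewrite lexx ler01 | lra].
have ubS : has_ubound S by exists 1 => t [/andP[]].
have m0 : 0 <= sup S by apply: ub_le_sup S0.
have m1 : sup S <= 1 by apply: ge_sup; [exists 0 | move=> t [/andP[]]].
have Plt s : 0 <= s < sup S -> P s.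
  move=> /andP[s0 sm]; have [|t [_ Pt] st] := sup_gt _ sm; first by exists 0.
  by apply: Pt; rewrite s0 ltW.
have Ple s : 0 <= s <= sup S -> P s.
  move=> /andP[s0]; rewrite le_eqVlt => /predU1P[->|sm]; last by apply: Plt; rewrite s0.
  by apply: Pclosed => //; rewrite m0.
have [lt1|ge1] := ltP (sup S) 1; last first.
  by move=> t /andP[t0 t1]; apply: Ple; rewrite t0 (le_trans t1).
have [|e e0 Pe] := Popen (sup S) _ Ple; first by rewrite m0.
exfalso; pose t := Num.min (sup S + e / 2) 1.
have tS : S t.
  have t0 : 0 <= t by rewrite le_min ler01 andbT addr_ge0// divr_ge0// ltW.
  split=> [|s /andP[s0 st]]; first by rewrite t0 ge_min lexx orbT.
  have [sm|ms] := leP s (sup S); first by apply: Ple; rewrite s0.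
  apply: Pe; rewrite ms; move: st; rewrite le_min => /andP[st _]; lra.
have : t <= sup S by apply: ub_le_sup tS.
by rewrite ge_min => /orP[|]; lra.
Qed.

(** A mean value inequality from bounds around each point, whose radius may depend on the point:
    [real_induction] propagates |psi t - psi 0| <= K t along [0, 1]. *)
Lemma pointwise_lipschitz (R : realType) (psi : R -> R) (K : R) :
  (forall t, 0 <= t <= 1 -> exists2 e, 0 < e & forall s, 0 <= s <= 1 ->
     `|s - t| < e -> `|psi s - psi t| <= K * `|s - t|) ->
  `|psi 1 - psi 0| <= K.
Proof.
move=> H.
suff: forall t, 0 <= t <= 1 -> `|psi t - psi 0| <= K * t.
  by move=> /(_ 1); rewrite mulr1; apply; rewrite lexx ler01.
apply: real_induction => [t t01 IH|t /andP[t0 t1] IH].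
  have [e e0 He] := H t t01; have /andP[t0 t1] := t01.
  have [->|tn0] := eqVneq t 0; first by rewrite subrr normr0 mulr0.
  pose s := Num.max 0 (t - e / 2).
  have s0 : 0 <= s by rewrite le_max lexx.
  have st : s < t by rewrite gt_max lt_neqAle eq_sym tn0 t0/= gtrBl divr_gt0.
  have ts : t - s < e.
    have : t - e / 2 <= s by rewrite le_max lexx orbT.
    by lra.
  have := IH s; rewrite s0 st => /(_ isT) h1.
  have := He s; rewrite s0 (ltW (lt_le_trans st t1)) => /(_ isT).
  rewrite distrC (gtr0_norm (x := t - s)) ?subr_gt0// => /(_ ts) h2.
  rewrite -(subrK (psi s) (psi t)) -addrA (le_trans (ler_normD _ _))//.
  by rewrite distrC; nra.
have [|e e0 He] := H t; first by rewrite t0 ltW.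
exists (Num.min e (1 - t)); first by rewrite lt_min e0 subr_gt0.
move=> s /andP[ts]; rewrite -ltrBlDl lt_min => /andP[se s1].
have := IH t; rewrite t0 lexx => /(_ isT) h1.
have := He s; rewrite (gtr0_norm (x := s - t)) ?subr_gt0// => /(_ _ se) h2.
have {}h2 := h2 ltac:(lra).
rewrite -(subrK (psi t) (psi s)) -addrA (le_trans (ler_normD _ _))//.
by nra.
Qed.

(** Three equal values are required because any two points lie on a geodesic; a contradiction with a
    horocycle takes three. *)
Lemma pigeonhole3 (I T : finType) (f : I -> T) : (2 * #|T| < #|I|)%N ->
  exists i j k, [/\ i != j, i != k, j != k, f i = f j & f i = f k].
Proof.
move=> h.
have [t ht] : exists t, (2 < #|[pred i | f i == t]|)%N.
  apply/existsP; apply: contraLR h => /existsPn/= h; rewrite -leqNgt.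
  rewrite -sum1_card (partition_big f predT)//= mulnC -sum_nat_const.
  apply: leq_sum => t _; have := h t; rewrite -leqNgt => {h} h.
  by apply: leq_trans h; rewrite sum1_card.
case/card_gt2P: ht => i [j [k [[]]]]; rewrite !inE => /eqP ti /eqP tj /eqP tk [ij jk ki].
by exists i, j, k; split=> //; rewrite ?ti ?tj ?tk// eq_sym.
Qed.

Section IntervalIntegral.
Variable R : realType.
Local Notation mu := (@lebesgue_measure R).
Implicit Types (h : R -> R) (a b c : R).

Lemma integrable_segment h a b : (forall t, a <= t <= b -> {for t, continuous h}) ->
  mu.-integrable `[a, b] (EFin \o h).
Proof.
move=> ch; apply: continuous_compact_integrable; first exact: segment_compact.
by apply/continuous_in_subspaceT => t; rewrite inE/= in_itv/= => /ch.
Qed.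

Lemma segment_integral_split h a b c : a <= b <= c ->
  (forall t, a <= t <= c -> {for t, continuous h}) ->
  \int[mu]_(t in `[a, c]) h t =
  \int[mu]_(t in `[a, b]) h t + \int[mu]_(t in `[b, c]) h t.
Proof.
move=> /andP[ab bc] ch; have ih := integrable_segment ch.
rewrite -(@Rintegral_itv_obnd_cbnd R b (BRight c)); last first.
  apply: integrableS ih => //; apply: subset_itvr; rewrite bnd_simp //.
by rewrite -(Rintegral_itvB (x := b) ih) ?bnd_simp// addrC subrK.
Qed.

Lemma segment_measure a b : a <= b -> fine (mu `[a, b]) = b - a.
Proof.
rewrite le_eqVlt => /predU1P[->|ab]; rewrite lebesgue_measure_itv/= lte_fin.
  by rewrite ltxx subrr.
by rewrite ab.
Qed.

Lemma segment_integral_cst (k a b : R) : a <= b ->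
  \int[mu]_(t in `[a, b]) k = k * (b - a).
Proof. by move=> ab; rewrite Rintegral_cst//= segment_measure. Qed.

Lemma segment_integral_ge h a b k : a <= b ->
  (forall t, a <= t <= b -> {for t, continuous h}) ->
  (forall t, a <= t <= b -> k <= h t) ->
  k * (b - a) <= \int[mu]_(t in `[a, b]) h t.
Proof.
move=> ab ch kh; rewrite -segment_integral_cst//; apply: le_Rintegral => //.
- by apply: (@integrable_segment (fun=> k)) => t _; exact: cst_continuous.
- exact: integrable_segment.
Qed.

Lemma segment_integral_le h a b k : a <= b ->
  (forall t, a <= t <= b -> {for t, continuous h}) ->
  (forall t, a <= t <= b -> h t <= k) ->
  \int[mu]_(t in `[a, b]) h t <= k * (b - a).
Proof.
move=> ab ch kh; rewrite -segment_integral_cst//; apply: le_Rintegral => //.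
- exact: integrable_segment.
- by apply: (@integrable_segment (fun=> k)) => t _; exact: cst_continuous.
Qed.

Lemma segment_integralD h1 h2 a b :
  (forall t, a <= t <= b -> {for t, continuous h1}) ->
  (forall t, a <= t <= b -> {for t, continuous h2}) ->
  \int[mu]_(t in `[a, b]) (h1 t + h2 t) =
  \int[mu]_(t in `[a, b]) h1 t + \int[mu]_(t in `[a, b]) h2 t.
Proof. by move=> c1 c2; rewrite RintegralD//; exact: integrable_segment. Qed.

End IntervalIntegral.

(** * Complex differentiability and inverse functions *)

Section ComplexArithmetic.
Variable R : realType.
Implicit Types (z w a b l : R * R).

Lemma norm_pair z : `|z| = Num.max `|z.1| `|z.2|.
Proof. by rewrite prod_normE. Qed.

Lemma norm_fst_le z : `|z.1| <= `|z|.
Proof. by rewrite norm_pair le_max lexx. Qed.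

Lemma norm_snd_le z : `|z.2| <= `|z|.
Proof. by rewrite norm_pair le_max lexx orbT. Qed.

Lemma norm_pair_le z (k : R) : `|z.1| <= k -> `|z.2| <= k -> `|z| <= k.
Proof. by move=> h1 h2; rewrite norm_pair ge_max h1. Qed.

Lemma cmulC z w : cmul z w = cmul w z.
Proof. by rewrite /cmul; congr (_, _); ring. Qed.

Lemma cmulA z w l : cmul z (cmul w l) = cmul (cmul z w) l.
Proof. by rewrite /cmul/=; congr (_, _); ring. Qed.

Lemma cmulDl z w l : cmul (z + w) l = cmul z l + cmul w l.
Proof. by rewrite /cmul/=; congr (_, _) => /=; ring. Qed.

Lemma cmulDr z w l : cmul z (w + l) = cmul z w + cmul z l.
Proof. by rewrite /cmul/=; congr (_, _) => /=; ring. Qed.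

Lemma cmulBl z w l : cmul (z - w) l = cmul z l - cmul w l.
Proof. by rewrite /cmul/=; congr (_, _) => /=; ring. Qed.

Lemma cmulBr z w l : cmul z (w - l) = cmul z w - cmul z l.
Proof. by rewrite /cmul/=; congr (_, _) => /=; ring. Qed.

(** The norm is the sup norm, which is submultiplicative only up to this factor 2; several constants
    below come from it. *)
Lemma norm_cmul z w : `|cmul z w| <= 2 * (`|z| * `|w|).
Proof.
have z1 := norm_fst_le z; have z2 := norm_snd_le z.
have w1 := norm_fst_le w; have w2 := norm_snd_le w.
apply: norm_pair_le => /=.
  apply: (le_trans (ler_normB _ _)); rewrite !normrM mulr2n mulrDl mul1r.
  by apply: lerD; apply: ler_pM.
apply: (le_trans (ler_normD _ _)); rewrite !normrM mulr2n mulrDl mul1r.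
by apply: lerD; apply: ler_pM.
Qed.

Definition cinv z : R * R :=
  (z.1 / (z.1 ^+ 2 + z.2 ^+ 2), - z.2 / (z.1 ^+ 2 + z.2 ^+ 2)).

Lemma sqr_modulus_gt0 z : z != 0 -> 0 < z.1 ^+ 2 + z.2 ^+ 2.
Proof.
move=> z0; rewrite lt_neqAle addr_ge0 ?sqr_ge0// andbT eq_sym.
rewrite paddr_eq0 ?sqr_ge0// !sqrf_eq0; apply: contra z0 => /andP[/eqP a /eqP b].
by apply/eqP; case: z a b => /= ? ? -> ->.
Qed.

Lemma cmul_inv z : z != 0 -> cmul z (cinv z) = (1, 0).
Proof.
move=> /sqr_modulus_gt0 z0; have zn := lt0r_neq0 z0.
by rewrite /cmul/cinv/=; congr (_, _); field.
Qed.

Lemma cmul1 z : cmul z (1, 0) = z.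
Proof. by case: z => x y; rewrite /cmul/=; congr (_, _); ring. Qed.

Lemma norm_sqr_le z : `|z| ^+ 2 <= z.1 ^+ 2 + z.2 ^+ 2.
Proof.
rewrite norm_pair /Num.max; case: ifP => _; rewrite real_normK ?num_real//.
  by rewrite lerDr sqr_ge0.
by rewrite lerDl sqr_ge0.
Qed.

Lemma norm_cinv z : `|cinv z| <= `|z|^-1.
Proof.
have [->|z0] := eqVneq z 0.
  rewrite normr0 invr0; apply: norm_pair_le => /=; first by rewrite mul0r normr0.
  by rewrite oppr0 mul0r normr0.
have zp : 0 < `|z| by rewrite normr_gt0.
have S := sqr_modulus_gt0 z0.
have K (k : R) : `|k| <= `|z| -> `|k / (z.1 ^+ 2 + z.2 ^+ 2)| <= `|z|^-1.
  move=> kz; rewrite normrM normfV (gtr0_norm S) ler_pdivrMr//.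
  by rewrite mulrC ler_pdivlMr// (le_trans _ (norm_sqr_le z))// expr2 ler_pM2r.
by apply: norm_pair_le => /=; apply: K; rewrite ?normrN ?norm_fst_le ?norm_snd_le.
Qed.

End ComplexArithmetic.

Section PlaneNeighborhoods.
Variable R : realType.
Implicit Types (b z : R * R) (d : R).

Lemma near_norm_lt b d : 0 < d -> \forall z \near b, `|z - b| < d.
Proof.
move=> d0; apply/(@nbhs_ballP _ (R * R)%type); exists d => //= z.
by rewrite -ball_normE/= distrC.
Qed.

Lemma near_normP (P : set (R * R)) b : (\forall z \near b, P z) ->
  exists2 d, 0 < d & forall z, `|z - b| < d -> P z.
Proof.
move=> /(@nbhs_ballP _ (R * R)%type)[d /= d0 H]; exists d => // z zb.
by apply: H; rewrite -ball_normE/= distrC.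
Qed.

Lemma near_norm_ltR (x d : R) : 0 < d -> \forall y \near x, `|y - x| < d.
Proof.
move=> d0; apply/nbhs_ballP; exists d => //= y.
by rewrite -ball_normE/= distrC.
Qed.

Lemma near_normRP (P : set R) (x : R) : (\forall y \near x, P y) ->
  exists2 d, 0 < d & forall y, `|y - x| < d -> P y.
Proof.
move=> /nbhs_ballP[d /= d0 H]; exists d => // y yx.
by apply: H; rewrite -ball_normE/= distrC.
Qed.

End PlaneNeighborhoods.

Section ComplexDerivative.
Variable R : realType.
Implicit Types (f g : R * R -> R * R) (z w a b l : R * R).

(** Complex differentiability at [b] with derivative [l], written without limits so that errors on
    the sides of a rectangle can be bounded explicitly. *)
Definition cdiff f b l := forall e : R, 0 < e -> exists2 d, 0 < d & forall z,
  `|z - b| < d -> `|f z - f b - cmul l (z - b)| <= e * `|z - b|.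

Lemma holomorphic_cdiff f b : holomorphic_at f b -> cdiff f b (cderiv f b).
Proof.
move=> [/diff_locallyP[_ df] hol] e e0.
move: df => /eqaddoP /(_ e e0).
rewrite !near_simpl/= => /nbhs_ballP[d /= d0 H]; exists d => // z zb.
have := H (z - b); rewrite -ball_normE/= sub0r normrN => /(_ zb).
by rewrite !fctE/= subrK hol opprD addrA.
Qed.

Lemma cdiff_near f b l : cdiff f b l -> forall e : R, `|l| * 2 < e ->
  exists2 d, 0 < d & forall z, `|z - b| < d -> `|f z - f b| <= e * `|z - b|.
Proof.
move=> df e le; have [d d0 H] := df (e - `|l| * 2) ltac:(by rewrite subr_gt0).
exists d => // z zb; rewrite -(subrK (cmul l (z - b)) (f z - f b)).
apply: (le_trans (ler_normD _ _)); have := norm_cmul l (z - b); have := H z zb.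
by rewrite mulrBl; lra.
Qed.

Lemma cdiff_lip f b l : cdiff f b l -> exists2 k, 0 < k & exists2 d, 0 < d &
  forall z, `|z - b| < d -> `|f z - f b| <= k * `|z - b|.
Proof.
move=> df; exists (`|l| * 2 + 1); first by rewrite ltr_wpDl// mulr_ge0.
by apply: (cdiff_near df); rewrite ltrDl.
Qed.

Lemma cdiff_continuous f b l : cdiff f b l -> {for b, continuous f}.
Proof.
move=> /cdiff_lip[k k0 [d d0 H]]; apply/cvgrPdist_lt => e e0.
near=> z.
have zb : `|z - b| < Num.min d (e / k).
  by near: z; apply: near_norm_lt; rewrite lt_min d0 divr_gt0.
rewrite distrC (le_lt_trans (H z _))//; move: zb; rewrite lt_min => /andP[//].
by rewrite ltr_pdivlMr// mulrC.
Unshelve. all: by end_near. Qed.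

(** An error bound up to a constant factor suffices, so the rules for products, inverses and
    composition need not tune their epsilons. *)
Lemma cdiffP f b l (k : R) : 0 < k ->
  (forall e, 0 < e -> e < 1 -> exists2 d, 0 < d & forall z,
     `|z - b| < d -> `|f z - f b - cmul l (z - b)| <= k * e * `|z - b|) -> cdiff f b l.
Proof.
move=> k0 H e e0; have [||d d0 Hd] := H (Num.min (e / k) (1 / 2)).
- by rewrite lt_min divr_gt0//= divr_gt0.
- by rewrite gt_min; apply/orP; right; lra.
exists d => // z zb; apply: (le_trans (Hd z zb)); apply: ler_wpM2r => //.
by rewrite mulrC -ler_pdivlMr// ge_min lexx.
Qed.

Lemma cdiff_mul f g b l m : cdiff f b l -> cdiff g b m ->
  cdiff (fun z => cmul (f z) (g z)) b (cmul l (g b) + cmul (f b) m).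
Proof.
move=> df dg; have [kf kf0 [d1 d10 Lf]] := cdiff_lip df.
have [kg kg0 [d2 d20 Lg]] := cdiff_lip dg.
apply: (@cdiffP _ _ _ (2 * (`|g b| + `|f b| + kf * kg))) => [|e e0 e1].
  by rewrite mulr_gt0// ltr_wpDl// ?addr_ge0// mulr_gt0.
have [d3 d30 Df] := df e e0; have [d4 d40 Dg] := dg e e0.
exists (Num.min (Num.min d1 d2) (Num.min (Num.min d3 d4) e)).
  by rewrite !lt_min d10 d20 d30 d40 e0.
move=> z; rewrite !lt_min => /andP[/andP[z1 z2] /andP[/andP[z3 z4] ze]].
have -> : cmul (f z) (g z) - cmul (f b) (g b) - cmul (cmul l (g b) + cmul (f b) m) (z - b)
  = cmul (f z - f b - cmul l (z - b)) (g b) + cmul (f b) (g z - g b - cmul m (z - b))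
    + cmul (f z - f b) (g z - g b).
  by rewrite /cmul/=; congr (_, _) => /=; ring.
apply: (le_trans (ler_normD _ _)); apply: (le_trans (lerD (ler_normD _ _) (lexx _))).
have n0 := normr_ge0 (z - b).
have h1 : `|cmul (f z - f b - cmul l (z - b)) (g b)| <= 2 * (e * `|z - b| * `|g b|).
  by apply: (le_trans (norm_cmul _ _)); rewrite ler_pM2l// ler_wpM2r// Df.
have h2 : `|cmul (f b) (g z - g b - cmul m (z - b))| <= 2 * (`|f b| * (e * `|z - b|)).
  by apply: (le_trans (norm_cmul _ _)); rewrite ler_pM2l// ler_wpM2l// Dg.
have h3 : `|cmul (f z - f b) (g z - g b)| <= 2 * ((kf * `|z - b|) * (kg * e)).
  apply: (le_trans (norm_cmul _ _)); rewrite ler_pM2l//; apply: ler_pM => //; first exact: Lf.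
  by apply: (le_trans (Lg z z2)); rewrite ler_pM2l// ltW.
apply: (le_trans (lerD (lerD h1 h2) h3)).
lra.
Qed.

Lemma cdiff_affine l a b : cdiff (fun z => cmul l (z - a)) b l.
Proof.
move=> e e0; exists 1 => // z _.
rewrite (_ : _ - _ = 0); first by rewrite normr0 mulr_ge0// ltW.
by rewrite /cmul/=; congr (_, _) => /=; ring.
Qed.

Lemma cdiff_cst a b : cdiff (fun=> a) b 0.
Proof.
move=> e e0; exists 1 => // z _.
by rewrite subrr /cmul/= !mul0r subrr addr0 subr0 normr0 mulr_ge0// ltW.
Qed.

Lemma cdiff_sub f g b l m : cdiff f b l -> cdiff g b m -> cdiff (fun z => f z - g z) b (l - m).
Proof.
move=> df dg; apply: (@cdiffP _ _ _ 2) => // e e0 e1.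
have [d3 d30 Df] := df e e0; have [d4 d40 Dg] := dg e e0.
exists (Num.min d3 d4); first by rewrite lt_min d30.
move=> z; rewrite lt_min => /andP[/Df h1 /Dg h2].
have -> : f z - g z - (f b - g b) - cmul (l - m) (z - b) =
  (f z - f b - cmul l (z - b)) - (g z - g b - cmul m (z - b)).
  by rewrite /cmul/=; congr (_, _) => /=; ring.
apply: (le_trans (ler_normB _ _)); lra.
Qed.

Lemma cdiff_cinv b : b != 0 -> cdiff (@cinv R) b (- cmul (cinv b) (cinv b)).
Proof.
move=> b0; have bp : 0 < `|b| by rewrite normr_gt0.
apply: (@cdiffP _ _ _ (16 * (`|b|^-1 * (`|b|^-1 * (2 * `|b|^-1))))) => [|e e0 e1].
  by rewrite !mulr_gt0// invr_gt0.
exists (Num.min e (`|b| / 2)); first by rewrite lt_min e0 divr_gt0.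
move=> z; rewrite lt_min => /andP[ze zb].
have zz : `|b| / 2 <= `|z|.
  have := ler_normB z (z - b); rewrite opprB addrC subrK; lra.
have z0 : z != 0 by rewrite -normr_gt0 (lt_le_trans _ zz)// divr_gt0.
(* This is 1/z - 1/b + (z - b)/b^2 = (z - b)^2/(b^2 z), quadratic in z - b. *)
have -> : cinv z - cinv b - cmul (- cmul (cinv b) (cinv b)) (z - b) =
   cmul (cmul (cinv b) (cinv b)) (cmul (cinv z) (cmul (z - b) (z - b))).
  have B := lt0r_neq0 (sqr_modulus_gt0 b0); have Z := lt0r_neq0 (sqr_modulus_gt0 z0).
  by rewrite /cmul/cinv/=; congr (_, _) => /=; field; rewrite ?B ?Z.
apply: (le_trans (norm_cmul _ _)).
have h1 : `|cmul (cinv b) (cinv b)| <= 2 * (`|b|^-1 * `|b|^-1).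
  by apply: (le_trans (norm_cmul _ _)); rewrite ler_pM2l//; apply: ler_pM => //; exact: norm_cinv.
have h2 : `|cmul (cinv z) (cmul (z - b) (z - b))| <= 2 * ((2 * `|b|^-1) * (2 * (e * `|z - b|))).
  apply: (le_trans (norm_cmul _ _)); rewrite ler_pM2l//; apply: ler_pM => //.
    apply: (le_trans (norm_cinv _)); rewrite -[2]invrK -invfM lef_pV2 ?posrE ?normr_gt0// ?mulr_gt0 ?invr_gt0//.
    by rewrite mulrC.
  by apply: (le_trans (norm_cmul _ _)); rewrite ler_pM2l// ler_wpM2r// ltW.
apply: (le_trans (ler_pM _ _ (lexx 2) (ler_pM _ _ h1 h2))) => //.
lra.
Qed.

End ComplexDerivative.

(** * Contour integrals: Goursat's theorem on rectangles and on the frame between two squares *)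

Section Goursat.
Variable R : realType.
Local Notation mu := (@lebesgue_measure R).
Implicit Types (f g : R * R -> R * R) (z w l : R * R) (a b c d : R).

(* Real part of the integral of g dz along the boundary of [a, b] x [c, d]. *)
Definition contour g a b c d : R :=
  \int[mu]_(t in `[a, b]) ((g (t, c)).1 - (g (t, d)).1) +
  \int[mu]_(t in `[c, d]) ((g (a, t)).2 - (g (b, t)).2).

Definition rect a b c d : set (R * R) := [set z | a <= z.1 <= b /\ c <= z.2 <= d].

Definition cont_on g a b c d := forall z, rect a b c d z -> {for z, continuous g}.

Lemma continuous_hline g (t c : R) : {for (t, c), continuous g} ->
  {for t, continuous (fun t => (g (t, c)).1)} /\ {for c, continuous (fun c => (g (t, c)).2)}.
Proof.
move=> /cvgr_dist_lt cg; split; apply/cvgrPdist_lt => e e0;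
  have /near_normP[d d0 H] := cg e e0; near=> s.
- have sd : `|s - t| < d by near: s; exact: near_norm_ltR.
  apply: (le_lt_trans (norm_fst_le (g (t, c) - g (s, c)))); apply: H.
  by rewrite norm_pair/= subrr normr0 gt_max sd d0.
- have sd : `|s - c| < d by near: s; exact: near_norm_ltR.
  apply: (le_lt_trans (norm_snd_le (g (t, c) - g (t, s)))); apply: H.
  by rewrite norm_pair/= subrr normr0 gt_max sd d0.
Unshelve. all: by end_near. Qed.

(* Continuity is only assumed on the segments along which g is integrated,
   so that g may be singular inside the rectangle. *)
Lemma contour_splitx g a m b c d : a <= m <= b -> c <= d ->
  (forall z, rect a b c d z -> z.1 \in [:: a; m; b] \/ z.2 \in [:: c; d] -> {for z, continuous g}) ->
  contour g a b c d = contour g a m c d + contour g m b c d.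
Proof.
move=> /andP[am mb] cd cg; have ab := le_trans am mb.
have Hx t s : a <= t <= b -> s \in [:: c; d] -> {for (t, s), continuous g}.
  move=> tab sE; apply: cg; last by right.
  by split=> //=; move: sE; rewrite !inE => /orP[] /eqP ->; rewrite lexx ?cd.
have Hy t s : t \in [:: a; m; b] -> c <= s <= d -> {for (t, s), continuous g}.
  move=> tE scd; apply: cg; last by left.
  by split=> //=; move: tE; rewrite !inE => /or3P[] /eqP ->; rewrite ?lexx ?ab ?am ?mb.
rewrite /contour (@segment_integral_split _ _ a m b) ?am//; last first.
  by move=> t tab; apply: continuousB; apply: (continuous_hline _).1; apply: Hx; rewrite ?inE ?eqxx ?orbT.
rewrite [RHS]addrACA -segment_integralD; first by congr (_ + _); apply: eq_Rintegral => t _; ring.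
  by move=> t tcd; apply: continuousB; apply: (continuous_hline _).2; apply: Hy; rewrite ?inE ?eqxx ?orbT.
by move=> t tcd; apply: continuousB; apply: (continuous_hline _).2; apply: Hy; rewrite ?inE ?eqxx ?orbT.
Qed.

Lemma contour_splity g a b c m d : a <= b -> c <= m <= d ->
  (forall z, rect a b c d z -> z.1 \in [:: a; b] \/ z.2 \in [:: c; m; d] -> {for z, continuous g}) ->
  contour g a b c d = contour g a b c m + contour g a b m d.
Proof.
move=> ab /andP[cm md] cg; have cd := le_trans cm md.
have Hy t s : t \in [:: a; b] -> c <= s <= d -> {for (t, s), continuous g}.
  move=> tE scd; apply: cg; last by left.
  by split=> //=; move: tE; rewrite !inE => /orP[] /eqP ->; rewrite lexx ?ab.
have Hx t s : a <= t <= b -> s \in [:: c; m; d] -> {for (t, s), continuous g}.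
  move=> tab sE; apply: cg; last by right.
  by split=> //=; move: sE; rewrite !inE => /or3P[] /eqP ->; rewrite ?lexx ?cd ?cm ?md.
rewrite /contour (@segment_integral_split _ _ c m d) ?cm//; last first.
  by move=> t tab; apply: continuousB; apply: (continuous_hline _).2; apply: Hy; rewrite ?inE ?eqxx ?orbT.
rewrite [RHS]addrACA -segment_integralD; first by congr (_ + _); apply: eq_Rintegral => t _; ring.
  by move=> t tcd; apply: continuousB; apply: (continuous_hline _).1; apply: Hx; rewrite ?inE ?eqxx ?orbT.
by move=> t tcd; apply: continuousB; apply: (continuous_hline _).1; apply: Hx; rewrite ?inE ?eqxx ?orbT.
Qed.

Lemma continuous_boundary g a b c d : a <= b -> c <= d ->
  (forall z, rect a b c d z -> z.1 \in [:: a; b] \/ z.2 \in [:: c; d] -> {for z, continuous g}) ->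
  (forall t, a <= t <= b -> {for t, continuous (fun t => (g (t, c)).1 - (g (t, d)).1)}) /\
  (forall t, c <= t <= d -> {for t, continuous (fun t => (g (a, t)).2 - (g (b, t)).2)}).
Proof.
move=> ab cd cg; split=> t ht; apply: continuousB.
- by apply: (continuous_hline _).1; apply: cg; [split; rewrite /= ?lexx ?cd | right; rewrite !inE eqxx].
- by apply: (continuous_hline _).1; apply: cg; [split; rewrite /= ?lexx ?cd | right; rewrite !inE eqxx orbT].
- by apply: (continuous_hline _).2; apply: cg; [split; rewrite /= ?lexx ?ab | left; rewrite !inE eqxx].
- by apply: (continuous_hline _).2; apply: cg; [split; rewrite /= ?lexx ?ab | left; rewrite !inE eqxx orbT].
Qed.

Lemma contour_le g a b c d k : a <= b -> c <= d ->
  (forall z, rect a b c d z -> z.1 \in [:: a; b] \/ z.2 \in [:: c; d] -> {for z, continuous g}) ->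
  (forall t, a <= t <= b -> (g (t, c)).1 - (g (t, d)).1 <= k.1) ->
  (forall t, c <= t <= d -> (g (a, t)).2 - (g (b, t)).2 <= k.2) ->
  contour g a b c d <= k.1 * (b - a) + k.2 * (d - c).
Proof.
move=> ab cd cg h1 h2; have [? ?] := continuous_boundary ab cd cg.
by apply: lerD; apply: segment_integral_le.
Qed.

Lemma contour_ge g a b c d k : a <= b -> c <= d ->
  (forall z, rect a b c d z -> z.1 \in [:: a; b] \/ z.2 \in [:: c; d] -> {for z, continuous g}) ->
  (forall t, a <= t <= b -> k.1 <= (g (t, c)).1 - (g (t, d)).1) ->
  (forall t, c <= t <= d -> k.2 <= (g (a, t)).2 - (g (b, t)).2) ->
  k.1 * (b - a) + k.2 * (d - c) <= contour g a b c d.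
Proof.
move=> ab cd cg h1 h2; have [? ?] := continuous_boundary ab cd cg.
by apply: lerD; apply: segment_integral_ge.
Qed.

(** Between opposite sides the affine part of g differs by the constants l.2 (d - c) and - l.2 (b -
    a), whose contributions to the contour cancel. What remains is an error of at most e times the
    half perimeter on each pair of sides. *)
Lemma cdiff_contour_small g z l : cdiff g z l -> forall e, 0 < e -> exists2 r, 0 < r &
  forall a b c d, a <= b -> c <= d -> cont_on g a b c d -> rect a b c d z ->
    (b - a) + (d - c) < r -> `|contour g a b c d| <= e * ((b - a) + (d - c)) ^+ 2.
Proof.
move=> dg e e0; have [r r0 Hr] := dg (e / 2) ltac:(by rewrite divr_gt0).
exists r => // a b c d ab cd cg [/andP[az zb] /andP[cz zd]]; set D := (b - a) + (d - c) => Dr.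
have key w : rect a b c d w -> `|g w - g z - cmul l (w - z)| <= e / 2 * D.
  move=> [/andP[aw wb] /andP[cw wd]].
  have wz : `|w - z| <= D.
    by apply: norm_pair_le => /=; rewrite ler_norml /D; lra.
  apply: (le_trans (Hr w (le_lt_trans wz Dr))).
  by rewrite ler_pM2l// divr_gt0.
have k1 w w' : rect a b c d w -> rect a b c d w' ->
    `|(g w - g w' - cmul l (w - w')).1| <= e * D /\ `|(g w - g w' - cmul l (w - w')).2| <= e * D.
  move=> rw rw'; have : `|g w - g w' - cmul l (w - w')| <= e * D.
    have -> : g w - g w' - cmul l (w - w') = (g w - g z - cmul l (w - z)) - (g w' - g z - cmul l (w' - z)).
      by rewrite /cmul/=; congr (_, _) => /=; ring.
    apply: (le_trans (ler_normB _ _)); have := key _ rw; have := key _ rw'; lra.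
  by move=> h; split; [apply: le_trans (norm_fst_le _) h | apply: le_trans (norm_snd_le _) h].
have X t : a <= t <= b -> l.2 * (d - c) - e * D <= (g (t, c)).1 - (g (t, d)).1 <= l.2 * (d - c) + e * D.
  move=> tab; have [] := k1 (t, c) (t, d).
  - by split; rewrite /= ?lexx ?cd.
  - by split; rewrite /= ?lexx ?cd.
  rewrite /cmul/= => + _; rewrite ler_norml => /andP[]; lra.
have Y t : c <= t <= d -> - l.2 * (b - a) - e * D <= (g (a, t)).2 - (g (b, t)).2 <= - l.2 * (b - a) + e * D.
  move=> tab; have [] := k1 (a, t) (b, t).
  - by split; rewrite /= ?lexx ?ab.
  - by split; rewrite /= ?lexx ?ab.
  rewrite /cmul/= => _; rewrite ler_norml => /andP[]; lra.
have := @contour_le g a b c d (l.2 * (d - c) + e * D, - l.2 * (b - a) + e * D) ab cd (fun z r _ => cg z r).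
have := @contour_ge g a b c d (l.2 * (d - c) - e * D, - l.2 * (b - a) - e * D) ab cd (fun z r _ => cg z r).
move=> /(_ (fun t h => (andP (X t h)).1) (fun t h => (andP (Y t h)).1)) /= h1.
move=> /(_ (fun t h => (andP (X t h)).2) (fun t h => (andP (Y t h)).2)) /= h2.
have E : e * D ^+ 2 = e * D * (b - a) + e * D * (d - c) by rewrite /D; ring.
by rewrite E ler_norml; apply/andP; split; lra.
Qed.

Lemma contour_quarter g a b c d : a <= b -> c <= d -> cont_on g a b c d ->
  exists p : R * R, [/\ a <= p.1 <= p.1 + (b - a) / 2, p.1 + (b - a) / 2 <= b,
    c <= p.2 <= p.2 + (d - c) / 2, p.2 + (d - c) / 2 <= d &
    `|contour g a b c d| / 4 <=
    `|contour g p.1 (p.1 + (b - a) / 2) p.2 (p.2 + (d - c) / 2)|].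
Proof.
move=> ab cd cg; pose m := a + (b - a) / 2; pose n := c + (d - c) / 2.
have [am mb cn nd] : [/\ a <= m, m <= b, c <= n & n <= d] by rewrite /m/n; split; lra.
have mE : m + (b - a) / 2 = b by rewrite /m; lra.
have nE : n + (d - c) / 2 = d by rewrite /n; lra.
have sub a' b' c' d' : a <= a' -> b' <= b -> c <= c' -> d' <= d -> cont_on g a' b' c' d'.
  move=> ? ? ? ? z [/andP[? ?] /andP[? ?]]; apply: cg; split; apply/andP; split; lra.
have E : contour g a b c d = (contour g a m c n + contour g a m n d) +
                             (contour g m b c n + contour g m b n d).
  rewrite (@contour_splitx g a m b) ?am//; last by move=> z r _; exact: cg.
  by congr (_ + _); rewrite (@contour_splity _ _ _ c n d) ?cn// => z r _; apply: (sub _ _ _ _ _ _ _ _ _ r).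
apply: contrapT => /forallNP H.
have h1 := H (a, c); have h2 := H (a, n); have h3 := H (m, c); have h4 := H (m, n).
move: h1 h2 h3 h4; rewrite /= -/m -/n mE nE.
set T := `|contour g a b c d|.
move=> h1 h2 h3 h4.
have l1 : `|contour g a m c n| < T / 4.
  by rewrite ltNge; apply/negP => h; apply: h1; split; rewrite // ?lexx ?am ?cn.
have l2 : `|contour g a m n d| < T / 4.
  by rewrite ltNge; apply/negP => h; apply: h2; split; rewrite // ?lexx ?am ?cn.
have l3 : `|contour g m b c n| < T / 4.
  by rewrite ltNge; apply/negP => h; apply: h3; split; rewrite // ?lexx ?am ?cn.
have l4 : `|contour g m b n d| < T / 4.
  by rewrite ltNge; apply/negP => h; apply: h4; split; rewrite // ?lexx ?am ?cn.
have : T <= (`|contour g a m c n| + `|contour g a m n d|) + (`|contour g m b c n| + `|contour g m b n d|).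
  by rewrite /T E; apply: (le_trans (ler_normD _ _)); apply: lerD; exact: ler_normD.
lra.
Qed.

Definition cdiff_on g a b c d := forall z, rect a b c d z -> exists l, cdiff g z l.

Lemma cdiff_cont_on g a b c d : cdiff_on g a b c d -> cont_on g a b c d.
Proof. by move=> dg z /dg[l]; exact: cdiff_continuous. Qed.

Lemma contour_nest g a b c d : a <= b -> c <= d -> cont_on g a b c d ->
  exists u : nat -> R * R, forall n,
   [/\ a <= (u n).1 /\ (u n).1 + (b - a) / 2 ^+ n <= b,
       c <= (u n).2 /\ (u n).2 + (d - c) / 2 ^+ n <= d,
       (u n).1 <= (u n.+1).1 /\ (u n.+1).1 + (b - a) / 2 ^+ n.+1 <= (u n).1 + (b - a) / 2 ^+ n,
       (u n).2 <= (u n.+1).2 /\ (u n.+1).2 + (d - c) / 2 ^+ n.+1 <= (u n).2 + (d - c) / 2 ^+ n &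
       `|contour g a b c d| / 4 ^+ n <=
       `|contour g (u n).1 ((u n).1 + (b - a) / 2 ^+ n) (u n).2 ((u n).2 + (d - c) / 2 ^+ n)| ].
Proof.
move=> ab cd cg.
pose good n (p : R * R) := [/\ a <= p.1 /\ p.1 + (b - a) / 2 ^+ n <= b,
       c <= p.2 /\ p.2 + (d - c) / 2 ^+ n <= d &
       `|contour g a b c d| / 4 ^+ n <=
       `|contour g p.1 (p.1 + (b - a) / 2 ^+ n) p.2 (p.2 + (d - c) / 2 ^+ n)| ].
pose next n (p q : R * R) :=
  [/\ p.1 <= q.1, q.1 + (b - a) / 2 ^+ n.+1 <= p.1 + (b - a) / 2 ^+ n,
       p.2 <= q.2 & q.2 + (d - c) / 2 ^+ n.+1 <= p.2 + (d - c) / 2 ^+ n].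
have step n p : good n p -> exists q, good n.+1 q /\ next n p q.
  move=> [[ap pb] [cp pd] ctr].
  have w0 : 0 <= (b - a) / 2 ^+ n by rewrite divr_ge0 ?subr_ge0// exprn_ge0.
  have h0 : 0 <= (d - c) / 2 ^+ n by rewrite divr_ge0 ?subr_ge0// exprn_ge0.
  have [||z [/andP[? ?] /andP[? ?]]|q] := @contour_quarter g p.1 (p.1 + (b - a) / 2 ^+ n) p.2 (p.2 + (d - c) / 2 ^+ n).
  - by rewrite lerDl.
  - by rewrite lerDl.
  - by apply: cg; split; apply/andP; split; lra.
  rewrite !(addrC p.1) !(addrC p.2) !addrK.
  have E (k : R) : k / 2 ^+ n / 2 = k / 2 ^+ n.+1.
    by rewrite exprSr invfM mulrA.
  have E4 (k : R) : k / 4 ^+ n / 4 = k / 4 ^+ n.+1.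
    by rewrite exprSr invfM mulrA.
  rewrite !E => -[/andP[h1 h1'] h2 /andP[h3 h3'] h4 h5]; exists q; split.
    split; [split; lra|split; lra|].
    apply: le_trans h5; rewrite -E4 ler_pM2r ?invr_gt0//.
    by rewrite (addrC p.1) (addrC p.2) in ctr.
  by split; lra.
(* Dependent choice by recursion; where the current corner is not good, which never happens, the
   recursion keeps it unchanged. *)
have [T [HT0 HT]] : exists T : nat -> R * R, good 0%N (T 0%N) /\
    forall n, good n (T n) -> good n.+1 (T n.+1) /\ next n (T n) (T n.+1).
  pose nx n p := if pselect (good n p) is left H then projT1 (cid (step n p H)) else p.
  pose T := fix T n := if n is n'.+1 then nx n' (T n') else (a, c).
  exists T; split; first by rewrite /good/= !expr0 !divr1 !(addrC _ (_ - _)) !subrK !lexx.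
  move=> n gn /=; rewrite /nx; case: pselect => // H; by case: cid.
have gT n : good n (T n) by elim: n => // n /HT[].
exists T => n; have [h1 h2 h3] := gT n; have [_ [? ? ? ?]] := HT n (gT n).
by split.
Qed.

Lemma nested_limit (x w : nat -> R) : (forall n, x n <= x n.+1 /\ x n.+1 + w n.+1 <= x n + w n) ->
  (forall n, 0 <= w n) -> exists v, forall n, x n <= v <= x n + w n.
Proof.
move=> H w0.
have xm m n : (m <= n)%N -> x m <= x n /\ x n + w n <= x m + w m.
  elim: n => [|n IH]; first by rewrite leqn0 => /eqP ->.
  rewrite leq_eqVlt => /predU1P[->//|]; rewrite ltnS => /IH[? ?].
  have [? ?] := H n; split; lra.
have xb m n : x m <= x n + w n.
  have [h|h] := leP m n; first by have [? ?] := xm _ _ h; have := w0 n; lra.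
  by have [? ?] := xm _ _ (ltnW h); have := w0 m; lra.
exists (sup (range x)) => n; apply/andP; split.
  by apply: ub_le_sup; [exists (x 0%N + w 0%N) => _ [m _ <-]; exact: xb | exists n].
by apply: ge_sup; [exists (x 0%N), 0%N | move=> _ [m _ <-]; exact: xb].
Qed.

(** The n-th quarter carries at least 4^-n of the contour, whereas [cdiff_contour_small] at the
    common point of all quarters bounds it by a small multiple of the squared half perimeter, which
    also scales as 4^-n. *)
Lemma goursat g a b c d : a <= b -> c <= d -> cdiff_on g a b c d -> contour g a b c d = 0.
Proof.
move=> ab cd dg; have cg := cdiff_cont_on dg.
apply/eqP; rewrite -normr_le0 leNgt; apply/negP; set k := `|_| => k0.
have [u Hu] := contour_nest ab cd cg.
have w0 n : 0 <= (b - a) / 2 ^+ n by rewrite divr_ge0 ?subr_ge0// exprn_ge0.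
have h0 n : 0 <= (d - c) / 2 ^+ n by rewrite divr_ge0 ?subr_ge0// exprn_ge0.
have [X HX] := @nested_limit (fun n => (u n).1) (fun n => (b - a) / 2 ^+ n) (fun n => let: And5 _ _ h _ _ := Hu n in h) w0.
have [Y HY] := @nested_limit (fun n => (u n).2) (fun n => (d - c) / 2 ^+ n) (fun n => let: And5 _ _ _ h _ := Hu n in h) h0.
pose S := (b - a) + (d - c).
have S0 : 0 <= S by rewrite /S addr_ge0// subr_ge0.
have [|l dl] := dg (X, Y).
  have := HX 0%N; have := HY 0%N; have [[? ?] [? ?] _ _ _] := Hu 0%N.
  rewrite !expr0 !divr1 in w0 h0 * => /andP[? ?] /andP[? ?]; split; apply/andP; split => /=; 
  move: (Hu 0%N) => [[? +] [? +] _ _ _]; rewrite expr0 !divr1; lra.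
(* With this epsilon, epsilon S^2 < k, which is the contradiction. *)
have e0 : 0 < k / (2 * (S ^+ 2 + 1)).
  by rewrite divr_gt0// mulr_gt0// ltr_wpDl// exprn_ge0.
have [r r0 Hr] := cdiff_contour_small dl e0.
have [n nr] : exists n, S / 2 ^+ n < r.
  have := cvg_geometric S (z := 2^-1 : R); rewrite ger0_norm// invf_lt1// => /(_ ltac:(lra)).
  move=> /cvgr_dist_lt /(_ r r0) [n _ /(_ n (leqnn n))] /=.
  by rewrite sub0r normrN => /(le_lt_trans (ler_norm _)) h; exists n; rewrite -exprVn.
have [[h1 h2] [h3 h4] _ _ h5] := Hu n.
have := Hr (u n).1 ((u n).1 + (b - a) / 2 ^+ n) (u n).2 ((u n).2 + (d - c) / 2 ^+ n).
rewrite !lerDl w0 h0 => /(_ isT isT).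
have -> : (u n).1 + (b - a) / 2 ^+ n - (u n).1 + ((u n).2 + (d - c) / 2 ^+ n - (u n).2) = S / 2 ^+ n.
  by rewrite /S mulrDl; ring.
move=> /(_ _ _ nr) h6.
have {}h6 : `|contour g (u n).1 ((u n).1 + (b - a) / 2 ^+ n) (u n).2 ((u n).2 + (d - c) / 2 ^+ n)|
    <= k / (2 * (S ^+ 2 + 1)) * (S / 2 ^+ n) ^+ 2.
  apply: h6; last by split; [exact: HX | exact: HY].
  by move=> z [/andP[? ?] /andP[? ?]]; apply: cg; split; apply/andP; split; lra.
have := le_trans h5 h6.
have -> : (S / 2 ^+ n) ^+ 2 = S ^+ 2 / 4 ^+ n.
  by rewrite exprMn exprVn -exprM mulnC exprM; congr (_ / _ ^+ n); ring.
rewrite -/k mulrA ler_pM2r ?invr_gt0 ?exprn_gt0// leNgt => /negP; apply.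
rewrite mulrAC ltr_pdivrMr; last by rewrite mulr_gt0// ltr_wpDl// exprn_ge0.
rewrite ltr_pM2l//; have S20 : 0 <= S ^+ 2 by rewrite exprn_ge0.
by clear -S20; lra.
Qed.

(** The frame is cut into a left, a right, a bottom and a top rectangle. None of them contains p, so
    [goursat] removes each. *)
Lemma contour_annulus g (p : R * R) (s h : R) : 0 < h -> h <= s ->
  (forall z, `|z - p| <= s -> z != p -> exists l, cdiff g z l) ->
  contour g (p.1 - s) (p.1 + s) (p.2 - s) (p.2 + s) =
  contour g (p.1 - h) (p.1 + h) (p.2 - h) (p.2 + h).
Proof.
move=> h0; rewrite le_eqVlt => /predU1P[->//|hs] dg.
have cg z : rect (p.1 - s) (p.1 + s) (p.2 - s) (p.2 + s) z -> z.1 != p.1 \/ z.2 != p.2 ->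
    exists l, cdiff g z l.
  move=> [/andP[? ?] /andP[? ?]] zp; apply: dg.
    by apply: norm_pair_le => /=; rewrite ler_norml; apply/andP; split; lra.
  by apply/eqP => zE; move: zp; rewrite zE !eqxx => -[].
have cc z : rect (p.1 - s) (p.1 + s) (p.2 - s) (p.2 + s) z -> z.1 != p.1 \/ z.2 != p.2 ->
    {for z, continuous g} by move=> h1 h2; have [l /cdiff_continuous] := cg z h1 h2.
have ne (x y : R) : x < y \/ y < x -> x != y by case=> xy; [rewrite lt_eqF | rewrite gt_eqF].
rewrite (@contour_splitx g (p.1 - s) (p.1 - h)) ?(goursat (a := p.1 - s)); first 1 last.
- by lra.
- by lra.
- by move=> z [/andP[? ?] /andP[? ?]]; apply: cg; [split; apply/andP; split; lra|left; apply: ne; lra].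
- by apply/andP; split; lra.
- by lra.
- move=> z rz [] H; apply: cc => //; [left|right]; apply: ne; move: H; rewrite !inE.
    by case/or3P => /eqP ->; lra.
  by case/orP => /eqP ->; lra.
rewrite add0r (@contour_splitx g (p.1 - h) (p.1 + h)) ?(goursat (b := p.1 + s)); first 1 last.
- by lra.
- by lra.
- by move=> z [/andP[? ?] /andP[? ?]]; apply: cg; [split; apply/andP; split; lra|left; apply: ne; lra].
- by apply/andP; split; lra.
- by lra.
- move=> z [/andP[? ?] /andP[? ?]] H; apply: cc; first by split; apply/andP; split; lra.
  case: H => H; [left|right]; apply: ne; move: H; rewrite !inE.
    by case/or3P => /eqP ->; lra.
  by case/orP => /eqP ->; lra.
rewrite addr0 (@contour_splity g _ _ _ (p.2 - h)) ?(goursat (c := p.2 - s)); first 1 last.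
- by lra.
- by lra.
- by move=> z [/andP[? ?] /andP[? ?]]; apply: cg; [split; apply/andP; split; lra|right; apply: ne; lra].
- by lra.
- by apply/andP; split; lra.
- move=> z [/andP[? ?] /andP[? ?]] H; apply: cc; first by split; apply/andP; split; lra.
  case: H => H; [left|right]; apply: ne; move: H; rewrite !inE.
    by case/orP => /eqP ->; lra.
  by case/or3P => /eqP ->; lra.
rewrite add0r (@contour_splity g _ _ _ (p.2 + h)) ?(goursat (d := p.2 + s)); first 1 last.
- by lra.
- by lra.
- by move=> z [/andP[? ?] /andP[? ?]]; apply: cg; [split; apply/andP; split; lra|right; apply: ne; lra].
- by lra.
- by apply/andP; split; lra.
- move=> z [/andP[? ?] /andP[? ?]] H; apply: cc; first by split; apply/andP; split; lra.
  case: H => H; [left|right]; apply: ne; move: H; rewrite !inE.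
    by case/orP => /eqP ->; lra.
  by case/or3P => /eqP ->; lra.
by rewrite addr0.
Qed.

End Goursat.

(** * Cauchy's estimate and strict differentiability of holomorphic maps *)

Section CauchyEstimate.
Variable R : realType.
Implicit Types (f g : R * R -> R * R) (z w l p : R * R) (h k : R).

Lemma square_boundary p h z : 0 <= h -> rect (p.1 - h) (p.1 + h) (p.2 - h) (p.2 + h) z ->
  z.1 \in [:: p.1 - h; p.1 + h] \/ z.2 \in [:: p.2 - h; p.2 + h] -> `|z - p| = h.
Proof.
move=> h0 [/andP[? ?] /andP[? ?]] H; apply/eqP; rewrite eq_le; apply/andP; split.
  by apply: norm_pair_le => /=; rewrite ler_norml; apply/andP; split; lra.
case: H; rewrite !inE => /orP[] /eqP E.
- by apply: le_trans (norm_fst_le (z - p)); rewrite /= E ler_normr; apply/orP; right; lra.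
- by apply: le_trans (norm_fst_le (z - p)); rewrite /= E ler_normr; apply/orP; left; lra.
- by apply: le_trans (norm_snd_le (z - p)); rewrite /= E ler_normr; apply/orP; right; lra.
- by apply: le_trans (norm_snd_le (z - p)); rewrite /= E ler_normr; apply/orP; left; lra.
Qed.

Lemma contour_square_ge g p h k : 0 < h ->
  (forall z, `|z - p| = h -> {for z, continuous g}) ->
  (forall t, `|t| <= h -> k <= (g (p.1 + t, p.2 - h)).1 - (g (p.1 + t, p.2 + h)).1) ->
  (forall t, `|t| <= h -> k <= (g (p.1 - h, p.2 + t)).2 - (g (p.1 + h, p.2 + t)).2) ->
  4 * h * k <= contour g (p.1 - h) (p.1 + h) (p.2 - h) (p.2 + h).
Proof.
move=> h0 cg k1 k2.
have := @contour_ge _ g (p.1 - h) (p.1 + h) (p.2 - h) (p.2 + h) (k, k).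
have -> : (k, k).1 * (p.1 + h - (p.1 - h)) + (k, k).2 * (p.2 + h - (p.2 - h)) = 4 * h * k by rewrite /=; ring.
apply; [lra | lra | | |].
- by move=> z rz H; apply: cg; apply: square_boundary H; rewrite // ltW.
- move=> t ht; have := k1 (t - p.1); rewrite [p.1 + _]addrC subrK; apply.
  by rewrite ler_norml; apply/andP; split; lra.
- move=> t ht; have := k2 (t - p.2); rewrite [p.2 + _]addrC subrK; apply.
  by rewrite ler_norml; apply/andP; split; lra.
Qed.

Lemma contour_square_le g p h k : 0 < h ->
  (forall z, `|z - p| = h -> {for z, continuous g}) ->
  (forall z, `|z - p| = h -> `|g z| <= k) ->
  contour g (p.1 - h) (p.1 + h) (p.2 - h) (p.2 + h) <= 8 * h * k.
Proof.
move=> h0 cg kg.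
have := @contour_le _ g (p.1 - h) (p.1 + h) (p.2 - h) (p.2 + h) (2 * k, 2 * k).
have -> : (2 * k, 2 * k).1 * (p.1 + h - (p.1 - h)) + (2 * k, 2 * k).2 * (p.2 + h - (p.2 - h)) = 8 * h * k by rewrite /=; ring.
apply; [lra | lra | | |].
- by move=> z rz H; apply: cg; apply: square_boundary H; rewrite // ltW.
- move=> t ht.
  have h1 := kg (t, p.2 - h) (square_boundary (ltW h0) _ _).
  have h2 := kg (t, p.2 + h) (square_boundary (ltW h0) _ _).
  have {}h1 := le_trans (norm_fst_le _) (h1 _ _); have {}h2 := le_trans (norm_fst_le _) (h2 _ _).
  move: h1 h2; rewrite /= !inE !eqxx ?orbT.
  have r1 : rect (p.1 - h) (p.1 + h) (p.2 - h) (p.2 + h) (t, p.2 - h) by split => //=; lra.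
  have r2 : rect (p.1 - h) (p.1 + h) (p.2 - h) (p.2 + h) (t, p.2 + h) by split => //=; lra.
  move=> /(_ r1 (or_intror isT)); rewrite ler_norml => /andP[? ?].
  move=> /(_ r2 (or_intror isT)); rewrite ler_norml => /andP[? ?]; lra.
- move=> t ht.
  have h1 := kg (p.1 - h, t) (square_boundary (ltW h0) _ _).
  have h2 := kg (p.1 + h, t) (square_boundary (ltW h0) _ _).
  have {}h1 := le_trans (norm_snd_le _) (h1 _ _); have {}h2 := le_trans (norm_snd_le _) (h2 _ _).
  move: h1 h2; rewrite /= !inE !eqxx ?orbT.
  have r1 : rect (p.1 - h) (p.1 + h) (p.2 - h) (p.2 + h) (p.1 - h, t) by split => //=; lra.
  have r2 : rect (p.1 - h) (p.1 + h) (p.2 - h) (p.2 + h) (p.1 + h, t) by split => //=; lra.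
  move=> /(_ r1 (or_introl isT)); rewrite ler_norml => /andP[? ?].
  move=> /(_ r2 (or_introl isT)); rewrite ler_norml => /andP[? ?]; lra.
Qed.

Lemma cdiff_shift f p z m : cdiff f (z - p) m -> cdiff (fun w => f (w - p)) z m.
Proof.
move=> df e e0; have [d d0 H] := df e e0; exists d => // w wz.
by have := H (w - p); rewrite opprB addrA subrK; apply.
Qed.

(* The contour integral of k (f z - f p) / (z - p)^2 dz, where k is chosen so
   that k l = - i |l|^2, is the same for all squares centred at p; for small
   squares it is at least about 4 |l|^2. *)
Lemma cauchy_estimate f p l (s M : R) : 0 < s ->
  (forall z, `|z - p| <= s -> exists m, cdiff f z m) -> cdiff f p l ->
  (forall z, `|z - p| <= s -> `|f z - f p| <= M) -> `|l| <= 16 * M / s.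
Proof.
move=> s0 hf dl fM.
have M0 : 0 <= M by apply: le_trans (fM p _); rewrite // subrr normr0 ltW.
have [->|l0] := eqVneq l 0; first by rewrite normr0 divr_ge0 ?mulr_ge0// ltW.
pose k : R * R := (- l.2, - l.1).
have kl : `|k| = `|l| by rewrite !norm_pair /k/= !normrN maxC.
have lp : 0 < `|l| by rewrite normr_gt0.
pose g z := cmul (cmul k (f z - f p)) (cmul (cinv (z - p)) (cinv (z - p))).
have gd z : `|z - p| <= s -> z != p -> exists m, cdiff g z m.
  move=> zs zp; have [m dm] := hf z zs.
  have zp0 : z - p != 0 by rewrite subr_eq0.
  eexists; apply: cdiff_mul.
    by apply: cdiff_mul; [exact: cdiff_cst | apply: cdiff_sub dm _; exact: cdiff_cst].
  apply: (@cdiff_shift (fun w => cmul (cinv w) (cinv w))).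
  by apply: cdiff_mul; exact: cdiff_cinv.
have gc h z : 0 < h <= s -> `|z - p| = h -> {for z, continuous g}.
  move=> /andP[h0 hs] zp; have [||m /cdiff_continuous//] := gd z; first by rewrite zp.
  by rewrite -subr_eq0 -normr_gt0 zp.
pose m := l.1 ^+ 2 + l.2 ^+ 2.
have inv2 w : `|cmul (cinv w) (cinv w)| <= 2 * (`|w|^-1 * `|w|^-1).
  by apply: (le_trans (norm_cmul _ _)); rewrite ler_pM2l//; apply: ler_pM => //; exact: norm_cinv.
have up : contour g (p.1 - s) (p.1 + s) (p.2 - s) (p.2 + s) <= 64 * `|l| * M / s.
  have -> : 64 * `|l| * M / s = 8 * s * (8 * `|l| * M / s ^+ 2) by field; rewrite gt_eqF.
  apply: contour_square_le => // z E; first by apply: gc E; rewrite s0 lexx.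
  apply: (le_trans (norm_cmul _ _)).
  have e1 : `|cmul k (f z - f p)| <= 2 * (`|l| * M).
    by apply: (le_trans (norm_cmul _ _)); rewrite kl ler_pM2l// ler_pM2l// fM// E.
  have := inv2 (z - p); rewrite E => e2.
  have := ler_pM (normr_ge0 _) (normr_ge0 _) e1 e2.
  have -> : 8 * `|l| * M / s ^+ 2 = 2 * (2 * (`|l| * M) * (2 * (s^-1 / s))) by field; rewrite gt_eqF.
  by rewrite ler_pM2l.
have low e : 0 < e -> 4 * m - 64 * `|l| * e <= contour g (p.1 - s) (p.1 + s) (p.2 - s) (p.2 + s).
  move=> e0; have [d d0 Hd] := dl e e0.
  pose h := Num.min s (d / 2).
  have h0 : 0 < h by rewrite lt_min s0 divr_gt0.
  have hs : h <= s by rewrite ge_min lexx.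
  have hd : h < d by rewrite gt_min; apply/orP; right; lra.
  rewrite (contour_annulus h0 hs gd).
  have -> : 4 * m - 64 * `|l| * e = 4 * h * (m / h - 16 * `|l| * e / h) by field; rewrite gt_eqF.
  (* On a small square g is k l / (z - p), with k l = (0, - m), up to an error of order e / h: the
     increment of f has been replaced by its linear part. *)
  have exp z : `|z - p| = h -> exists2 E, g z = cmul (0, - m) (cinv (z - p)) + E & `|E| <= 8 * `|l| * e / h.
    move=> zp; have zp0 : z - p != 0 by rewrite -normr_gt0 zp.
    exists (cmul (cmul k (f z - f p - cmul l (z - p))) (cmul (cinv (z - p)) (cinv (z - p)))).
      have C := cmul_inv zp0.
      have -> : (0, - m) = cmul k l by rewrite /cmul/k/m/=; congr (_, _); ring.
      have -> : cmul (cmul k l) (cinv (z - p)) =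
        cmul (cmul k (cmul l (z - p))) (cmul (cinv (z - p)) (cinv (z - p))).
        rewrite -(cmul1 (cmul (cmul k l) (cinv (z - p)))) -C.
        by rewrite /cmul/=; congr (_, _) => /=; ring.
      by rewrite -cmulDl -cmulDr addrC subrK.
    apply: (le_trans (norm_cmul _ _)).
    have e1 : `|cmul k (f z - f p - cmul l (z - p))| <= 2 * (`|l| * (e * h)).
      apply: (le_trans (norm_cmul _ _)); rewrite kl ler_pM2l// ler_pM2l//.
      by rewrite -[in leRHS]zp Hd// zp.
    have := inv2 (z - p); rewrite zp => e2.
    have := ler_pM (normr_ge0 _) (normr_ge0 _) e1 e2.
    have -> : 8 * `|l| * e / h = 2 * (2 * (`|l| * (e * h)) * (2 * (h^-1 / h))) by field; rewrite gt_eqF.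
    by rewrite ler_pM2l.
  (* On each side the main term is m h / (t^2 + h^2), at least m / (2 h) because |t| <= h; two
     opposite sides give m / h. *)
  have N t : `|t| <= h -> 2 * (m * h / (t ^+ 2 + h ^+ 2)) >= m / h.
    move=> th; have : t ^+ 2 <= h ^+ 2 by rewrite -(real_normK (num_real t)) lerXn2r ?nnegrE// ltW.
    have h20 : 0 < h ^+ 2 by rewrite exprn_gt0.
    have t20 : 0 <= t ^+ 2 by rewrite sqr_ge0.
    move=> H; have m0 : 0 <= m by rewrite addr_ge0 ?sqr_ge0.
    rewrite [leRHS]mulrA mulrA ler_pdivlMr ?ltr_wpDl//.
    have -> : 2 * m * h = m / h * (2 * h ^+ 2) by field; rewrite gt_eqF.
    by apply: ler_wpM2l; [rewrite divr_ge0// ltW | lra].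
  apply: contour_square_ge => //.
  - by move=> z; apply: gc; rewrite h0.
  - move=> t th.
    have n1 : `|((p.1 + t, p.2 - h) - p : R * R)| = h.
      rewrite norm_pair/= (addrC p.1) (addrC p.2) !addrK normrN (gtr0_norm h0).
      by apply/max_idPr.
    have n2 : `|((p.1 + t, p.2 + h) - p : R * R)| = h.
      rewrite norm_pair/= (addrC p.1) (addrC p.2) !addrK (gtr0_norm h0).
      by apply/max_idPr.
    have [E1 -> /(le_trans (norm_fst_le _))] := exp _ n1.
    have [E2 -> /(le_trans (norm_fst_le _))] := exp _ n2.
    rewrite !ler_norml => /andP[? ?] /andP[? ?]; have := N t th.
    rewrite /cmul/cinv/= (addrC p.1) (addrC p.2) !addrK (addrC p.2) addrK sqrrN.
    set q := _ ^+ 2 + _; rewrite !mul0r !sub0r !mulNr opprK => ?.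
    lra.
  - move=> t th.
    have n1 : `|((p.1 - h, p.2 + t) - p : R * R)| = h.
      rewrite norm_pair/= (addrC p.1) (addrC p.2) !addrK normrN (gtr0_norm h0).
      by apply/max_idPl.
    have n2 : `|((p.1 + h, p.2 + t) - p : R * R)| = h.
      rewrite norm_pair/= (addrC p.1) (addrC p.2) !addrK (gtr0_norm h0).
      by apply/max_idPl.
    have [E1 -> /(le_trans (norm_snd_le _))] := exp _ n1.
    have [E2 -> /(le_trans (norm_snd_le _))] := exp _ n2.
    rewrite !ler_norml => /andP[? ?] /andP[? ?]; have := N t th.
    rewrite /cmul/cinv/= (addrC p.1) (addrC p.2) !addrK (addrC p.1) addrK sqrrN (addrC (t ^+ 2)).
    set q := _ ^+ 2 + _; rewrite !mul0r !add0r => ?.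
    lra.
have m2 : `|l| ^+ 2 <= m := norm_sqr_le l.
have {low up} key : 4 * m <= 64 * `|l| * M / s.
  apply/ler_addgt0Pr => e e0; have := le_trans (low (e / (64 * `|l|)) _) up.
  have -> : 64 * `|l| * (e / (64 * `|l|)) = e by field; rewrite gt_eqF.
  by rewrite divr_gt0 ?mulr_gt0// => /(_ isT); lra.
have : `|l| * `|l| <= `|l| * (16 * M / s) by rewrite -expr2; lra.
by rewrite ler_pM2l.
Qed.

Lemma cdiff_lipschitz f (z w : R * R) (k : R) :
  (forall t : R, 0 <= t <= 1 -> exists2 l, cdiff f (w + t *: (z - w)) l & 2 * `|l| < k) ->
  `|f z - f w| <= k * `|z - w|.
Proof.
move=> H.
have [->|zw] := eqVneq z w; first by rewrite !subrr !normr0 mulr0.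
have nz : 0 < `|z - w| by rewrite normr_gt0 subr_eq0.
have key t : 0 <= t <= 1 -> exists2 e, 0 < e & forall s, `|s - t| < e ->
   `|f (w + s *: (z - w)) - f (w + t *: (z - w))| <= k * `|z - w| * `|s - t|.
  move=> /H[l dl lk]; have [d d0 Hd] := cdiff_near dl (e := k) ltac:(by rewrite mulrC).
  exists (d / `|z - w|); first by rewrite divr_gt0.
  move=> s st.
  have E : `|w + s *: (z - w) - (w + t *: (z - w))| = `|s - t| * `|z - w|.
    by rewrite opprD addrACA subrr add0r -scalerBl normrZ.
  rewrite -mulrA (mulrC `|z - w|) -E; apply: Hd; rewrite E.
  by rewrite -ltr_pdivlMr.
have e1 : w + 1 *: (z - w) = z by rewrite scale1r addrC subrK.
have e0 : w + 0 *: (z - w) = w by rewrite scale0r addr0.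
apply: norm_pair_le.
  have := @pointwise_lipschitz _ (fun t => (f (w + t *: (z - w))).1) (k * `|z - w|).
  rewrite e1 e0; apply => t /key[e ep He]; exists e => // s _ /He.
  by apply: le_trans; exact: (norm_fst_le (_ - _)).
have := @pointwise_lipschitz _ (fun t => (f (w + t *: (z - w))).2) (k * `|z - w|).
rewrite e1 e0; apply => t /key[e ep He]; exists e => // s _ /He.
by apply: le_trans; exact: (norm_snd_le (_ - _)).
Qed.

(** Subtracting the linear part leaves g with g z - g p = o(|z - p|). Cauchy's estimate on squares
    of size comparable to the distance d turns this into a small derivative of g throughout a
    neighbourhood of p, and the mean value inequality concludes. No continuity of f' is assumed. *)
Theorem strictly_differentiable f p l : (\forall z \near p, exists m, cdiff f z m) ->
  cdiff f p l -> forall e, 0 < e -> exists2 d, 0 < d & forall z w,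
    `|z - p| < d -> `|w - p| < d -> `|f z - f w - cmul l (z - w)| <= e * `|z - w|.
Proof.
move=> /near_normP[d0 d00 H0] dl e e0.
(* The estimates below end with 128 e', which must be less than e. *)
pose e' := e / 200.
have e'0 : 0 < e' by rewrite divr_gt0.
have [d1 d10 H1] := dl e' e'0.
pose d := Num.min d0 d1.
have dp : 0 < d by rewrite lt_min d00.
pose g z := f z - cmul l z.
have gl z m : cdiff f z m -> cdiff g z (m - l).
  move=> dm; apply: cdiff_sub => //.
  have -> : cmul l = (fun z => cmul l (z - 0)) by apply/funext => w; rewrite subr0.
  exact: cdiff_affine.
have gsmall z : `|z - p| < d -> `|g z - g p| <= e' * `|z - p|.
  move=> zd; have -> : g z - g p = f z - f p - cmul l (z - p).
    by rewrite /g /cmul; congr (_, _) => /=; ring.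
  by apply: H1; apply: lt_le_trans zd _; rewrite ge_min lexx orbT.
exists (d / 4) => [|z w zd wd]; first by rewrite divr_gt0.
have -> : f z - f w - cmul l (z - w) = g z - g w.
  by rewrite /g /cmul; congr (_, _) => /=; ring.
apply: cdiff_lipschitz => t /andP[t0 t1].
set u := w + _.
have ud : `|u - p| < d / 4.
  have -> : u - p = (1 - t) *: (w - p) + t *: (z - p).
    by rewrite /u; case: (z) (w) (p) => ? ? [? ?] [? ?]; congr (_, _) => /=; rewrite /GRing.scale/=; ring.
  apply: (le_lt_trans (ler_normD _ _)); rewrite !normrZ (ger0_norm t0) ger0_norm ?subr_ge0//.
  have [->|tn0] := eqVneq t 0; first by rewrite subr0 mul1r mul0r addr0.
  have tp : 0 < t by rewrite lt_neqAle eq_sym tn0.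
  have a1 : 0 < t * (d / 4 - `|z - p|) by rewrite mulr_gt0// subr_gt0.
  have a2 : 0 <= (1 - t) * (d / 4 - `|w - p|) by rewrite mulr_ge0// subr_ge0// ltW.
  by lra.
have [|m dm] := H0 u.
  by apply: (lt_le_trans ud); rewrite (@le_trans _ _ d)// ?ge_min ?lexx//; lra.
exists (m - l); first exact: gl.
have Hc : `|m - l| <= 16 * (2 * (e' * d)) / (d / 2).
  apply: (cauchy_estimate _ _ (gl _ _ dm)); first by rewrite divr_gt0.
    move=> v vu; have [|mv dv] := H0 v; last by exists (mv - l); exact: gl.
    have : `|v - p| <= `|v - u| + `|u - p| by rewrite -[X in `|X|](_ : v - u + (u - p) = _) ?ler_normD// addrA subrK.
    have : d <= d0 by rewrite ge_min lexx.
    lra.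
  move=> v vu; have vp : `|v - p| < d.
    have : `|v - p| <= `|v - u| + `|u - p| by rewrite -[X in `|X|](_ : v - u + (u - p) = _) ?ler_normD// addrA subrK.
    lra.
  have up : `|u - p| < d by lra.
  have -> : g v - g u = (g v - g p) - (g u - g p) by rewrite /g /cmul; congr (_, _) => /=; ring.
  apply: (le_trans (ler_normB _ _)).
  have h1 := gsmall v vp; have h2 := gsmall u up.
  have h3 : e' * `|v - p| <= e' * d by rewrite ler_pM2l// ltW.
  have h4 : e' * `|u - p| <= e' * d by rewrite ler_pM2l// ltW.
  lra.
apply: (@le_lt_trans _ _ (2 * (16 * (2 * (e' * d)) / (d / 2)))); first by rewrite ler_pM2l.
have -> : 2 * (16 * (2 * (e' * d)) / (d / 2)) = 128 * e' by field; rewrite gt_eqF.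
rewrite /e'; lra.
Qed.
End CauchyEstimate.

(** * The inverse function theorem for strictly differentiable maps *)

Section LocalInverse.
Variable R : realType.
Implicit Types (f : R * R -> R * R) (z w l p : R * R).

(** A minimum point of |T z - z| on the compact ball is fixed, since applying T at least halves this
    quantity. *)
Lemma plane_fixed_point (T : R * R -> R * R) (p : R * R) (r : R) : 0 < r ->
  (forall z, `|z - p| <= r -> `|T z - p| <= r) ->
  (forall z w, `|z - p| <= r -> `|w - p| <= r -> `|T z - T w| <= 2^-1 * `|z - w|) ->
  exists2 z, `|z - p| <= r & T z = z.
Proof.
move=> r0 TU TC.
pose U : set (R * R) := [set z | `|z - p| <= r].
have cU : compact U.
  have -> : U = `[p.1 - r, p.1 + r]%classic `*` `[p.2 - r, p.2 + r]%classic.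
    apply/seteqP; split=> z; rewrite /U/= !in_itv/=.
      move=> zp; have := le_trans (norm_fst_le (z - p)) zp; have := le_trans (norm_snd_le (z - p)) zp.
      by rewrite !ler_norml /= => /andP[? ?] /andP[? ?]; split; apply/andP; split; lra.
    by move=> [/andP[? ?] /andP[? ?]]; apply: norm_pair_le; rewrite ler_norml/=; apply/andP; split; lra.
  by apply: compact_setX; exact: segment_compact.
have U0 : U !=set0 by exists p; rewrite /U/= subrr normr0 ltW.
have [|z Uz zmin] := @compact_EVT_min _ R (fun z => `|T z - z|) U U0 cU.
  apply/subspace_continuousP => z Uz; apply/cvgrPdist_lt => e e0.
  rewrite near_withinE; near=> w => Uw.
  apply: (le_lt_trans (ler_dist_dist _ _)).
  have -> : T z - z - (T w - w) = (T z - T w) - (z - w).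
    by rewrite !opprB addrACA [RHS]addrACA; congr (_ + _); rewrite addrC.
  apply: (le_lt_trans (ler_normB _ _)); have := TC z w Uz Uw.
  have : `|w - z| < e / 2 by near: w; apply: near_norm_lt; rewrite divr_gt0.
  rewrite (distrC w); lra.
have {}Uz : U z by rewrite inE in Uz.
exists z => //; have /zmin : T z \in U by rewrite inE; exact: TU.
have := TC (T z) z (TU z Uz) Uz; have n0 := normr_ge0 (T z - z) => h1 h2.
by apply/eqP; rewrite -subr_eq0 -normr_le0; lra.
Unshelve. all: by end_near. Qed.

(** Up to a map with small Lipschitz constant f is multiplication by l, hence bi-Lipschitz near p. A
    value w is reached at the fixed point of the Newton map z - (f z - w)/l, in which the derivative
    is frozen. *)
Lemma local_inverse f p l (r0 : R) : 0 < r0 -> l != 0 ->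
  (forall e, 0 < e -> exists2 d, 0 < d & forall z w,
    `|z - p| < d -> `|w - p| < d -> `|f z - f w - cmul l (z - w)| <= e * `|z - w|) ->
  exists K r s : R, [/\ 0 < K, 0 < r <= r0, 0 < s,
   (forall z w, `|z - p| < r -> `|w - p| < r ->
     `|z - w| <= K * `|f z - f w| /\ `|f z - f w| <= K * `|z - w|) &
   (forall w, `|w - f p| < s -> exists2 z, `|z - p| < r & f z = w)].
Proof.
move=> r00 l0 H; pose m := cinv l.
have ml w : cmul m (cmul l w) = w.
  by rewrite cmulA (cmulC m) cmul_inv// cmulC cmul1.
have m0 : 0 < `|m|.
  rewrite normr_gt0; apply/eqP => mE; have := ml (1, 0); rewrite mE /cmul/= !mul0r subrr addr0 => -[/eqP].
  by rewrite eq_sym oner_eq0.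
(* Two factors [|m|] and the 2 of [norm_cmul] turn this into a Lipschitz constant 1/4 for the Newton
   map; the radius s below is such that p moves by at most r / 4, so the ball of radius r / 2 is
   preserved. *)
have [d d0 Hd] := H (8 * `|m|)^-1 ltac:(by rewrite invr_gt0 mulr_gt0).
pose r := Num.min d r0.
have r0' : 0 < r by rewrite lt_min d0.
have Hr z w : `|z - p| < r -> `|w - p| < r ->
    `|f z - f w - cmul l (z - w)| <= (8 * `|m|)^-1 * `|z - w|.
  by rewrite !lt_min => /andP[zd _] /andP[wd _]; exact: Hd.
exists (4 * `|m| + 2 * `|l| + (8 * `|m|)^-1), r, (r / 2 / (8 * `|m|)).
have k0 : 0 < (8 * `|m|)^-1 by rewrite invr_gt0 mulr_gt0.
split=> //.
- have : 0 <= 2 * `|l| by rewrite mulr_ge0.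
  by have : 0 < 4 * `|m| by [rewrite mulr_gt0]; lra.
- by rewrite r0' ge_min lexx orbT.
- by rewrite !divr_gt0// mulr_gt0.
- move=> z w zr wr; have h := Hr z w zr wr; have n0 := normr_ge0 (z - w).
  have n1 := normr_ge0 (f z - f w); split; last first.
    rewrite -[in leLHS](subrK (cmul l (z - w)) (f z - f w)); apply: (le_trans (ler_normD _ _)).
    have := norm_cmul l (z - w); have : 0 <= 4 * `|m| * `|z - w| by rewrite !mulr_ge0.
    by set q := (8 * `|m|)^-1 in h k0 *; lra.
  have h1 : `|z - w| <= 2 * (`|m| * `|cmul l (z - w)|) by rewrite -[in leLHS](ml (z - w)) norm_cmul.
  have h2 : `|cmul l (z - w)| <= `|f z - f w| + (8 * `|m|)^-1 * `|z - w|.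
    have := ler_normB (f z - f w) (f z - f w - cmul l (z - w)).
    by rewrite opprB addrC subrK => /le_trans; apply; lra.
  have h3 : `|m| * `|cmul l (z - w)| <= `|m| * `|f z - f w| + 8^-1 * `|z - w|.
    have -> : 8^-1 * `|z - w| = `|m| * ((8 * `|m|)^-1 * `|z - w|) by field; rewrite gt_eqF.
    by rewrite -mulrDr ler_pM2l.
  have : 0 <= (2 * `|l| + (8 * `|m|)^-1) * `|f z - f w| by rewrite mulr_ge0// addr_ge0// ?mulr_ge0// ltW.
  rewrite -[4 * _ + _ + _]addrA (mulrDl (4 * _)).
  by lra.
move=> w ws.
pose T z := z - cmul m (f z - w).
have TT z z' : T z - T z' = - cmul m (f z - f z' - cmul l (z - z')).
  rewrite cmulBr ml /T /cmul; congr (_, _) => /=; ring.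
have TC z z' : `|z - p| < r -> `|z' - p| < r -> `|T z - T z'| <= 4^-1 * `|z - z'|.
  move=> zr zr'; rewrite TT normrN (le_trans (norm_cmul _ _))//.
  have -> : 4^-1 * `|z - z'| = 2 * (`|m| * ((8 * `|m|)^-1 * `|z - z'|)) by field; rewrite gt_eqF.
  by rewrite ler_pM2l// ler_pM2l// Hr.
have Tp : `|T p - p| <= r / 4.
  rewrite /T addrAC subrr add0r normrN (le_trans (norm_cmul _ _))//.
  have -> : r / 4 = 2 * (`|m| * (r / (8 * `|m|))) by field; rewrite gt_eqF.
  rewrite ler_pM2l// ler_pM2l// distrC (le_trans (ltW ws))//.
  by rewrite ler_pM2r//; lra.
have [|z zr|z z' zr zr'|z zr Tz] := @plane_fixed_point T p (r / 2).
- by rewrite divr_gt0.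
- rewrite -(subrK (T p) (T z)) -addrA (le_trans (ler_normD _ _))//.
  have := TC z p; rewrite subrr normr0 => /(_ ltac:(lra) r0'); lra.
- by have := TC z z' ltac:(lra) ltac:(lra); have := normr_ge0 (z - z'); lra.
exists z; first lra.
have : cmul m (f z - w) = 0 by rewrite -(subKr z (cmul m _)) -[X in _ - X]/(T z) Tz subrr.
move=> /(congr1 (cmul l)); rewrite cmulA cmul_inv// cmulC cmul1 => E.
apply/eqP; rewrite -subr_eq0 E /cmul/= !mulr0 subrr addr0//.
Qed.

Lemma cdiff_unique f p l l' : cdiff f p l -> cdiff f p l' -> l = l'.
Proof.
move=> dl dl'; apply/eqP; rewrite -subr_eq0 -normr_le0; apply/ler_addgt0Pr => e e0.
have [d d0 Hd] := dl (e / 2) ltac:(by rewrite divr_gt0).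
have [d' d'0 Hd'] := dl' (e / 2) ltac:(by rewrite divr_gt0).
pose t := Num.min d d' / 2.
have t0 : 0 < t by rewrite divr_gt0// lt_min d0.
have [td td'] : t < d /\ t < d'.
  have : Num.min d d' <= d by rewrite ge_min lexx.
  have : Num.min d d' <= d' by rewrite ge_min lexx orbT.
  by move: t0; rewrite /t; lra.
have nt : `|((t, 0) : R * R)| = t.
  by rewrite norm_pair/= normr0 (gtr0_norm t0); apply/max_idPl; rewrite ltW.
have := Hd (p + (t, 0)); rewrite addrC addKr nt => /(_ td) h1.
have := Hd' (p + (t, 0)); rewrite addrC addKr nt => /(_ td') h2.
rewrite add0r -(ler_pM2r t0).
have -> : `|l - l'| * t = `|cmul l (t, 0) - cmul l' (t, 0)|.
  rewrite -cmulBl -{1}(gtr0_norm t0) mulrC -normrZ; congr `|_|.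
  by rewrite /cmul/= !mulr0 subr0 add0r; congr (_, _) => /=; rewrite /GRing.scale/=; ring.
have -> : cmul l (t, 0) - cmul l' (t, 0) =
  (f (p + (t, 0)) - f p - cmul l' (t, 0)) - (f (p + (t, 0)) - f p - cmul l (t, 0)).
  by rewrite /cmul; congr (_, _) => /=; ring.
by apply: (le_trans (ler_normB _ _)); lra.
Qed.

Lemma cdiff_comp f g p l m : cdiff f (g p) l -> cdiff g p m -> cdiff (f \o g) p (cmul l m).
Proof.
move=> df dg; have [k k0 [d1 d10 Lg]] := cdiff_lip dg.
apply: (@cdiffP _ _ _ _ (2 * `|l| + k)) => [|e e0 e1]; first by rewrite ltr_wpDl// mulr_ge0.
have [d2 d20 Df] := df e e0; have [d3 d30 Dg] := dg e e0.
exists (Num.min (Num.min d1 d3) (d2 / k)); first by rewrite !lt_min d10 d30 divr_gt0.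
move=> z; rewrite !lt_min => /andP[/andP[z1 z3] z2] /=.
have gz : `|g z - g p| < d2.
  by apply: le_lt_trans (Lg z z1) _; rewrite mulrC -ltr_pdivlMr.
have -> : f (g z) - f (g p) - cmul (cmul l m) (z - p) =
  (f (g z) - f (g p) - cmul l (g z - g p)) + cmul l (g z - g p - cmul m (z - p)).
  by rewrite /cmul; congr (_, _) => /=; ring.
apply: (le_trans (ler_normD _ _)).
have h1 : `|f (g z) - f (g p) - cmul l (g z - g p)| <= e * (k * `|z - p|).
  by apply: le_trans (Df _ gz) _; rewrite ler_pM2l// Lg.
have h2 : `|cmul l (g z - g p - cmul m (z - p))| <= 2 * (`|l| * (e * `|z - p|)).
  by apply: le_trans (norm_cmul _ _) _; rewrite ler_pM2l// ler_wpM2l// Dg.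
lra.
Qed.

Lemma cdiff_near_eq f g p l : (\forall z \near p, f z = g z) -> cdiff f p l -> cdiff g p l.
Proof.
move=> /near_normP[d0 d00 E] df e /df[d dp H].
exists (Num.min d d0); first by rewrite lt_min dp.
move=> z; rewrite lt_min => /andP[zd zd0]; rewrite -!E ?subrr ?normr0//; exact: H.
Qed.

Lemma cdiff_id p : cdiff id p (1, 0).
Proof.
move=> e e0; exists 1 => // z _; rewrite cmulC cmul1 subrr normr0 mulr_ge0// ltW//.
Qed.

End LocalInverse.

(** * The hyperbolic plane *)

Section HyperbolicFunctions.
Variable R : realType.
Implicit Types x y : R.

Definition cosh x : R := (expR x + expR (- x)) / 2.
Definition sinh x : R := (expR x - expR (- x)) / 2.

Lemma cosh0 : cosh 0 = 1. Proof. by rewrite /cosh oppr0 expR0; field. Qed.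
Lemma coshN x : cosh (- x) = cosh x. Proof. by rewrite /cosh opprK addrC. Qed.
Lemma sinhN x : sinh (- x) = - sinh x. Proof. by rewrite /sinh opprK -mulNr opprB. Qed.

Lemma coshD x y : cosh (x + y) = cosh x * cosh y + sinh x * sinh y.
Proof. by rewrite /cosh/sinh opprD !expRD; field. Qed.

Lemma sinhD x y : sinh (x + y) = sinh x * cosh y + cosh x * sinh y.
Proof. by rewrite /cosh/sinh opprD !expRD; field. Qed.

Lemma cosh_sqr x : cosh x ^+ 2 = 1 + sinh x ^+ 2.
Proof.
have := coshD x (- x); rewrite subrr cosh0 coshN sinhN => E.
by rewrite !expr2 [1]E; ring.
Qed.

Lemma cosh_half x : cosh x = 1 + 2 * sinh (x / 2) ^+ 2.
Proof.
rewrite [in LHS](_ : x = x / 2 + x / 2); last by field.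
rewrite coshD -!expr2 cosh_sqr; ring.
Qed.

Lemma sinh_ge0 x : 0 <= x -> 0 <= sinh x.
Proof. by move=> x0; rewrite /sinh divr_ge0// subr_ge0 ler_expR; lra. Qed.

Lemma sinh_gt0 x : 0 < x -> 0 < sinh x.
Proof. by move=> x0; rewrite /sinh divr_gt0// subr_gt0 ltr_expR; lra. Qed.

Lemma cosh_gt0 x : 0 < cosh x.
Proof. by rewrite /cosh divr_gt0// addr_gt0 ?expR_gt0. Qed.

Lemma cosh_ge0 x : 0 <= cosh x.
Proof. by rewrite ltW// cosh_gt0. Qed.

Lemma ltr_cosh x y : 0 <= x -> x < y -> cosh x < cosh y.
Proof.
move=> x0 xy; rewrite -subr_gt0.
have -> : cosh y - cosh x = 2 * sinh ((y + x) / 2) * sinh ((y - x) / 2).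
  rewrite [in cosh y](_ : y = (y + x) / 2 + (y - x) / 2); last by field.
  rewrite [in cosh x](_ : x = (y + x) / 2 - (y - x) / 2); last by field.
  rewrite !coshD sinhN coshN; ring.
by apply: mulr_gt0; [apply: mulr_gt0 => // |]; apply: sinh_gt0; lra.
Qed.

Lemma ler_cosh x y : 0 <= x -> 0 <= y -> (cosh x <= cosh y) = (x <= y).
Proof.
move=> x0 y0; apply/idP/idP; last first.
  by rewrite le_eqVlt => /predU1P[->//|/(ltr_cosh x0)/ltW].
by apply: contraTT; rewrite -!ltNge => /(ltr_cosh y0).
Qed.

(** The upper bound comes from exp(-x) >= 1 - x, that is, exp(x) (1 - x) <= 1. *)
Lemma expR_near0 x : `|x| <= 2^-1 -> 0 <= expR x - 1 - x <= 2 * x ^+ 2.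
Proof.
move=> x1; have [x2 x3] : - 2^-1 <= x /\ x <= 2^-1 by move: x1; rewrite ler_norml => /andP[].
have e1 := expR_ge1Dx x; apply/andP; split; first lra.
have e2 := expR_ge1Dx (- x).
have E : expR x * expR (- x) = 1 by rewrite expRN divff// gt_eqF// expR_gt0.
have e0 := expR_gt0 x.
have : expR x * (1 - x) <= 1 by rewrite -[leRHS]E ler_pM2l.
move=> h; have h1 : 0 <= x ^+ 2 * (1 - 2 * x) by rewrite mulr_ge0 ?sqr_ge0//; lra.
have : (expR x - 1 - x - 2 * x ^+ 2) * (1 - x) <= 0.
  by rewrite (_ : _ * _ = (expR x * (1 - x) - 1) - x ^+ 2 * (1 - 2 * x)); [lra | ring].
rewrite pmulr_lle0; lra.
Qed.

Lemma sinh_near0 x : `|x| <= 2^-1 -> `|sinh x - x| <= x ^+ 2.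
Proof.
move=> x1; have /andP[h1 h2] := expR_near0 x1.
have := expR_near0 (x := - x); rewrite normrN => /(_ x1); rewrite sqrrN => /andP[h3 h4].
by rewrite /sinh ler_norml; apply/andP; split; lra.
Qed.

Definition arcosh b : R := ln (b + Num.sqrt (b ^+ 2 - 1)).

Lemma arcosh_ge0 b : 1 <= b -> 0 <= arcosh b.
Proof.
by move=> b1; rewrite /arcosh ln_ge0// (le_trans b1)// lerDl sqrtr_ge0.
Qed.

Lemma arcoshK b : 1 <= b -> cosh (arcosh b) = b.
Proof.
move=> b1; have b20 : 0 <= b ^+ 2 - 1 by rewrite subr_ge0 expr_ge1//; lra.
have p0 : 0 < b + Num.sqrt (b ^+ 2 - 1) by rewrite ltr_pwDl ?sqrtr_ge0//; lra.
rewrite /cosh /arcosh expRN lnK ?posrE//.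
have E := sqr_sqrtr b20; set s := Num.sqrt _ in E p0 *.
have : (b + s) * (b - s) = 1 by rewrite mulrC -subr_sqr E; ring.
move=> H; have -> : (b + s)^-1 = b - s by apply: (mulfI (lt0r_neq0 p0)); rewrite H divff// gt_eqF.
by field.
Qed.

Lemma coshK x : 0 <= x -> arcosh (cosh x) = x.
Proof.
move=> x0; have c1 : 1 <= cosh x by rewrite -cosh0 ler_cosh.
apply/eqP; rewrite eq_le; apply/andP; split.
  by rewrite -ler_cosh ?arcosh_ge0// arcoshK.
by rewrite -ler_cosh ?arcosh_ge0// arcoshK.
Qed.

Lemma cosh_ge1 x : 1 <= cosh x.
Proof. by rewrite cosh_half lerDl mulr_ge0// sqr_ge0. Qed.

End HyperbolicFunctions.

Section HyperbolicPlane.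
Variable R : realType.
Implicit Types (z w u v : R * R) (l m s t : R).

(* [hB] is cosh of the hyperbolic distance of the upper half plane. *)
Definition hB z w : R := ((z.1 - w.1) ^+ 2 + z.2 ^+ 2 + w.2 ^+ 2) / (2 * z.2 * w.2).
Definition hd z w : R := arcosh (hB z w).

Lemma hBE z w : 0 < z.2 -> 0 < w.2 ->
  hB z w = 1 + ((z.1 - w.1) ^+ 2 + (z.2 - w.2) ^+ 2) / (2 * z.2 * w.2).
Proof. by move=> z0 w0; rewrite /hB; field; rewrite !gt_eqF. Qed.

Lemma hB_ge1 z w : 0 < z.2 -> 0 < w.2 -> 1 <= hB z w.
Proof.
move=> z0 w0; rewrite hBE// lerDl divr_ge0// ?addr_ge0 ?sqr_ge0//.
by rewrite !mulr_ge0// ltW.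
Qed.

Lemma hBC z w : hB z w = hB w z.
Proof.
rewrite /hB -[(z.1 - w.1) ^+ 2]sqrrN opprB (mulrAC 2) -[_ + z.2 ^+ 2 + _]addrA.
by rewrite (addrC (z.2 ^+ 2)) addrA.
Qed.

Lemma hBxx z : 0 < z.2 -> hB z z = 1.
Proof. by move=> z0; rewrite /hB; field; rewrite gt_eqF. Qed.

Lemma hB_eq1 z w : 0 < z.2 -> 0 < w.2 -> hB z w = 1 -> z = w.
Proof.
move=> z0 w0; rewrite hBE// => /eqP; rewrite -subr_eq0 addrAC subrr add0r.
rewrite mulf_eq0 invr_eq0 !mulf_eq0 !(gt_eqF z0) (gt_eqF w0) pnatr_eq0/= orbF.
rewrite paddr_eq0 ?sqr_ge0// !sqrf_eq0 !subr_eq0 => /andP[/eqP h1 /eqP h2].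
by case: z w h1 h2 {z0 w0} => ? ? [? ?] /= -> ->.
Qed.

Lemma hd_ge0 z w : 0 < z.2 -> 0 < w.2 -> 0 <= hd z w.
Proof. by move=> z0 w0; rewrite arcosh_ge0// hB_ge1. Qed.

Lemma cosh_hd z w : 0 < z.2 -> 0 < w.2 -> cosh (hd z w) = hB z w.
Proof. by move=> z0 w0; rewrite arcoshK// hB_ge1. Qed.

Lemma hdC z w : hd z w = hd w z. Proof. by rewrite /hd hBC. Qed.

Lemma hdxx z : 0 < z.2 -> hd z z = 0.
Proof. by move=> z0; rewrite /hd hBxx// -cosh0 coshK. Qed.

Lemma hd_eq0 z w : 0 < z.2 -> 0 < w.2 -> hd z w = 0 -> z = w.
Proof. by move=> z0 w0 E; apply: hB_eq1 => //; rewrite -cosh_hd// E cosh0. Qed.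

(** The Gram determinant of three points of the hyperboloid model: the determinant of the matrix of
    the values [hB], whose diagonal is 1. It vanishes exactly when the points lie on one
    geodesic. *)
Definition gram u v w : R :=
  1 + 2 * hB u v * hB v w * hB u w - hB u v ^+ 2 - hB v w ^+ 2 - hB u w ^+ 2.

(** The determinant with rows (1, x, x^2 + y^2). It vanishes when the points lie on a vertical line
    or on a circle centred on the real axis, that is, on a geodesic. *)
Definition hdet u v w : R :=
  (v.1 - u.1) * (w.1 ^+ 2 + w.2 ^+ 2 - (u.1 ^+ 2 + u.2 ^+ 2))
  - (w.1 - u.1) * (v.1 ^+ 2 + v.2 ^+ 2 - (u.1 ^+ 2 + u.2 ^+ 2)).

(** [hB] is a bilinear form on the vectors (1, x, x^2 + y^2) / y, so the Gram determinant is the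
    square of their determinant times that of the form, which is 1/4. *)
Lemma gramE u v w : 0 < u.2 -> 0 < v.2 -> 0 < w.2 ->
  gram u v w = (hdet u v w / (2 * u.2 * v.2 * w.2)) ^+ 2.
Proof. by move=> u0 v0 w0; rewrite /gram/hdet/hB; field; rewrite !gt_eqF. Qed.

Lemma gram_ge0 u v w : 0 < u.2 -> 0 < v.2 -> 0 < w.2 -> 0 <= gram u v w.
Proof. by move=> u0 v0 w0; rewrite gramE// sqr_ge0. Qed.

Lemma sinh_hd z w : 0 < z.2 -> 0 < w.2 -> sinh (hd z w) ^+ 2 = hB z w ^+ 2 - 1.
Proof. by move=> z0 w0; rewrite -cosh_hd// cosh_sqr addrAC subrr add0r. Qed.

(** Expanding cosh of the sum and squaring, the inequality becomes the nonnegativity of [gram]. *)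
Lemma hd_triangle v u w : 0 < u.2 -> 0 < v.2 -> 0 < w.2 -> hd u w <= hd u v + hd v w.
Proof.
move=> u0 v0 w0; rewrite -ler_cosh ?addr_ge0 ?hd_ge0// coshD !cosh_hd//.
rewrite -lerBlDl; apply: le_trans (ler_norm _) _.
have S0 : 0 <= sinh (hd u v) * sinh (hd v w).
  by apply: mulr_ge0; apply: sinh_ge0; exact: hd_ge0.
rewrite -ler_sqr ?nnegrE// real_normK ?num_real// exprMn !sinh_hd//.
by rewrite -subr_ge0; have := gram_ge0 u0 v0 w0; rewrite /gram; congr (0 <= _); ring.
Qed.

(* The point [pt l m z w] is the normalisation of the combination
   l psi(z) + m psi(w), where psi z = (1, z.1, |z|^2) / z.2 embeds the upper
   half plane in the hyperboloid p r - q^2 = 1. *)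
Definition pt l m z w : R * R :=
  let p := l / z.2 + m / w.2 in
  let q := l * z.1 / z.2 + m * w.1 / w.2 in
  (q / p, Num.sqrt (l ^+ 2 + m ^+ 2 + 2 * l * m * hB z w) / p).

Section Point.
Variables (l m : R) (z w : R * R).
Hypotheses (l0 : 0 <= l) (m0 : 0 <= m) (lm : 0 < l + m) (z0 : 0 < z.2) (w0 : 0 < w.2).

Let n2 := l ^+ 2 + m ^+ 2 + 2 * l * m * hB z w.

Lemma pt_norm_gt0 : 0 < l ^+ 2 + m ^+ 2 + 2 * l * m * hB z w.
Proof.
have : 0 < (l + m) ^+ 2 by rewrite exprn_gt0.
have := hB_ge1 z0 w0; have : 0 <= l * m by rewrite mulr_ge0.
move=> h1 h2; have : 0 <= l * m * (hB z w - 1) by rewrite mulr_ge0// subr_ge0.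
lra.
Qed.

Let p := l / z.2 + m / w.2.
Let p0 : 0 < p.
Proof.
have h1 : 0 <= l / z.2 by rewrite divr_ge0// ltW.
have h2 : 0 <= m / w.2 by rewrite divr_ge0// ltW.
rewrite lt_neqAle addr_ge0// andbT eq_sym paddr_eq0// !mulf_eq0 !invr_eq0.
rewrite !(gt_eqF z0) !(gt_eqF w0) !orbF; apply/negP => /andP[/eqP a /eqP b].
by move: lm; rewrite a b addr0 ltxx.
Qed.

Lemma pt_gt0 : 0 < (pt l m z w).2.
Proof. by rewrite /pt/= divr_gt0// sqrtr_gt0 pt_norm_gt0. Qed.

Lemma hB_pt u : 0 < u.2 ->
  hB (pt l m z w) u = (l * hB z u + m * hB w u) / Num.sqrt (l ^+ 2 + m ^+ 2 + 2 * l * m * hB z w).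
Proof.
move=> u0; have N := pt_norm_gt0; rewrite /hB /pt/= -/p.
have E : Num.sqrt (l ^+ 2 + m ^+ 2 + 2 * l * m * hB z w) ^+ 2 =
  l ^+ 2 + m ^+ 2 + 2 * l * m * hB z w by rewrite sqr_sqrtr// ltW.
have S0 : 0 < Num.sqrt (l ^+ 2 + m ^+ 2 + 2 * l * m * hB z w) by rewrite sqrtr_gt0.
rewrite -/(hB z w); set S := Num.sqrt _ in E S0 *.
have -> : (((l * z.1 / z.2 + m * w.1 / w.2) / p - u.1) ^+ 2 + (S / p) ^+ 2 + u.2 ^+ 2) =
  ((l * z.1 / z.2 + m * w.1 / w.2 - p * u.1) ^+ 2 + S ^+ 2 + p ^+ 2 * u.2 ^+ 2) / p ^+ 2.
  have gen (a q : R) : q != 0 -> (a / q - u.1) ^+ 2 + (S / q) ^+ 2 + u.2 ^+ 2 =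
    ((a - q * u.1) ^+ 2 + S ^+ 2 + q ^+ 2 * u.2 ^+ 2) / q ^+ 2 by move=> q0; field.
  by apply: gen; rewrite gt_eqF.
rewrite E; have pn := lt0r_neq0 p0; move: pn; rewrite /p /hB => pn; clear E.
have q0 : l * w.2 + m * z.2 != 0.
  apply: contra pn => /eqP h; have -> : l / z.2 + m / w.2 = (l * w.2 + m * z.2) / (z.2 * w.2).
    by field; rewrite !gt_eqF.
  by rewrite h mul0r.
by field; apply/and5P; split => //; exact: lt0r_neq0.
Qed.

(** The point [pt] is a combination of z and w, so its [hB] with u is determined by those of u with
    z and w, and equals 1. Thus anything preserving distances to z and w preserves [pt]. *)
Lemma pt_unique u : 0 < u.2 -> hB u z = hB (pt l m z w) z ->
  hB u w = hB (pt l m z w) w -> u = pt l m z w.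
Proof.
move=> u0 uz uw; symmetry; have P0 := pt_gt0; apply: hB_eq1 => //.
by rewrite hB_pt// (hBC z) (hBC w) uz uw ![hB (pt _ _ _ _) _]hBC -hB_pt// hBxx.
Qed.

End Point.

Definition mid z w := pt 1 1 z w.

Lemma mid_gt0 z w : 0 < z.2 -> 0 < w.2 -> 0 < (mid z w).2.
Proof. by move=> z0 w0; apply: pt_gt0. Qed.

Lemma hB_mid z w u : 0 < z.2 -> 0 < w.2 -> 0 < u.2 ->
  hB (mid z w) u = (hB z u + hB w u) / Num.sqrt (2 + 2 * hB z w).
Proof.
move=> z0 w0 u0; rewrite /mid hB_pt// !mul1r; congr (_ / Num.sqrt _); ring.
Qed.

Lemma mid_norm_gt0 z w : 0 < z.2 -> 0 < w.2 -> 0 < Num.sqrt (2 + 2 * hB z w).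
Proof. by move=> z0 w0; rewrite sqrtr_gt0; have := hB_ge1 z0 w0; lra. Qed.

Lemma midC z w : mid z w = mid w z.
Proof. by rewrite /mid/pt hBC; congr (_, _); rewrite [X in _ / X]addrC// [X in X / _]addrC. Qed.

Lemma cosh_half_hd v w : 0 < v.2 -> 0 < w.2 -> cosh (hd v w / 2) ^+ 2 = (1 + hB v w) / 2.
Proof. by move=> v0 w0; rewrite cosh_sqr -cosh_hd// (cosh_half (hd v w)); field. Qed.

(** The hyperbolic midline theorem with its exact defect: the midline is shorter than half the third
    side by an amount governed by [gram], so near equality forces near collinearity. *)
Lemma midline_defect u v w : 0 < u.2 -> 0 < v.2 -> 0 < w.2 ->
  cosh (hd v w / 2) ^+ 2 - cosh (hd (mid u v) (mid u w)) ^+ 2 =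
  gram u v w / (4 * (1 + hB u v) * (1 + hB u w)).
Proof.
move=> u0 v0 w0; have m0 := mid_gt0 u0 v0; have m0' := mid_gt0 u0 w0.
rewrite cosh_half_hd// cosh_hd// hB_mid// ![hB _ (mid u w)]hBC !hB_mid// hBxx//.
have A := hB_ge1 u0 v0; have B := hB_ge1 u0 w0.
have SA : Num.sqrt (2 + 2 * hB u v) ^+ 2 = 2 + 2 * hB u v by rewrite sqr_sqrtr//; lra.
have SB : Num.sqrt (2 + 2 * hB u w) ^+ 2 = 2 + 2 * hB u w by rewrite sqr_sqrtr//; lra.
have pA := mid_norm_gt0 u0 v0; have pB := mid_norm_gt0 u0 w0.
rewrite -mulrDl !exprMn !exprVn SA SB (hBC w v) (hBC w u) /gram.
by field; rewrite !gt_eqF//; lra.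
Qed.

Lemma midline u v w : 0 < u.2 -> 0 < v.2 -> 0 < w.2 ->
  hd (mid u v) (mid u w) <= hd v w / 2.
Proof.
move=> u0 v0 w0; have m0 := mid_gt0 u0 v0; have m0' := mid_gt0 u0 w0.
rewrite -ler_cosh ?hd_ge0//; last by rewrite divr_ge0// hd_ge0.
rewrite -ler_sqr ?nnegrE ?cosh_ge0// -subr_ge0 midline_defect//.
have A := hB_ge1 u0 v0; have B := hB_ge1 u0 w0.
by rewrite divr_ge0 ?gram_ge0// !mulr_ge0//; lra.
Qed.

(** The diagonal from y0 to x1 cuts the quadrilateral into two triangles. Only one of the two
    midlines is estimated; the other is kept, so that its defect can be exploited. *)
Lemma hd_mid_mid x0 y0 x1 y1 : 0 < x0.2 -> 0 < y0.2 -> 0 < x1.2 -> 0 < y1.2 ->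
  hd (mid x0 y0) (mid x1 y1) <= hd (mid y0 x0) (mid y0 x1) + hd y0 y1 / 2.
Proof.
move=> x00 y00 x10 y10.
apply: le_trans (hd_triangle (v := mid y0 x1) _ _ _) _; rewrite ?mid_gt0//.
rewrite (midC x0) lerD2l (midC y0 x1); exact: midline.
Qed.

Lemma hd_mid_convex x0 y0 x1 y1 : 0 < x0.2 -> 0 < y0.2 -> 0 < x1.2 -> 0 < y1.2 ->
  hd (mid x0 y0) (mid x1 y1) <= (hd x0 x1 + hd y0 y1) / 2.
Proof.
move=> x00 y00 x10 y10; apply: le_trans (hd_mid_mid _ _ _ _) _ => //.
by rewrite mulrDl lerD2r midline.
Qed.

(* Quantitative strict convexity: when the midline of the quadrilateral is almost
   as long as convexity allows, the triangle y0 x0 x1 is almost degenerate. *)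
Lemma gram_bound x0 y0 x1 y1 t k : 0 < x0.2 -> 0 < y0.2 -> 0 < x1.2 -> 0 < y1.2 -> 0 <= t ->
  hd x0 x1 <= 1 -> hB y0 x0 <= k -> hB y0 x1 <= k ->
  (hd x0 x1 + hd y0 y1) / 2 - t <= hd (mid x0 y0) (mid x1 y1) ->
  gram y0 x0 x1 <= 4 * (1 + k) ^+ 2 * (2 * expR 1 ^+ 2 * t).
Proof.
move=> x00 y00 x10 y10 t0 d1 k0 k1 H.
have m0 := mid_gt0 y00 x00; have m0' := mid_gt0 y00 x10.
set h := hd (mid y0 x0) (mid y0 x1); set a := hd x0 x1 / 2.
have h0 : 0 <= h by apply: hd_ge0.
have ha : h <= a by apply: midline.
have a1 : a <= 1 by rewrite /a; lra.
(* The other triangle contributes at most half of its side, so this midline alone carries the whole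
   defect t. *)
have aht : a - h <= t by have := hd_mid_mid x00 y00 x10 y10; rewrite -/h /a; lra.
have D := midline_defect y00 x00 x10; rewrite -/h -/a in D.
have A := hB_ge1 y00 x00; have B := hB_ge1 y00 x10.
have -> : gram y0 x0 x1 = (4 * (1 + hB y0 x0) * (1 + hB y0 x1)) * (cosh a ^+ 2 - cosh h ^+ 2).
  by rewrite D; field; rewrite !gt_eqF//; lra.
have ch0 := cosh_gt0 h.
have dc : 0 <= cosh a - cosh h by rewrite subr_ge0 ler_cosh//; lra.
have ea : cosh a <= expR 1.
  have : expR a <= expR 1 by rewrite ler_expR.
  by have : expR (- a) <= expR 1 by [rewrite ler_expR; lra]; rewrite /cosh; lra.
have dc' : cosh a - cosh h <= expR 1 * t.
  have h1 : expR (h - a) >= 1 + (h - a) := expR_ge1Dx _.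
  have h2 : expR (- a) <= expR (- h) by rewrite ler_expR lerN2.
  have h3 : expR a - expR h <= expR 1 * t.
    have -> : expR a - expR h = expR a * (1 - expR (h - a)).
      by rewrite mulrBr mulr1 -expRD; congr (_ - expR _); ring.
    apply: ler_pM; rewrite ?expR_ge0 ?ler_expR//; last lra.
    by rewrite subr_ge0 -expR0 ler_expR; lra.
  have : 0 <= expR 1 * t by rewrite mulr_ge0// expR_ge0.
  by rewrite /cosh; lra.
have E2 : cosh a ^+ 2 - cosh h ^+ 2 <= 2 * expR 1 ^+ 2 * t.
  rewrite subr_sqr (_ : 2 * _ * t = (expR 1 * t) * (2 * expR 1)); last by ring.
  by apply: ler_pM => //; [have := cosh_gt0 a; lra | lra].
apply: ler_pM => //.
- by rewrite !mulr_ge0//; lra.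
- by rewrite subr_sqr mulr_ge0//; have := cosh_gt0 a; lra.
- rewrite -mulrA ler_pM2l// expr2; apply: ler_pM; lra.
Qed.

(** Hyperbolic analogue of spherical linear interpolation. For z = w both weights vanish and [pt]
    would divide by 0, hence the separate case. *)
Definition geo s z w : R * R :=
  if z == w then z else pt (sinh ((1 - s) * hd z w)) (sinh (s * hd z w)) z w.

Section Geodesic.
Variables (z w : R * R).
Hypotheses (z0 : 0 < z.2) (w0 : 0 < w.2) (zw : z != w).
Let d := hd z w.
Let d0 : 0 < d.
Proof.
rewrite lt_neqAle hd_ge0// andbT eq_sym; apply: contra zw => /eqP h.
by apply/eqP; apply: hd_eq0.
Qed.

Lemma geo_coef s : 0 <= s <= 1 ->
  [/\ 0 <= sinh ((1 - s) * d), 0 <= sinh (s * d) & 0 < sinh ((1 - s) * d) + sinh (s * d)].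
Proof.
move=> /andP[s0 s1].
have h1 : 0 <= sinh ((1 - s) * d) by apply: sinh_ge0; rewrite mulr_ge0 ?subr_ge0// ltW.
have h2 : 0 <= sinh (s * d) by apply: sinh_ge0; rewrite mulr_ge0// ltW.
split=> //; rewrite lt_neqAle addr_ge0// andbT eq_sym paddr_eq0//.
have [->|sn0] := eqVneq s 0.
  by rewrite subr0 mul1r gt_eqF// sinh_gt0.
by rewrite andbC (gt_eqF (sinh_gt0 _))// mulr_gt0// lt_neqAle eq_sym sn0.
Qed.

Lemma geo_norm s : 0 <= s <= 1 ->
  Num.sqrt (sinh ((1 - s) * d) ^+ 2 + sinh (s * d) ^+ 2 +
            2 * sinh ((1 - s) * d) * sinh (s * d) * hB z w) = sinh d.
Proof.
move=> s01; rewrite -cosh_hd// -/d.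
have -> : (1 - s) * d = d - s * d by ring.
rewrite sinhD coshN sinhN -[RHS]ger0_norm; last by rewrite sinh_ge0// ltW.
rewrite -sqrtr_sqr; congr Num.sqrt.
have E1 := cosh_sqr d; have E2 := cosh_sqr (s * d).
set a := sinh d in E1 *; set b := cosh d in E1 *; set e := sinh _ in E2 *; set f := cosh _ in E2 *.
have -> : (a * f + b * - e) ^+ 2 + e ^+ 2 + 2 * (a * f + b * - e) * e * b = a ^+ 2 * f ^+ 2 + e ^+ 2 - b ^+ 2 * e ^+ 2 by ring.
by rewrite E1 E2; ring.
Qed.

Lemma geo_gt0_neq s : 0 <= s <= 1 -> 0 < (geo s z w).2.
Proof. by move=> /geo_coef[? ? ?]; rewrite /geo (negbTE zw) pt_gt0. Qed.

Lemma hB_geo_l s : 0 <= s <= 1 -> hB (geo s z w) z = cosh (s * d).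
Proof.
move=> s01; have [? ? ?] := geo_coef s01; rewrite /geo (negbTE zw) hB_pt// geo_norm//.
have S := sinh_gt0 d0; rewrite hBxx// (hBC w) -cosh_hd// -/d.
have -> : (1 - s) * d = d - s * d by ring.
by rewrite sinhD coshN sinhN; field; rewrite gt_eqF.
Qed.

Lemma hB_geo_r s : 0 <= s <= 1 -> hB (geo s z w) w = cosh ((1 - s) * d).
Proof.
move=> s01; have [? ? ?] := geo_coef s01; rewrite /geo (negbTE zw) hB_pt// geo_norm//.
have S := sinh_gt0 d0; rewrite hBxx// -cosh_hd// -/d.
have {1}-> : s * d = d - (1 - s) * d by ring.
by rewrite [sinh (d - _)]sinhD coshN sinhN; field; rewrite gt_eqF.
Qed.

Lemma hB_geo s t : 0 <= s <= 1 -> 0 <= t <= 1 -> hB (geo s z w) (geo t z w) = cosh ((s - t) * d).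
Proof.
move=> s01 t01; have [? ? ?] := geo_coef s01.
rewrite {1}/geo (negbTE zw) hB_pt ?geo_gt0_neq// geo_norm//.
have S := sinh_gt0 d0; rewrite (hBC z) (hBC w) hB_geo_l// hB_geo_r//.
have -> : (1 - s) * d = d - s * d by ring.
have -> : (1 - t) * d = d - t * d by ring.
have -> : (s - t) * d = s * d - t * d by ring.
rewrite !sinhD !coshD !coshN !sinhN.
by have E1 := cosh_sqr d; field; rewrite gt_eqF.
Qed.
End Geodesic.

Lemma geo_gt0 s z w : 0 < z.2 -> 0 < w.2 -> 0 <= s <= 1 -> 0 < (geo s z w).2.
Proof.
by move=> z0 w0 s01; have [<-|zw] := eqVneq z w; [rewrite /geo eqxx | apply: geo_gt0_neq].
Qed.

Lemma hd_geo s t z w : 0 < z.2 -> 0 < w.2 -> 0 <= s <= 1 -> 0 <= t <= 1 ->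
  hd (geo s z w) (geo t z w) = `|s - t| * hd z w.
Proof.
move=> z0 w0 s01 t01; have [<-|zw] := eqVneq z w.
  by rewrite /geo !eqxx hdxx// mulr0.
rewrite {1}/hd hB_geo//; have d0 : 0 <= hd z w by apply: hd_ge0.
have [h|h] := leP 0 (s - t).
  by rewrite ger0_norm// coshK// mulr_ge0.
by rewrite ltr0_norm// -coshN -mulNr coshK// mulr_ge0// oppr_ge0 ltW.
Qed.

Lemma geo0 z w : 0 < z.2 -> 0 < w.2 -> geo 0 z w = z.
Proof.
move=> z0 w0; have [<-|zw] := eqVneq z w; first by rewrite /geo eqxx.
by apply: hB_eq1; rewrite ?geo_gt0_neq ?lexx ?ler01// hB_geo_l ?lexx ?ler01// mul0r cosh0.
Qed.

Lemma geo1 z w : 0 < z.2 -> 0 < w.2 -> geo 1 z w = w.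
Proof.
move=> z0 w0; have [<-|zw] := eqVneq z w; first by rewrite /geo eqxx.
by apply: hB_eq1; rewrite ?geo_gt0_neq ?lexx ?ler01// hB_geo_r ?lexx ?ler01// subrr mul0r cosh0.
Qed.

Lemma sqr_le_le (x y : R) : 0 <= y -> x ^+ 2 <= y ^+ 2 -> x <= y.
Proof.
move=> y0 h; rewrite leNgt; apply/negP => yx.
have : y ^+ 2 < x ^+ 2 by rewrite ltr_sqr ?nnegrE// ltW// (le_lt_trans y0 yx).
by rewrite ltNge h.
Qed.

Lemma modulus_ge0 z : 0 <= modulus z. Proof. exact: sqrtr_ge0. Qed.

Lemma sqr_modulus z : modulus z ^+ 2 = z.1 ^+ 2 + z.2 ^+ 2.
Proof. by rewrite /modulus sqr_sqrtr// addr_ge0 ?sqr_ge0. Qed.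

Lemma norm_le_modulus z : `|z| <= modulus z.
Proof. by rewrite -ler_sqr ?nnegrE ?modulus_ge0// sqr_modulus norm_sqr_le. Qed.

Lemma modulus_le_norm z : modulus z <= 2 * `|z|.
Proof.
rewrite -ler_sqr ?nnegrE ?modulus_ge0 ?mulr_ge0// sqr_modulus exprMn.
have h1 : z.1 ^+ 2 <= `|z| ^+ 2 by rewrite -real_normK ?num_real// lerXn2r ?nnegrE// norm_fst_le.
have h2 : z.2 ^+ 2 <= `|z| ^+ 2 by rewrite -real_normK ?num_real// lerXn2r ?nnegrE// norm_snd_le.
have : 0 <= `|z| ^+ 2 by rewrite sqr_ge0.
lra.
Qed.

Lemma modulusN z : modulus (- z) = modulus z.
Proof. by rewrite /modulus /= !sqrrN. Qed.

Lemma modulusM z w : modulus (cmul z w) = modulus z * modulus w.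
Proof.
rewrite /modulus -sqrtrM ?addr_ge0 ?sqr_ge0//; congr Num.sqrt; rewrite /cmul/=; ring.
Qed.

Lemma ler_modulusD z w : modulus (z + w) <= modulus z + modulus w.
Proof.
have z0 := modulus_ge0 z; have w0 := modulus_ge0 w.
apply: sqr_le_le; first exact: addr_ge0.
rewrite (sqr_modulus (z + w)) [leRHS]sqrrD (sqr_modulus z) (sqr_modulus w) /=.
have h : z.1 * w.1 + z.2 * w.2 <= modulus z * modulus w.
  apply: le_trans (ler_norm _) _; rewrite -ler_sqr ?nnegrE ?mulr_ge0//.
  rewrite real_normK ?num_real// exprMn !sqr_modulus -subr_ge0.
  have -> : (z.1 ^+ 2 + z.2 ^+ 2) * (w.1 ^+ 2 + w.2 ^+ 2) - (z.1 * w.1 + z.2 * w.2) ^+ 2 =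
    (z.1 * w.2 - z.2 * w.1) ^+ 2 by ring.
  exact: sqr_ge0.
lra.
Qed.

Lemma hB_modulus z w : 0 < z.2 -> 0 < w.2 -> hB z w = 1 + modulus (z - w) ^+ 2 / (2 * z.2 * w.2).
Proof. by move=> z0 w0; rewrite hBE// sqr_modulus. Qed.

Lemma sinh_half_hd z w : 0 < z.2 -> 0 < w.2 ->
  2 * sinh (hd z w / 2) = modulus (z - w) / Num.sqrt (z.2 * w.2).
Proof.
move=> z0 w0; have P : 0 < z.2 * w.2 by rewrite mulr_gt0.
have S0 : 0 <= sinh (hd z w / 2) by apply: sinh_ge0; rewrite divr_ge0// hd_ge0.
apply/eqP; rewrite -(@eqrXn2 _ 2)//; last 2 first.
- by rewrite mulr_ge0.
- by rewrite divr_ge0 ?modulus_ge0 ?sqrtr_ge0.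
apply/eqP; rewrite exprMn [RHS]exprMn exprVn (sqr_sqrtr (ltW P)).
have := cosh_half (hd z w); rewrite cosh_hd// hB_modulus// => /addrI H.
have -> : 2 ^+ 2 * sinh (hd z w / 2) ^+ 2 = 2 * (2 * sinh (hd z w / 2) ^+ 2) by ring.
by rewrite -H; field; rewrite !gt_eqF.
Qed.

Lemma modulus_hd_le z w : 0 < z.2 -> 0 < w.2 -> hB z w <= 2 ->
  modulus (z - w) ^+ 2 <= 8 * z.2 ^+ 2 * (hB z w - 1).
Proof.
move=> z0 w0 B2; have B1 := hB_ge1 z0 w0.
have w4 : w.2 <= 4 * z.2.
  have : hB z w * (2 * z.2 * w.2) <= 2 * (2 * z.2 * w.2) by rewrite ler_wpM2r// !mulr_ge0// ltW.
  rewrite /hB divfK ?gt_eqF ?mulr_gt0// => H.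
  have : w.2 ^+ 2 <= 4 * z.2 * w.2.
    by have := sqr_ge0 (z.1 - w.1); have := sqr_ge0 z.2; lra.
  by rewrite expr2 ler_pM2r.
have E : modulus (z - w) ^+ 2 = (hB z w - 1) * (2 * z.2 * w.2).
  by rewrite hB_modulus//; field; rewrite !gt_eqF.
rewrite E (_ : 8 * _ * _ = (hB z w - 1) * (2 * z.2 * (4 * z.2))); last by ring.
by apply: ler_wpM2l; [rewrite subr_ge0 | rewrite ler_pM2l// mulr_gt0].
Qed.

(** With [hd_small]: [hd] and the norm have the same neighbourhoods in the half plane. *)
Lemma hd_nbhs z d : 0 < z.2 -> 0 < d -> exists2 e, 0 < e &
  forall w, 0 < w.2 -> hd z w < e -> `|w - z| < d.
Proof.
move=> z0 d0.
pose k := Num.min 2 (1 + d ^+ 2 / (16 * z.2 ^+ 2)).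
have q0 : 0 < d ^+ 2 / (16 * z.2 ^+ 2) by rewrite divr_gt0 ?mulr_gt0 ?exprn_gt0.
have k1 : 1 < k by rewrite lt_min ltr1n ltrDl q0.
exists (arcosh k).
  rewrite lt_neqAle arcosh_ge0 ?ltW// andbT eq_sym; apply/eqP => E.
  by have := arcoshK (ltW k1); rewrite E cosh0 => kE; move: k1; rewrite -kE ltxx.
move=> w w0 h; have : hB z w < k.
  by rewrite -cosh_hd// -[k]arcoshK ?ltW//; apply: ltr_cosh => //; exact: hd_ge0.
rewrite lt_min => /andP[B2 B]; have := modulus_hd_le z0 w0 (ltW B2) => M.
rewrite distrC; apply: le_lt_trans (norm_le_modulus _) _.
rewrite -ltr_sqr ?nnegrE ?modulus_ge0 ?(ltW d0)//; apply: le_lt_trans M _.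
have : 8 * z.2 ^+ 2 * (hB z w - 1) < 8 * z.2 ^+ 2 * (d ^+ 2 / (16 * z.2 ^+ 2)).
  by rewrite ltr_pM2l ?mulr_gt0 ?exprn_gt0//; lra.
rewrite (_ : _ * (d ^+ 2 / _) = d ^+ 2 / 2); last by field; rewrite gt_eqF.
by have : 0 < d ^+ 2 by [rewrite exprn_gt0]; lra.
Qed.

Lemma near_gt0 z : 0 < z.2 -> forall w, `|w - z| < z.2 / 2 -> z.2 / 2 < w.2 < 2 * z.2.
Proof.
move=> z0 w wz; have := le_lt_trans (norm_snd_le (w - z)) wz.
by rewrite ltr_norml/= => /andP[? ?]; apply/andP; split; lra.
Qed.

Lemma hd_small z e : 0 < z.2 -> 0 < e -> exists2 d, 0 < d &
  forall w w', `|w - z| < d -> `|w' - z| < d -> [/\ 0 < w.2, 0 < w'.2 & hd w w' < e].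
Proof.
move=> z0 e0; have ce : 1 < cosh e by rewrite -cosh0 ltr_cosh.
pose q := (cosh e - 1) * z.2 ^+ 2.
have q0 : 0 < q by rewrite mulr_gt0 ?subr_gt0 ?exprn_gt0.
exists (Num.min (z.2 / 2) (Num.min 1 (q / 64))); first by rewrite !lt_min !divr_gt0//= ltr01.
move=> w w'; rewrite !lt_min => /and3P[w1 w2 w3] /and3P[v1 v2 v3].
have /andP[a1 a2] := near_gt0 z0 w1; have /andP[b1 b2] := near_gt0 z0 v1.
have w0 : 0 < w.2 by lra.
have w'0 : 0 < w'.2 by lra.
split=> //; rewrite ltNge; apply/negP => eh.
have : cosh e <= hB w w' by rewrite -cosh_hd// ler_cosh ?hd_ge0// ltW.
rewrite hB_modulus// leNgt => /negP; apply; rewrite -ltrBrDl ltr_pdivrMr ?mulr_gt0//.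
have n1 : `|w - w'| <= 2 * Num.min 1 (q / 64).
  have -> : w - w' = (w - z) - (w' - z) by rewrite opprB addrA subrK.
  have h1 : `|w - z| < Num.min 1 (q / 64) by rewrite lt_min w2.
  have h2 : `|w' - z| < Num.min 1 (q / 64) by rewrite lt_min v2.
  by apply: le_trans (ler_normB _ _) _; lra.
have m1 : modulus (w - w') <= 4 * Num.min 1 (q / 64).
  by apply: le_trans (modulus_le_norm _) _; lra.
have mn0 : 0 < Num.min 1 (q / 64) by rewrite lt_min ltr01 divr_gt0.
have m2 : modulus (w - w') ^+ 2 <= 16 * (q / 64).
  have -> : 16 * (q / 64) = 4 * (4 * (q / 64)) by ring.
  rewrite expr2; apply: ler_pM; rewrite ?modulus_ge0//.
    by apply: le_trans m1 _; rewrite ger_pMr// ge_min lexx.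
  by apply: le_trans m1 _; rewrite ler_pM2l// ge_min lexx orbT.
have : z.2 ^+ 2 / 2 <= 2 * w.2 * w'.2.
  have -> : z.2 ^+ 2 / 2 = 2 * ((z.2 / 2) * (z.2 / 2)) by field.
  by rewrite -[leRHS]mulrA ler_pM2l//; apply: ler_pM; lra.
move=> h; have : (cosh e - 1) * (z.2 ^+ 2 / 2) <= (cosh e - 1) * (2 * w.2 * w'.2).
  by rewrite ler_pM2l// subr_gt0.
rewrite mulrA -/q; lra.
Qed.

(** The line element |dz| / Im z. The error is uniform over pairs near z, because ball charts
    compare pairs of points and not only distances to the centre. *)
Lemma hd_modulus z e : 0 < z.2 -> 0 < e -> exists2 d, 0 < d &
  forall w w', `|w - z| < d -> `|w' - z| < d -> [/\ 0 < w.2, 0 < w'.2 &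
    `|hd w w' - modulus (w - w') / z.2| <= e * modulus (w - w')].
Proof.
move=> z0 e0.
(* eta controls both sinh x / x and sqrt (Im w Im w') / Im z *)
pose eta := Num.min (1 / 4) (e * z.2 / 8).
have eta0 : 0 < eta by rewrite lt_min !divr_gt0// mulr_gt0.
have eta1 : eta <= 1 / 4 by rewrite ge_min lexx.
have etae : 8 * eta <= e * z.2.
  have : eta <= e * z.2 / 8 by rewrite ge_min lexx orbT.
  by lra.
have [d1 d10 H1] := hd_small z0 eta0.
exists (Num.min d1 (eta * z.2)); first by rewrite lt_min d10 mulr_gt0.
move=> w w'; rewrite !lt_min => /andP[w1 w2] /andP[v1 v2].
have [w0 w'0 hs] := H1 _ _ w1 v1; split=> //.
have h0 : 0 <= hd w w' by apply: hd_ge0.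
have S := sinh_half_hd w0 w'0.
set M := modulus (w - w') in S *; have M0 : 0 <= M by apply: modulus_ge0.
set x := hd w w' in S hs h0 *.
have sx : `|sinh (x / 2) - x / 2| <= (x / 2) ^+ 2.
  by apply: sinh_near0; rewrite ger0_norm ?divr_ge0//; lra.
have sx2 : `|2 * sinh (x / 2) - x| <= eta * x.
  have -> : 2 * sinh (x / 2) - x = 2 * (sinh (x / 2) - x / 2) by field.
  rewrite normrM ger0_norm//.
  have : (x / 2) ^+ 2 <= eta * x / 4.
    have -> : (x / 2) ^+ 2 = x * x / 4 by field.
    by rewrite ler_pM2r// ler_wpM2r// ltW.
  have : 0 <= eta * x by rewrite mulr_ge0// ltW.
  lra.
have /andP[a1 a2] : (1 - eta) * z.2 <= w.2 <= (1 + eta) * z.2.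
  have := le_lt_trans (norm_snd_le (w - z)) w2; rewrite ltr_norml/= => /andP[? ?].
  by apply/andP; split; lra.
have /andP[b1 b2] : (1 - eta) * z.2 <= w'.2 <= (1 + eta) * z.2.
  have := le_lt_trans (norm_snd_le (w' - z)) v2; rewrite ltr_norml/= => /andP[? ?].
  by apply/andP; split; lra.
set s := Num.sqrt _ in S.
have p1 : 0 <= (1 - eta) * z.2 by rewrite mulr_ge0 ?ltW//; lra.
have p2 : 0 <= (1 + eta) * z.2 by rewrite mulr_ge0 ?ltW//; lra.
have s1 : (1 - eta) * z.2 <= s.
  rewrite -[leLHS](ger0_norm p1) -sqrtr_sqr; apply: ler_wsqrtr.
  by rewrite expr2; apply: ler_pM.
have s2 : s <= (1 + eta) * z.2.
  rewrite -[leRHS](ger0_norm p2) -sqrtr_sqr; apply: ler_wsqrtr.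
  by rewrite expr2; apply: ler_pM => //; rewrite ltW.
have s0 : 0 < s by apply: lt_le_trans s1; rewrite mulr_gt0//; lra.
have {S}S : 2 * sinh (x / 2) * s = M by rewrite S divfK// gt_eqF.
move: sx2; rewrite ler_norml => /andP[g1 g2].
have X1 : (1 - eta) * x * s <= M by rewrite -S ler_pM2r//; lra.
have X2 : M <= (1 + eta) * x * s by rewrite -S ler_pM2r//; lra.
have xz0 : 0 <= x * z.2 by rewrite mulr_ge0// ltW.
have Y1 : (1 - 2 * eta) * (x * z.2) <= M.
  apply: le_trans X1; apply: (@le_trans _ _ ((1 - eta) * x * ((1 - eta) * z.2))).
    rewrite (_ : (1 - eta) * x * _ = (1 - 2 * eta + eta ^+ 2) * (x * z.2)); last by ring.
    by rewrite ler_wpM2r// lerDl sqr_ge0.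
  by apply: ler_wpM2l => //; rewrite mulr_ge0//; lra.
have Y2 : M <= (1 + 3 * eta) * (x * z.2).
  apply: le_trans X2 _; apply: (@le_trans _ _ ((1 + eta) * x * ((1 + eta) * z.2))).
    by apply: ler_wpM2l => //; rewrite mulr_ge0//; lra.
  rewrite (_ : (1 + eta) * x * _ = (1 + 2 * eta + eta * eta) * (x * z.2)); last by ring.
  rewrite ler_wpM2r//; have : eta * eta <= eta * 1 by rewrite ler_pM2l//; lra.
  lra.
have xM : x * z.2 <= 2 * M by have : (1 / 2) * (x * z.2) <= (1 - 2 * eta) * (x * z.2) by [rewrite ler_wpM2r//; lra]; lra.
have E : `|x * z.2 - M| <= 8 * eta * M.
  have : eta * (x * z.2) <= eta * (2 * M) by rewrite ler_pM2l.
  have : 0 <= eta * M by rewrite mulr_ge0// ltW.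
  by move=> k1 k2; rewrite ler_norml; apply/andP; split; lra.
have -> : x - M / z.2 = (x * z.2 - M) / z.2 by field; rewrite gt_eqF.
rewrite normrM normfV (gtr0_norm z0) ler_pdivrMr//; apply: le_trans E _.
by rewrite [leRHS]mulrAC ler_wpM2r.
Qed.

(** Clearing denominators describes the ball by g <= 0 with g a polynomial; as g > 0 where Im w <=
    0, this set is closed in the whole plane, and it is bounded. *)
Lemma closed_hball_compact z (r : R) : 0 < z.2 ->
  compact [set w | 0 < w.2 /\ hd z w <= r].
Proof.
move=> z0; have [r0|r0] := leP 0 r; last first.
  rewrite (_ : [set w | _] = set0); first exact: compact0.
  apply/seteqP; split=> w //= [w0]; rewrite leNgt => /negP; apply.
  by apply: lt_le_trans r0 _; exact: hd_ge0.
have c1 := cosh_ge1 r; set c := cosh r in c1.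
pose g w : R := (z.1 - w.1) ^+ 2 + z.2 ^+ 2 + w.2 ^+ 2 - c * (2 * z.2 * w.2).
have E : [set w | 0 < w.2 /\ hd z w <= r] = g @^-1` [set x | x <= 0].
  apply/seteqP; split=> w; rewrite /g/=.
    move=> [w0]; rewrite -ler_cosh ?hd_ge0// cosh_hd// /hB ler_pdivrMr ?mulr_gt0// -/c; lra.
  move=> H; have w0 : 0 < w.2.
    rewrite ltNge; apply/negP => w0; have : 0 <= c * (2 * z.2 * - w.2) by rewrite !mulr_ge0 ?oppr_ge0//; lra.
    have := sqr_ge0 (z.1 - w.1); have := sqr_ge0 w.2; have : 0 < z.2 ^+ 2 by rewrite exprn_gt0.
    lra.
  split=> //; rewrite -ler_cosh ?hd_ge0// cosh_hd// /hB ler_pdivrMr ?mulr_gt0// -/c; lra.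
have cg : continuous g.
  move=> w; have f1 : {for w, continuous (fun w : R * R => w.1)} by exact: cvg_fst.
  have f2 : {for w, continuous (fun w : R * R => w.2)} by exact: cvg_snd.
  rewrite /continuous_at /g; under eq_fun do rewrite !expr2; rewrite !expr2.
  have fs : (fun w : R * R => z.1 - w.1) @ w --> z.1 - w.1 by apply: cvgB => //; exact: cvg_cst.
  apply: cvgB; first by apply: cvgD; [apply: cvgD; [exact: cvgM | exact: cvg_cst] | exact: cvgM].
  by apply: cvgM; [exact: cvg_cst | apply: cvgM => //; exact: cvg_cst].
rewrite E; apply: (@subclosed_compact _ _ (`[z.1 - 2 * c * z.2, z.1 + 2 * c * z.2]%classic `*` `[0, 2 * c * z.2]%classic)).
- by apply: preimage_closed; [move=> w _; exact: cg | exact: closed_le].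
- by apply: compact_setX; exact: segment_compact.
- move=> w H; have : [set w | 0 < w.2 /\ hd z w <= r] w by rewrite E.
  move: H; rewrite /g/= !in_itv/= => H [w0 _].
  have s1 := sqr_ge0 (z.1 - w.1); have s2 := sqr_ge0 z.2.
  have W2 : w.2 <= 2 * c * z.2.
    have : w.2 * w.2 <= 2 * c * z.2 * w.2 by rewrite -expr2; lra.
    by rewrite ler_pM2r.
  have cz : 0 <= 2 * c * z.2 by apply: le_trans (ltW w0) W2.
  have Q : (z.1 - w.1) ^+ 2 <= (2 * c * z.2) ^+ 2.
    have : 2 * c * z.2 * w.2 <= (2 * c * z.2) ^+ 2 by rewrite expr2 ler_wpM2l.
    have := sqr_ge0 w.2; lra.
  have := sqr_le_le cz Q; have := @sqr_le_le (w.1 - z.1) _ cz.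
  rewrite -sqrrN opprB => /(_ Q) ? ?; split; apply/andP; split; lra.
Qed.

End HyperbolicPlane.

(** * Lipschitz functions of one variable *)

Section LipschitzFTC.
Variables (R : realType) (u : R -> R) (K : R).
Hypothesis lipu : forall x y, `|u x - u y| <= K * `|x - y|.
Local Notation mu := (@lebesgue_measure R).

Let K0 : 0 <= K.
Proof.
have := lipu 0 1; rewrite sub0r normrN normr1 mulr1; apply: le_trans; exact: normr_ge0.
Qed.

Lemma lipschitz_continuous_real : continuous u.
Proof.
move=> x; apply/cvgrPdist_lt => e e0; near=> y.
apply: le_lt_trans (lipu _ _) _.
have : `|x - y| < e / (K + 1).
  by near: y; apply: cvgr_dist_lt; [exact: cvg_id | rewrite divr_gt0// ltr_wpDl].
rewrite ltr_pdivlMr ?ltr_wpDl// mulrDr mulr1 => h; apply: le_lt_trans h.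
by rewrite mulrC lerDl.
Unshelve. all: by end_near. Qed.

Definition up_part (x : R) : R := K * x + u x.
Definition down_part (x : R) : R := K * x - u x.
Definition slope_part (x : R) : R := K * x + K * x.

Let cvgK (x : R) : (fun y => K * y) @ x --> K * x.
Proof. by apply: cvgM; [exact: cvg_cst | exact: cvg_id]. Qed.

Let up_nd : {homo up_part : x y / x <= y}.
Proof.
move=> x y xy; have := lipu y x; rewrite (ger0_norm (x := y - x)) ?subr_ge0// ler_norml => /andP[? ?].
rewrite /up_part; lra.
Qed.

Let down_nd : {homo down_part : x y / x <= y}.
Proof.
move=> x y xy; have := lipu y x; rewrite (ger0_norm (x := y - x)) ?subr_ge0// ler_norml => /andP[? ?].
rewrite /down_part; lra.
Qed.

Let slope_nd : {homo slope_part : x y / x <= y}.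
Proof. by move=> x y xy; rewrite /slope_part lerD// ler_wpM2l. Qed.

Let up_rc : right_continuous up_part.
Proof.
by apply/right_continuousW => x; apply: cvgD; [exact: cvgK | exact: lipschitz_continuous_real].
Qed.

Let down_rc : right_continuous down_part.
Proof.
by apply/right_continuousW => x; apply: cvgB; [exact: cvgK | exact: lipschitz_continuous_real].
Qed.

Let slope_rc : right_continuous slope_part.
Proof. by apply/right_continuousW => x; apply: cvgD; exact: cvgK. Qed.

HB.instance Definition _ := isCumulative.Build R _ R up_part up_nd up_rc.
HB.instance Definition _ := isCumulative.Build R _ R down_part down_nd down_rc.
HB.instance Definition _ := isCumulative.Build R _ R slope_part slope_nd slope_rc.

Let mF := lebesgue_stieltjes_measure up_part.
Let mG := lebesgue_stieltjes_measure down_part.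
Let mH := lebesgue_stieltjes_measure slope_part.

Lemma LS_itv (f : cumulative R R) (a b : R) : a <= b ->
  lebesgue_stieltjes_measure f `]a, b] = (f b - f a)%:E.
Proof.
move=> ab; rewrite /lebesgue_stieltjes_measure/= /measure_extension measurable_mu_extE/=.
  by rewrite wlength_itv_bnd.
exact: is_ocitv.
Qed.

Lemma mu_itv (a b : R) : a <= b -> mu `]a, b] = (b - a)%:E.
Proof.
move=> ab; rewrite lebesgue_measure_itv/= lte_fin; case: ltP => //.
by move=> ba; have -> : a = b by [apply/le_anti; rewrite ab]; rewrite subrr.
Qed.

(** The measures of K x + u and K x - u add up to 2 K times Lebesgue measure, by comparison on
    half-open intervals; hence a null set is null for each of them. *)
Lemma LS_dominated : mF `<< mu.
Proof.
have K20 : 0 <= K + K by rewrite addr_ge0.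
have oc X : ocitv X -> exists a b : R, a <= b /\ X = `]a, b]%classic.
  move=> /ocitvP[->|[[a b] /= ab ->]]; last by exists a, b; rewrite ltW.
  by exists 0, 0; rewrite set_itvoc0.
have E1 A : measurable A -> mH A = (mF A + mG A)%E.
  move=> mA; rewrite -measure_addE.
  apply: (lebesgue_stieltjes_measure_unique (mu := measure_add mF mG)) mA => X /oc[a [b [ab ->]]].
  apply: etrans (LS_itv _ ab) _; apply: etrans _ (esym (measure_addE _ _ _)).
  apply: etrans _ (esym (congr2 adde (LS_itv _ ab) (LS_itv _ ab))); rewrite /adde/=; congr EFin.
  rewrite /slope_part/up_part/down_part; ring.
have E2 A : measurable A -> mH A = ((K + K)%:E * mu A)%E.
  apply: (lebesgue_stieltjes_measure_unique (mu := mscale (NngNum K20) mu)) => X /oc[a [b [ab ->]]].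
  apply: etrans (LS_itv _ ab) _.
  apply: etrans _ (esym (congr1 (fun t => (K + K)%:E * t)%E (mu_itv ab))); rewrite -EFinM; congr EFin.
  by rewrite /= /slope_part; ring.
apply/null_content_dominatesP => A mA muA; have := E1 A mA; rewrite (E2 A mA) muA mule0 => /esym/eqP.
by rewrite padde_eq0 ?measure_ge0// => /andP[/eqP].
Qed.

(* The functions K x + u x and K x - u x are nondecreasing; their
   Lebesgue-Stieltjes measures are dominated by Lebesgue measure, so that u is
   the integral of a Radon-Nikodym density. *)
Lemma lipschitz_ftc (a b : R) : a < b -> exists N : set R,
  [/\ measurable N, mu N = 0%E,
   (forall x, a < x < b -> ~ N x -> derivable u x 1) &
   forall (N' : set R) (v : R -> R), measurable N' -> mu N' = 0%E -> N `<=` N' ->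
     measurable_fun (`]a, b[%classic `\` N') v ->
     (forall x, a < x < b -> ~ N' x -> 0 <= v x /\ 'D_1 u x <= v x) ->
     ((u b - u a)%:E <= \int[mu]_(x in `]a, b[%classic `\` N') (v x)%:E)%E].
Proof.
move=> ab.
have moo : (mF `]a, b] < +oo)%E by rewrite /mF LS_itv ?ltW// ltry.
(* Restriction to ]a, b] makes the measure finite, as the Radon-Nikodym theorem requires. *)
pose nu : {finite_measure set (measurableTypeR R) -> \bar R} := mfrestr (measurable_itv `]a, b] : measurable (_ : set (measurableTypeR R))) moo.
have nuE A : nu A = mF (A `&` `]a, b]) by [].
have dom : nu `<< mu.
  apply/null_content_dominatesP => A mA A0; rewrite nuE; apply/eqP; rewrite eq_le measure_ge0 andbT.
  by rewrite -((null_content_dominatesP _ _).1 LS_dominated A mA A0); apply: le_measure; rewrite ?inE//; exact: measurableI.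
have [f [f0 ffin fint fE]] := radon_nikodym_sigma_finite dom.
pose phi x := fine (f x).
have phiE x : (phi x)%:E = f x by rewrite fineK.
have phi0 x : 0 <= phi x by rewrite fine_ge0.
have iphi : mu.-integrable setT (EFin \o phi).
  by apply: eq_integrable fint => // x _; rewrite /= phiE.
have locphi : locally_integrable setT phi by apply: open_integrable_locally => //; exact: openT.
have iphiy y : mu.-integrable `]-oo, y] (EFin \o phi) by apply: integrableS iphi.
have := FTC1Ny iphiy locphi.
set G := (fun x => _) => -[N [mN N0 NG]].
have GE x : a <= x <= b -> G x = up_part x - up_part a.
  move=> /andP[ax xb]; rewrite /G /Rintegral; under eq_integral do rewrite phiE.
  rewrite -fE// nuE; have -> : `]-oo, x]%classic `&` `]a, b]%classic = `]a, x]%classic :> set R.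
    apply/seteqP; split=> t /=; rewrite !in_itv/=; first by move=> [-> /andP[->]].
    by move=> /andP[-> tx]; rewrite tx (le_trans tx).
  exact: (congr1 fine (LS_itv _ ax)).
have deru x : a < x < b -> ~ N x -> derivable u x 1 /\ 'D_1 u x = phi x - K.
  move=> /andP[ax xb] Nx.
  have [dG GE'] : derivable G x 1 /\ G^`()%classic x = phi x by apply: contrapT => h; exact/Nx/NG.
  (* Near x, u is the primitive G of phi minus K y, up to a constant; so u' = phi - K wherever G' =
     phi. *)
  have uE : \forall y \near x, G y + up_part a - K * y = u y.
    near=> y; rewrite GE; first by rewrite /up_part; ring.
    apply/andP; split; near: y.
      by apply: filterS (lt_nbhsr ax) => z /ltW.
    exact: (lt_le_nbhsl xb).
  have dG' : is_derive x 1 G (phi x).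
    by apply: (DeriveDef dG); rewrite -GE' derive1E.
  have dH : is_derive x 1 (fun y => G y + up_part a - K * y) (phi x - K).
    apply: is_derive_eq.
    by rewrite addr0 /GRing.scale/= mulr1.
  have [dH1 dH2] := dH; split; first exact: near_eq_derivable uE dH1.
  by rewrite -dH2; apply/esym/near_eq_derive.
exists N; split=> // [x xab Nx|N' v mN' N'0 NN' mv Hv]; first by have [] := deru x xab Nx.
set D := _ `\` N'; have mD : measurable D by apply: measurableD.
(* After adding K (b - a) to both sides, the claim is an integrated form of phi <= v + K, an
   inequality between nonnegative functions. *)
have vDK : (\int[mu]_(x in D) (v x)%:E + (K * (b - a))%:E = \int[mu]_(x in D) ((v x)%:E + K%:E))%E.
  have v0 x : D x -> (0 <= (v x)%:E)%E.
    by move=> [/=]; rewrite in_itv/= => xab Nx; rewrite lee_fin; have [] := Hv x xab Nx.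
  have Kf x : D x -> (0 <= K%:E)%E by rewrite lee_fin.
  rewrite [RHS](_ : _ = \int[mu]_(x in D) (v x)%:E + \int[mu]_(x in D) (cst K%:E) x)%E; last first.
    by apply: ge0_integralD => //; exact/measurable_EFinP.
  rewrite integral_cst//; congr (_ + _)%E.
  rewrite EFinM; congr (_ * _)%E.
  have : mu `]a, b[ = (b - a)%:E by rewrite lebesgue_measure_itv/= lte_fin ab.
  move=> <-; rewrite /D measureD//= ?lebesgue_measure_itv/= ?lte_fin ?ab ?ltry//.
  have -> : mu (`]a, b[ `&` N') = 0%E; last by rewrite sube0.
  by apply/eqP; rewrite eq_le measure_ge0 andbT -N'0; apply: le_measure; rewrite ?inE//; exact: measurableI.
have K_fin : (K * (b - a))%:E \is a fin_num by [].
rewrite -(leeD2rE _ _ K_fin) vDK -EFinD.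
have -> : u b - u a + K * (b - a) = up_part b - up_part a by rewrite /up_part; ring.
have -> : (up_part b - up_part a)%:E = (\int[mu]_(x in D) (phi x)%:E)%E.
  under eq_integral do rewrite phiE.
  rewrite /D -ge0_negligible_integral//; last first.
    by case/integrableP: fint => mf _; exact: measurable_funTS.
  rewrite integral_itv_bndo_bndc//; last by case/integrableP: fint => mf _; exact: measurable_funTS.
  by rewrite -fE// nuE setIid; apply/esym/LS_itv/ltW.
apply: ge0_le_integral => //.
- by move=> x _; rewrite lee_fin.
- by apply: measurable_funTS; case/integrableP: iphi.
- by apply: (@emeasurable_funD _ _ _ _ _ (cst K%:E)) => //; exact/measurable_EFinP.
- move=> x [/=]; rewrite in_itv/= => xab Nx; rewrite -EFinD lee_fin.
  have [_ h] := Hv x xab Nx; have [_ E] := deru x xab (fun h => Nx (NN' _ h)).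
  by rewrite E in h; lra.
Unshelve. all: by end_near.
Qed.
End LipschitzFTC.

Lemma near_continuous (T U : topologicalType) (f : T -> U) (x : T) (P : U -> Prop) :
  {for x, continuous f} -> (\forall y \near f x, P y) -> \forall y \near x, P (f y).
Proof. by move=> cf; exact: cf. Qed.

Lemma modulus_gt0 (R : realType) (z : R * R) : z != 0 -> 0 < modulus z.
Proof. by move=> z0; apply: lt_le_trans (norm_le_modulus _); rewrite normr_gt0. Qed.

Lemma cmul_neq0 (R : realType) (z w : R * R) : z != 0 -> w != 0 -> cmul z w != 0.
Proof.
move=> /modulus_gt0 z0 /modulus_gt0 w0; have : 0 < modulus (cmul z w).
  by rewrite modulusM; exact: mulr_gt0.
by move=> /lt_le_trans/(_ (modulus_le_norm _)); rewrite pmulr_rgt0// normr_gt0.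
Qed.

(** * Isometric charts by hyperbolic balls *)

Section Charts.
Variables (R : realType) (X : riemannSurface R).
Implicit Types (i j : 'I_(nb_charts X)) (x y : X) (z w : R * R).

Lemma near_dom i x : dom i x -> \forall y \near x, dom i y.
Proof. by move=> dx; apply: open_nbhs_nbhs; split => //; exact: dom_open. Qed.

Lemma near_chart_image i z : chart_image i z -> \forall w \near z, chart_image i w.
Proof. by move=> dx; apply: open_nbhs_nbhs; split => //; exact: chart_image_open. Qed.

Lemma chart_in i x : dom i x -> chart_image i (chart i x).
Proof. by move=> dx; exists x. Qed.

Lemma paramK i z : chart_image i z -> chart i (param i z) = z.
Proof. by move=> [x dx <-]; rewrite chartK. Qed.

Lemma param_dom i z : chart_image i z -> dom i (param i z).
Proof. by move=> [x dx <-]; rewrite chartK. Qed.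

Lemma chart_cvg i x : dom i x -> {for x, continuous (chart i)}.
Proof.
move=> dx; have := @chart_continuous _ X i.
rewrite continuous_open_subspace; last exact: dom_open.
by apply; rewrite inE.
Qed.

Lemma param_cvg i z : chart_image i z -> {for z, continuous (param i)}.
Proof.
move=> dx; have := @param_continuous _ X i.
rewrite continuous_open_subspace; last exact: chart_image_open.
by apply; rewrite inE.
Qed.

Definition transition i j : R * R -> R * R := chart j \o param i.

Lemma transition_cdiff i j x : dom i x -> dom j x ->
  cdiff (transition i j) (chart i x) (cderiv (chart j \o param i) (chart i x)).
Proof. by move=> dx dy; apply: holomorphic_cdiff; exact: transition_holomorphic. Qed.

Lemma near_transition i j x : dom i x -> dom j x -> \forall z \near chart i x,
  chart_image i z /\ dom j (param i z).
Proof.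
move=> dx dy; near=> z; split; near: z; first exact/near_chart_image/chart_in.
apply: (@near_continuous _ _ (param i) _ (dom j)); first exact/param_cvg/chart_in.
by rewrite chartK//; exact: near_dom.
Unshelve. all: by end_near. Qed.

Lemma transition_near_cdiff i j x : dom i x -> dom j x ->
  \forall z \near chart i x, exists l, cdiff (transition i j) z l.
Proof.
move=> dx dy; near=> z.
have [zi zj] : chart_image i z /\ dom j (param i z) by near: z; exact: near_transition.
exists (cderiv (chart j \o param i) z); have := transition_cdiff (param_dom zi) zj.
by rewrite paramK.
Unshelve. all: by end_near. Qed.

(** The two transition maps are inverse to each other near the point, so the product of their
    derivatives is 1. *)
Lemma transition_neq0 i j x : dom i x -> dom j x ->
  cderiv (chart j \o param i) (chart i x) != 0.
Proof.
move=> dx dy; apply/eqP => E.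
have h1 := transition_cdiff dx dy; have h2 := transition_cdiff dy dx.
have : cdiff (transition j i \o transition i j) (chart i x)
    (cmul (cderiv (chart i \o param j) (chart j x)) (cderiv (chart j \o param i) (chart i x))).
  apply: (@cdiff_comp _ (transition j i) (transition i j) _ _ _ _ h1).
  by have -> : transition i j (chart i x) = chart j x; [rewrite /transition/= chartK | exact: h2].
rewrite E => h3; have h4 : cdiff id (chart i x)
    (cmul (cderiv (chart i \o param j) (chart j x)) 0).
  apply: cdiff_near_eq h3; near=> z.
  have [zi zj] : chart_image i z /\ dom j (param i z) by near: z; exact: near_transition.
  by rewrite /transition/= chartK// paramK.
have := cdiff_unique h4 (cdiff_id _); rewrite /cmul/= !mulr0 subrr => -[/eqP].
by rewrite eq_sym oner_eq0.
Unshelve. all: by end_near. Qed.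

End Charts.

Section BallCharts.
Variables (R : realType) (X : riemannSurface R) (rho : conformalMetric X).
Implicit Types (i j : 'I_(nb_charts X)) (x y : X) (z w o : R * R) (r : R).

Definition hball o r : set (R * R) := [set w | 0 < w.2 /\ hd o w < r].

(* [phi] and [e] are inverse isometries between an open part of X, with the
   metric rho |dz|, and the hyperbolic ball with centre [o] and radius [r]. *)
Record ballchart (phi : X -> R * R) (e : R * R -> X) o r : Prop := BallChart {
  bc_r : 0 < r;
  bc_o : 0 < o.2;
  bcK : forall z, hball o r z -> phi (e z) = z;
  bc_cont : forall z, hball o r z -> {for z, continuous e};
  bc_open : forall z U, hball o r z -> nbhs z U -> nbhs (e z) (e @` U);
  bc_lip : forall z i, hball o r z -> dom i (e z) -> exists2 K : R, 0 < K &
    \forall x \near e z & y \near e z,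
      `|chart i x - chart i y| <= K * hd (phi x) (phi y) /\
      hd (phi x) (phi y) <= K * `|chart i x - chart i y|;
  bc_speed : forall z i, hball o r z -> dom i (e z) -> 0 < rho i (chart i (e z)) /\
    forall eps : R, 0 < eps -> \forall x \near e z,
      `|hd (phi x) z - rho i (chart i (e z)) * modulus (chart i x - chart i (e z))|
        <= eps * modulus (chart i x - chart i (e z))
}.

Section Construction.
Variables (i0 : 'I_(nb_charts X)) (f g : R * R -> R * R) (p : R * R) (r0 s K r : R).
Hypotheses (r00 : 0 < r0) (K0 : 0 < K) (rp : 0 < r).
Hypothesis hol : forall z, `|z - p| < r0 -> [/\ chart_image i0 z, cdiff f z (cderiv f z),
  cderiv f z != 0, 0 < (f z).2 & rho i0 z = modulus (cderiv f z) / (f z).2].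
Hypothesis bilip : forall z w, `|z - p| < r0 -> `|w - p| < r0 ->
  `|z - w| <= K * `|f z - f w| /\ `|f z - f w| <= K * `|z - w|.
Hypothesis gP : forall w, `|w - f p| < s -> `|g w - p| < r0 /\ f (g w) = w.
Hypothesis ballP : forall w, hball (f p) r w -> `|w - f p| < s.

Let phi : X -> R * R := f \o chart i0.
Let e : R * R -> X := param i0 \o g.

Let gK z : `|z - p| < r0 -> `|f z - f p| < s -> g (f z) = z.
Proof.
move=> zr zs; have [gr gE] := gP zs; have [h _] := bilip gr zr.
by apply/eqP; rewrite -subr_eq0 -normr_le0 (le_trans h)// gE subrr normr0 mulr0.
Qed.

Let g_cont w : `|w - f p| < s -> {for w, continuous g}.
Proof.
move=> ws; apply/(@cvgrPdist_lt _ (R * R)%type) => eps eps0; near=> v.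
have vs : `|v - f p| < s.
  have : `|v - w| < s - `|w - f p| by near: v; apply: near_norm_lt; rewrite subr_gt0.
  move=> h; rewrite -(subrK w v) -addrA; apply: le_lt_trans (ler_normD _ _) _; lra.
have [gv gvE] := gP vs; have [gw gwE] := gP ws.
have [h _] := bilip gw gv; apply: le_lt_trans h _; rewrite gvE gwE.
have : `|v - w| < eps / K by near: v; apply: near_norm_lt; rewrite divr_gt0.
by rewrite ltr_pdivlMr// distrC mulrC.
Unshelve. all: by end_near. Qed.

Let f_cont z : `|z - p| < r0 -> {for z, continuous f}.
Proof. by move=> /hol[_ /cdiff_continuous]. Qed.

Let near_ball z : `|z - p| < r0 -> \forall w \near z, `|w - p| < r0.
Proof.
move=> zr; near=> w.
have : `|w - z| < r0 - `|z - p| by near: w; apply: near_norm_lt; rewrite subr_gt0.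
move=> h; rewrite -(subrK z w) -addrA; apply: le_lt_trans (ler_normD _ _) _; lra.
Unshelve. all: by end_near. Qed.

Let near_sball z : `|z - f p| < s -> \forall w \near z, `|w - f p| < s.
Proof.
move=> zr; near=> w.
have : `|w - z| < s - `|z - f p| by near: w; apply: near_norm_lt; rewrite subr_gt0.
move=> h; rewrite -(subrK z w) -addrA; apply: le_lt_trans (ler_normD _ _) _; lra.
Unshelve. all: by end_near. Qed.

Let e_dom w : `|w - f p| < s -> [/\ dom i0 (e w), chart i0 (e w) = g w & phi (e w) = w].
Proof.
move=> ws; have [gr gE] := gP ws; have [ci _ _ _ _] := hol gr.
by rewrite /e /phi /= paramK//; split => //; exact: param_dom.
Qed.

Let near_phi w : `|w - f p| < s -> \forall x \near e w,
  [/\ dom i0 x, `|chart i0 x - p| < r0, `|phi x - f p| < s & e (phi x) = x].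
Proof.
move=> ws; have [di gE pE] := e_dom ws; have [gr fgE] := gP ws.
near=> x.
have dx : dom i0 x by near: x; exact: near_dom.
have xr : `|chart i0 x - p| < r0.
  near: x; apply: (@near_continuous _ _ (chart i0) _ (fun z => `|z - p| < r0)).
    exact: chart_cvg.
  by rewrite gE; exact: near_ball.
have xs : `|phi x - f p| < s.
  near: x; apply: (@near_continuous _ _ phi _ (fun z => `|z - f p| < s)).
    by apply: continuous_comp; [exact: chart_cvg | rewrite gE; exact: f_cont].
  by rewrite pE; exact: near_sball.
by split => //; rewrite /e/phi/= gK// chartK.
Unshelve. all: by end_near. Qed.

Let F i := f \o transition i i0.

(** In another chart i the map [phi] reads [F i]. The transformation rule of the density carries the
    formula |f'| / Im f from the chart i0 to the chart i, with [F i] in place of f. *)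
Let F_cdiff i w : `|w - f p| < s -> dom i (e w) -> exists l,
  [/\ cdiff (F i) (chart i (e w)) l, l != 0,
      rho i (chart i (e w)) = modulus l / w.2 &
      \forall z \near chart i (e w), exists m, cdiff (F i) z m].
Proof.
move=> ws diw; have [di gE pE] := e_dom ws; have [gr fgE] := gP ws.
set y := e w in di gE pE diw *.
have tE : transition i i0 (chart i y) = g w by rewrite /transition/= chartK.
have [ci df fn fp rhoE] := hol gr.
exists (cmul (cderiv f (g w)) (cderiv (chart i0 \o param i) (chart i y))); split.
- by apply: cdiff_comp; [rewrite tE | exact: transition_cdiff].
- exact: (cmul_neq0 fn (transition_neq0 diw di)).
- rewrite (density_change rho diw di) gE rhoE fgE.
  by rewrite (modulusM (cderiv f (g w)) (cderiv (chart i0 \o param i) (chart i y))) mulrAC.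
- have cT : {for chart i y, continuous (transition i i0)}.
    exact: cdiff_continuous (transition_cdiff diw di).
  near=> z.
  have [m dm] : exists m, cdiff (transition i i0) z m.
    by near: z; exact: transition_near_cdiff.
  have zr : `|transition i i0 z - p| < r0.
    near: z; apply: (@near_continuous _ _ (transition i i0) _ (fun z => `|z - p| < r0)) => //.
    by rewrite tE; exact: near_ball.
  have [_ dfz _ _ _] := hol zr.
  by exists (cmul (cderiv f (transition i i0 z)) m); exact: cdiff_comp.
Unshelve. all: by end_near. Qed.

Let phiF i x : dom i x -> F i (chart i x) = phi x.
Proof. by move=> dx; rewrite /F/transition/= chartK. Qed.

(** The bi-Lipschitz bound combines [local_inverse] for [F i] with [hd_modulus]; the infinitesimal
    one combines the first order expansion of [F i] with [hd_modulus]. *)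
Let loc i w : `|w - f p| < s -> 0 < w.2 -> dom i (e w) ->
  (exists2 K : R, 0 < K &
    \forall x \near e w & y \near e w,
      `|chart i x - chart i y| <= K * hd (phi x) (phi y) /\
      hd (phi x) (phi y) <= K * `|chart i x - chart i y|) /\
  (0 < rho i (chart i (e w)) /\
    forall eps : R, 0 < eps -> \forall x \near e w,
      `|hd (phi x) w - rho i (chart i (e w)) * modulus (chart i x - chart i (e w))|
        <= eps * modulus (chart i x - chart i (e w))).
Proof.
move=> ws w0 diw; have [di gE pE] := e_dom ws.
have [l [dF l0 rhoE nF]] := F_cdiff ws diw.
have FE : F i (chart i (e w)) = w by rewrite phiF.
have ml0 : 0 < modulus l by exact: modulus_gt0.
have cphi : {for e w, continuous phi}.
  by apply: continuous_comp; [exact: chart_cvg | rewrite gE; apply: f_cont; have [] := gP ws].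
have near_eu (d : R) : 0 < d -> \forall x \near e w,
    [/\ dom i x, `|chart i x - chart i (e w)| < d & `|phi x - w| < d].
  move=> d0; near=> x; split; near: x; first exact: near_dom.
    apply: (@near_continuous _ _ (chart i) _ (fun z => `|z - chart i (e w)| < d)); first exact: chart_cvg.
    exact: near_norm_lt.
  apply: (@near_continuous _ _ phi _ (fun z => `|z - w| < d)) => //.
  by rewrite pE; exact: near_norm_lt.
split.
  have [K1 [d1 [_ [K10 /andP[d10 _] _ Hb _]]]] := local_inverse (@ltr01 R) l0 (strictly_differentiable nF dF).
  have w20 : 0 < w.2^-1 by rewrite invr_gt0.
  have [d2 d20 Hh] := hd_modulus w0 (e := w.2^-1 / 2) ltac:(by rewrite divr_gt0).
  pose d := Num.min d1 d2; have d0 : 0 < d by rewrite lt_min d10.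
  exists (K1 * (2 * w.2) + 4 * w.2^-1 * K1).
    by rewrite addr_gt0 ?mulr_gt0.
  near=> x y => /=.
  have [dx cx px] : [/\ dom i x, `|chart i x - chart i (e w)| < d & `|phi x - w| < d].
    by near: x; exact: near_eu.
  have [dy cy py] : [/\ dom i y, `|chart i y - chart i (e w)| < d & `|phi y - w| < d].
    by near: y; exact: near_eu.
  move: cx px cy py; rewrite !lt_min => /andP[cx _] /andP[_ px] /andP[cy _] /andP[_ py].
  have [b1 b2] := Hb _ _ cx cy; rewrite !phiF// in b1 b2.
  have [_ _ h] := Hh _ _ px py; move: h; rewrite ler_norml => /andP[h1 h2].
  have m1 := norm_le_modulus (phi x - phi y); have m2 := modulus_le_norm (phi x - phi y).
  set M := modulus _ in h1 h2 m1 m2; set H := hd _ _ in h1 h2 *.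
  set N := `|phi x - phi y| in b1 b2 m1 m2.
  have N0 : 0 <= N by apply: normr_ge0.
  have h1' : M <= 2 * w.2 * H.
    have : w.2^-1 / 2 * M <= H by lra.
    rewrite mulrAC ler_pdivrMr// => /(ler_wpM2l (ltW w0)).
    by rewrite mulrA mulfV ?gt_eqF// mul1r => /le_trans; apply; lra.
  have H0 : 0 <= H by have : 0 <= 2 * w.2 * H by [lra]; rewrite pmulr_rge0// mulr_gt0.
  split.
    apply: le_trans b1 _; apply: (@le_trans _ _ (K1 * (2 * w.2 * H))).
      by rewrite ler_pM2l//; lra.
    rewrite mulrA ler_wpM2r// lerDl; exact/ltW/mulr_gt0/K10/mulr_gt0.
  have h2' : H <= w.2^-1 * (2 * M) by lra.
  apply: le_trans h2' _; apply: (@le_trans _ _ (w.2^-1 * (4 * (K1 * `|chart i x - chart i y|)))).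
    by rewrite ler_pM2l//; lra.
  rewrite (_ : _ * (4 * _) = 4 * w.2^-1 * K1 * `|chart i x - chart i y|); last by ring.
  by rewrite ler_wpM2r// lerDr ltW// mulr_gt0// mulr_gt0.
split; first by rewrite rhoE divr_gt0.
move=> eps eps0.
have w20 : 0 < w.2^-1 by rewrite invr_gt0.
(* The denominator collects the constants of the two error terms; the cut at 1 below bounds the
   image increment by [modulus l + 2] times [M]. *)
pose eta := eps / (2 + modulus l + w.2^-1 *+ 4).
have q0 : 0 < 2 + modulus l + w.2^-1 *+ 4 by rewrite !addr_gt0// pmulrn_lgt0.
pose eta1 := Num.min eta 1.
have eta0 : 0 < eta1 by rewrite lt_min ltr01 divr_gt0.
have [d2 d20 Hh] := hd_modulus w0 eta0.
have [d1 d10 HF] := dF eta1 eta0.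
near=> x.
have [dx cx px] : [/\ dom i x, `|chart i x - chart i (e w)| < Num.min d1 d2 & `|phi x - w| < Num.min d1 d2].
  by near: x; apply: near_eu; rewrite lt_min d10.
move: cx px; rewrite !lt_min => /andP[cx _] /andP[_ px].
have [_ _ h] := Hh _ w px ltac:(by rewrite subrr normr0).
have := HF _ cx; rewrite FE phiF// => h'.
set M := modulus (chart i x - chart i (e w)).
have M0 : 0 <= M by apply: modulus_ge0.
have h'' : modulus (phi x - w - cmul l (chart i x - chart i (e w))) <= 2 * eta1 * M.
  apply: le_trans (modulus_le_norm _) _; rewrite -mulrA ler_pM2l//; apply: le_trans h' _.
  by rewrite ler_pM2l// norm_le_modulus.
have k1 : `|modulus (phi x - w) - modulus l * M| <= 2 * eta1 * M.
  rewrite -modulusM ler_norml; apply/andP; split.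
    have := ler_modulusD (phi x - w) (- (phi x - w - cmul l (chart i x - chart i (e w)))).
    by rewrite modulusN opprB addrC subrK; lra.
  have := ler_modulusD (phi x - w - cmul l (chart i x - chart i (e w))) (cmul l (chart i x - chart i (e w))).
  by rewrite subrK; lra.
have k2 : modulus (phi x - w) <= (modulus l + 2) * M.
  move: k1; rewrite ler_norml => /andP[_].
  have : eta1 * M <= 1 * M by rewrite ler_wpM2r// ge_min lexx orbT.
  lra.
rewrite rhoE.
have -> : hd (phi x) w - modulus l / w.2 * M =
  (hd (phi x) w - modulus (phi x - w) / w.2) + (modulus (phi x - w) - modulus l * M) / w.2.
  by field; rewrite gt_eqF.
apply: le_trans (ler_normD _ _) _; rewrite (normrM _ w.2^-1) (gtr0_norm w20).
apply: (@le_trans _ _ (eta1 * ((modulus l + 2) * M) + 2 * eta1 * M / w.2)).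
  apply: lerD; first by apply: le_trans h _; rewrite ler_pM2l.
  by rewrite ler_pM2r.
have -> : eta1 * ((modulus l + 2) * M) + 2 * eta1 * M / w.2 = eta1 * (2 + modulus l + 2 * w.2^-1) * M by ring.
rewrite ler_wpM2r//; apply: (@le_trans _ _ (eta * (2 + modulus l + w.2^-1 *+ 4))).
  apply: ler_pM; rewrite ?(ltW eta0)//.
  - by rewrite !addr_ge0 ?mulr_ge0 ?(ltW w20) ?(ltW ml0).
  - by rewrite ge_min lexx.
  - by rewrite lerD2l; lra.
by rewrite /eta divfK// gt_eqF.
Unshelve. all: by end_near. Qed.

Lemma construct_ballchart : ballchart phi e (f p) r.
Proof.
have fp : 0 < (f p).2 by have [] := hol (z := p) ltac:(by rewrite subrr normr0).
split => //.
- by move=> w /ballP/e_dom[].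
- move=> w /ballP ws; have [gr gE] := gP ws; have [ci _ _ _ _] := hol gr.
  by apply: continuous_comp; [exact: g_cont | exact: param_cvg].
- move=> w U /ballP ws wU; have [di gE pE] := e_dom ws; have [gr fgE] := gP ws.
  near=> x; have [dx xr xs xE] : [/\ dom i0 x, `|chart i0 x - p| < r0, `|phi x - f p| < s & e (phi x) = x].
    by near: x; exact: near_phi.
  exists (phi x) => //; near: x.
  apply: (@near_continuous _ _ phi _ U); last by rewrite pE.
  by apply: continuous_comp; [exact: chart_cvg | rewrite gE; exact: f_cont].
- move=> w i hw diw; have ws := ballP hw; have [lip _] := loc ws (proj1 hw) diw; exact: lip.
- move=> w i hw diw; have ws := ballP hw; have [_ sp] := loc ws (proj1 hw) diw; exact: sp.
Unshelve. all: by end_near. Qed.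

End Construction.

Lemma exists_ballchart x : hyperbolic_metric rho ->
  exists phi e o r, ballchart phi e o r /\ e o = x.
Proof.
move=> hyp; have [i di] := dom_cover x; have [f nf] := hyp i x di.
set p := chart i x in nf *.
have /near_normP[d0 d00 H0] : \forall z \near p, [/\ chart_image i z, holomorphic_at f z,
    cderiv f z != 0, 0 < (f z).2 & rho i z = modulus (cderiv f z) / (f z).2].
  near=> z; have [? ? ? ?] : [/\ holomorphic_at f z, cderiv f z != 0, 0 < (f z).2 &
    rho i z = modulus (cderiv f z) / (f z).2] by near: z.
  by split => //; near: z; exact/near_chart_image/chart_in.
have hol z : `|z - p| < d0 -> [/\ chart_image i z, cdiff f z (cderiv f z),
    cderiv f z != 0, 0 < (f z).2 & rho i z = modulus (cderiv f z) / (f z).2].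
  by move=> /H0[? /holomorphic_cdiff ? ? ? ?]; split.
have [cp dp np fp _] := hol p ltac:(by rewrite subrr normr0).
have sd : \forall z \near p, exists m, cdiff f z m.
  near=> z; have zp : `|z - p| < d0 by near: z; exact: near_norm_lt.
  have [_ dz _ _ _] := hol z zp.
  by exists (cderiv f z).
have [K [r0 [s [K0 /andP[r00 r0d] s0 bilip surj]]]] :=
  local_inverse d00 np (strictly_differentiable sd dp).
(* A section of f, chosen by surjectivity; the bi-Lipschitz bounds make it a continuous inverse. *)
pose g w := if pselect (exists z, `|z - p| < r0 /\ f z = w) is left h then projT1 (cid h) else p.
have gP w : `|w - f p| < s -> `|g w - p| < r0 /\ f (g w) = w.
  move=> /surj[z zr zw]; rewrite /g; case: pselect => [h|[]]; last by exists z.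
  by case: cid.
have [r rp Hr] := hd_nbhs fp s0.
exists (f \o chart i), (param i \o g), (f p), r; split.
  apply: construct_ballchart r00 K0 rp _ bilip gP _ => [z zr|w [w0 wr]]; first by apply: hol; exact: lt_le_trans r0d.
  exact: Hr.
have [gr gE] := gP (f p) ltac:(by rewrite subrr normr0).
have [h _] := bilip _ p gr ltac:(by rewrite subrr normr0).
rewrite gE subrr normr0 mulr0 normr_le0 subr_eq0 in h.
by rewrite /= (eqP h) /p chartK.
Unshelve. all: by end_near. Qed.

Lemma near_hball o r w : 0 < o.2 -> hball o r w -> \forall v \near w, hball o r v.
Proof.
move=> o0 [w0 wr]; have [d d0 H] := hd_small w0 (e := r - hd o w) ltac:(by rewrite subr_gt0).
near=> v; have vd : `|v - w| < d by near: v; exact: near_norm_lt.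
have [_ v0 wv] := H w v ltac:(by rewrite subrr normr0) vd.
split=> //; apply: le_lt_trans (hd_triangle (v := w) o0 w0 v0) _; lra.
Unshelve. all: by end_near. Qed.

Lemma hball_center o r : 0 < o.2 -> 0 < r -> hball o r o.
Proof. by move=> o0 r0; split=> //; rewrite hdxx. Qed.

Section Facts.
Variables (phi : X -> R * R) (e : R * R -> X) (o : R * R) (r : R).
Hypothesis bc : ballchart phi e o r.

Lemma sub_ballchart o' r' : 0 < o'.2 -> 0 < r' -> hd o o' + r' <= r -> ballchart phi e o' r'.
Proof.
move=> o'0 r'0 h; have S w : hball o' r' w -> hball o r w.
  move=> [w0 wr]; split => //.
  by apply: le_lt_trans (hd_triangle (v := o') (bc_o bc) o'0 w0) _; lra.
split=> // [w /S|w /S|w U /S|w i /S|w i /S].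
- by move=> hw; exact: (bcK bc hw).
- by move=> hw; exact: (bc_cont bc hw).
- by move=> hw; exact: (bc_open bc hw).
- by move=> hw; exact: (bc_lip bc hw).
- by move=> hw; exact: (bc_speed bc hw).
Qed.

Lemma near_ballchart z : hball o r z ->
  \forall x \near e z, hball o r (phi x) /\ e (phi x) = x.
Proof.
move=> zr; apply: filterS (bc_open bc zr (near_hball (bc_o bc) zr)) => _ [w wr <-].
by rewrite (bcK bc wr).
Qed.

Lemma phi_continuous z : hball o r z -> {for e z, continuous phi}.
Proof.
move=> zr U; rewrite /= (bcK bc zr) => zU.
have zI : nbhs z (U `&` hball o r) by apply: filterI => //; exact: near_hball (bc_o bc) zr.
by apply: filterS (bc_open bc zr zI) => _ [w [wU wr] <-]; rewrite /= (bcK bc wr).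
Qed.

End Facts.

(** * Changes of ball chart are isometries *)

Section Transport.
Variables (phi1 phi2 : X -> R * R) (e1 e2 : R * R -> X).

(** Both charts see the same density at the common point, so the change of chart has dilation 1
    there, up to the factor 1 + eps nearby. *)
Lemma transport_infinitesimal o1 r1 o2 r2 u v (eps : R) :
  ballchart phi1 e1 o1 r1 -> ballchart phi2 e2 o2 r2 ->
  hball o1 r1 u -> hball o2 r2 v -> e1 u = e2 v -> 0 < eps ->
  \forall w \near u, [/\ hball o2 r2 (phi2 (e1 w)), e2 (phi2 (e1 w)) = e1 w &
    hd v (phi2 (e1 w)) <= (1 + eps) * hd u w].
Proof.
move=> b1 b2 u1 v2 uv eps0.
have [i di] := dom_cover (e1 u).
have [rho0 S1] := bc_speed b1 u1 di.
have di2 : dom i (e2 v) by rewrite -uv.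
have [_ S2] := bc_speed b2 v2 di2.
set p := rho i (chart i (e1 u)) in rho0 S1.
have q0 : 0 < 2 + eps by rewrite addr_gt0.
(* This solves p + eta = (1 + eps) (p - eta). *)
pose eta := p * eps / (2 + eps).
have eta0 : 0 < eta by rewrite divr_gt0// mulr_gt0.
near=> w.
have w1 : hball o1 r1 w by near: w; apply: near_hball => //; exact: bc_o b1.
have [h1 h2] : hball o2 r2 (phi2 (e1 w)) /\ e2 (phi2 (e1 w)) = e1 w.
  near: w; apply: (@near_continuous _ _ e1 u (fun x => hball o2 r2 (phi2 x) /\ e2 (phi2 x) = x)).
    exact: bc_cont b1 _ u1.
  by rewrite uv; exact: near_ballchart b2 _ v2.
split=> //.
have k1 : `|hd (phi1 (e1 w)) u - p * modulus (chart i (e1 w) - chart i (e1 u))| <=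
    eta * modulus (chart i (e1 w) - chart i (e1 u)).
  near: w; apply: (@near_continuous _ _ e1 u (fun x => `|hd (phi1 x) u - p * modulus (chart i x - chart i (e1 u))| <=
    eta * modulus (chart i x - chart i (e1 u)))); first exact: bc_cont b1 _ u1.
  exact: S1.
have k2 : `|hd (phi2 (e1 w)) v - p * modulus (chart i (e1 w) - chart i (e1 u))| <=
    eta * modulus (chart i (e1 w) - chart i (e1 u)).
  near: w; apply: (@near_continuous _ _ e1 u (fun x => `|hd (phi2 x) v - p * modulus (chart i x - chart i (e1 u))| <=
    eta * modulus (chart i x - chart i (e1 u)))); first exact: bc_cont b1 _ u1.
  by rewrite /p uv; exact: S2.
rewrite (bcK b1 w1) in k1; rewrite hdC [hd u w]hdC.
set M := modulus _ in k1 k2; have M0 : 0 <= M by apply: modulus_ge0.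
move: k1 k2; rewrite !ler_norml => /andP[k1 _] /andP[_ k2].
have : (p + eta) * M = (1 + eps) * ((p - eta) * M) by rewrite /eta; field; rewrite gt_eqF.
have : (1 + eps) * ((p - eta) * M) <= (1 + eps) * hd w u by rewrite ler_pM2l ?addr_gt0//; lra.
lra.
Unshelve. all: by end_near. Qed.

Lemma geo_near u w t (U : set (R * R)) : 0 < u.2 -> 0 < w.2 -> 0 <= t <= 1 ->
  nbhs (geo t u w) U -> exists2 eta, 0 < eta & forall s, 0 <= s <= 1 -> `|s - t| < eta -> U (geo s u w).
Proof.
move=> u0 w0 t01 /near_normP[d d0 HU].
have J0 := geo_gt0 u0 w0 t01.
have [eps eps0 Heps] := hd_nbhs J0 d0.
have D0 : 0 <= hd u w by apply: hd_ge0.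
exists (eps / (hd u w + 1)); first by rewrite divr_gt0// ltr_wpDl.
move=> s s01 st; apply: HU; apply: Heps; first exact: geo_gt0.
rewrite hd_geo// distrC; move: st; rewrite ltr_pdivlMr ?ltr_wpDl//.
by apply: le_lt_trans; rewrite mulrDr mulr1 lerDl.
Qed.

Hypothesis Xhaus : hausdorff_space X.

(** Continuity induction along the geodesic from u to w, with dilation 1 + eps.
    [transport_infinitesimal] gives the open step; the closed step is that the path cannot leave the
    second chart while its length stays below r. Then eps tends to 0. *)
Lemma transport_le u v r : ballchart phi1 e1 u r -> ballchart phi2 e2 v r -> e1 u = e2 v ->
  forall w, hball u r w -> [/\ hball v r (phi2 (e1 w)), e2 (phi2 (e1 w)) = e1 w &
    hd v (phi2 (e1 w)) <= hd u w].
Proof.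
move=> b1 b2 uv w [w0 wr].
have u0 := bc_o b1; have v0 := bc_o b2; have r0 := bc_r b1.
have D0 : 0 <= hd u w by apply: hd_ge0.
set D := hd u w in wr D0 *.
have Jb s : 0 <= s <= 1 -> hball u r (geo s u w).
  move=> s01; have /andP[s0 s1] := s01; split; first exact: geo_gt0.
  rewrite -{1}(geo0 u0 w0) hd_geo ?lexx ?ler01// sub0r normrN ger0_norm//.
  by apply: le_lt_trans wr; rewrite -/D -[leRHS]mul1r ler_wpM2r.
have key (eps : R) : 0 < eps -> D * (1 + eps) < r -> forall s, 0 <= s <= 1 ->
   [/\ hball v r (phi2 (e1 (geo s u w))), e2 (phi2 (e1 (geo s u w))) = e1 (geo s u w) &
    hd v (phi2 (e1 (geo s u w))) <= s * (D * (1 + eps))].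
  move=> eps0 epsr; set L := D * (1 + eps) in epsr *.
  have L0 : 0 <= L by rewrite mulr_ge0// addr_ge0// ltW.
  apply: real_induction => [t t01 IH|t /andP[t0 t1] IH].
    have /andP[t0 t1] := t01.
    have [->|tn0] := eqVneq t 0.
      rewrite geo0// uv (bcK b2 (hball_center v0 r0)) hdxx// mul0r lexx; split => //.
      exact: hball_center.
    (* The image of a closed ball is compact, hence closed in the Hausdorff space X, so it contains
       the limit of the part of the path already transported. *)
    pose K := e2 @` [set z | 0 < z.2 /\ hd v z <= t * L].
    have tL : t * L < r by apply: le_lt_trans epsr; rewrite -[leRHS]mul1r ler_wpM2r.
    have Kb z : 0 < z.2 /\ hd v z <= t * L -> hball v r z.
      by move=> [z0 zr]; split => //; exact: le_lt_trans tL.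
    have cK : closed K.
      apply: compact_closed => //; apply: continuous_compact; last exact: closed_hball_compact.
      apply/continuous_in_subspaceT => z; rewrite inE => /Kb zb; exact: bc_cont b2 _ zb.
    have : K (e1 (geo t u w)).
      apply: contrapT => nK.
      have nU : nbhs (geo t u w) (e1 @^-1` ~` K).
        apply: (bc_cont b1 (Jb t t01)); apply: open_nbhs_nbhs; split=> //; exact: closed_openC.
      have [eta eta0 Heta] := geo_near u0 w0 t01 nU.
      pose s := Num.max 0 (t - eta / 2).
      have s0 : 0 <= s by rewrite le_max lexx.
      have st : s < t by rewrite gt_max lt_neqAle eq_sym tn0 t0/= gtrBl divr_gt0.
      have ts : t - s < eta.
        have : t - eta / 2 <= s by rewrite le_max lexx orbT.
        by lra.
      have s01 : 0 <= s <= 1 by rewrite s0 (ltW (lt_le_trans st t1)).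
      have [h1 h2 h3] := IH s ltac:(by rewrite s0 st).
      apply: (Heta s s01); first by rewrite distrC gtr0_norm ?subr_gt0.
      exists (phi2 (e1 (geo s u w))) => //; split; first by case: h1.
      by apply: le_trans h3 _; rewrite ler_wpM2r// ltW.
    move=> [z zK zE]; rewrite -zE (bcK b2 (Kb z zK)); split=> //; first exact: Kb.
    by case: zK.
  have t01 : 0 <= t <= 1 by rewrite t0 ltW.
  have [h1 h2 h3] := IH t ltac:(by rewrite t0 lexx).
  have := transport_infinitesimal b1 b2 (Jb t t01) h1 (esym h2) eps0.
  move=> /(geo_near u0 w0 t01)[eta eta0 Heta].
  exists (Num.min eta (1 - t)); first by rewrite lt_min eta0 subr_gt0.
  move=> s /andP[ts]; rewrite -ltrBlDl lt_min => /andP[se s1].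
  have s01 : 0 <= s <= 1 by apply/andP; split; lra.
  have [k1 k2 k3] := Heta s s01 ltac:(by rewrite gtr0_norm ?subr_gt0).
  split=> //; apply: le_trans (hd_triangle v0 (proj1 h1) (proj1 k1)) _.
  rewrite hd_geo// distrC gtr0_norm ?subr_gt0// in k3.
  have -> : s * L = t * L + (1 + eps) * ((s - t) * D) by rewrite /L; ring.
  exact: lerD.
have e0 : 0 < r - D by rewrite subr_gt0.
have one : 0 <= (1 : R) <= 1 by rewrite ler01 lexx.
(* The bound on eps keeps D (1 + eps) below r. *)
have K eps : 0 < eps -> eps <= (r - D) / 2 / (D + 1) -> [/\ hball v r (phi2 (e1 w)), e2 (phi2 (e1 w)) = e1 w &
    hd v (phi2 (e1 w)) <= D * (1 + eps)].
  move=> eps0 he; have := key eps eps0 _ 1 one; rewrite geo1// mul1r; apply.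
  move: he; rewrite ler_pdivlMr ?ltr_wpDl// => he.
  have : D * eps <= (r - D) / 2 by apply: le_trans he; rewrite mulrC ler_wpM2l ?(ltW eps0)// lerDl.
  rewrite mulrDr mulr1; lra.
pose q := (r - D) / 2 / (D + 1).
have qp : 0 < q by rewrite !divr_gt0// ltr_wpDl.
have [h1 h2 _] := K q qp (lexx _); split=> //.
apply/ler_addgt0Pr => t tp.
have mp : 0 < Num.min q (t / (D + 1)) by rewrite lt_min qp divr_gt0// ltr_wpDl.
have [|_ _ /le_trans] := K _ mp; first by rewrite ge_min lexx.
apply; rewrite mulrDr mulr1 lerD2l.
apply: (@le_trans _ _ (D * (t / (D + 1)))).
  by rewrite ler_wpM2l// ge_min lexx orbT.
by rewrite mulrA ler_pdivrMr ?ltr_wpDl// mulrC mulrDr mulr1 ler_wpDr// ltW.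
Qed.

End Transport.

Lemma transport phi1 phi2 e1 e2 u v r : hausdorff_space X ->
  ballchart phi1 e1 u r -> ballchart phi2 e2 v r -> e1 u = e2 v ->
  forall w, hball u r w -> [/\ hball v r (phi2 (e1 w)), e2 (phi2 (e1 w)) = e1 w &
    hd v (phi2 (e1 w)) = hd u w].
Proof.
move=> hX b1 b2 uv w wr; have [h1 h2 h3] := transport_le hX b1 b2 uv wr.
split=> //; apply/le_anti; rewrite h3/=.
by have [_ _] := transport_le hX b2 b1 (esym uv) h1; rewrite h2 (bcK b1 wr).
Qed.

(** A ball chart of radius r at x, recentred at a point of its half ball, is a ball chart there of
    radius r / 2; compactness makes the radius uniform. *)
Lemma uniform_ballchart : hyperbolic_metric rho -> compact [set: X] -> exists2 r, 0 < r &
  forall x, exists phi e o, ballchart phi e o r /\ e o = x.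
Proof.
move=> hyp /compact_near_coveringP cX.
pose P (r : R) x := exists phi e o, ballchart phi e o r /\ e o = x.
have := cX R (0 : R)^'+ P _.
have H : forall x, [set: X] x -> \forall x' \near x & r \near (0 : R)^'+, P r x'.
  move=> x _; have [phi [e [z0 [r [bc eo]]]]] := exists_ballchart x hyp.
  have r0 := bc_r bc; have o0 := bc_o bc.
  have r2 : 0 < r / 2 by rewrite divr_gt0.
  have bc2 : ballchart phi e z0 (r / 2) by apply: (sub_ballchart bc) => //; rewrite hdxx// add0r; lra.
  near=> x' r' => /=.
  have [[p0 pr] pE] : hball z0 (r / 2) (phi x') /\ e (phi x') = x'.
    by near: x'; rewrite -eo; apply: (near_ballchart bc2); exact: hball_center.
  exists phi, e, (phi x'); split=> //; apply: (sub_ballchart bc) => //.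
  have : r' <= r / 2 by near: r'; exact: nbhs_right_le.
  by lra.
move=> /(_ _ H) near_r.
near (0 : R)^'+ => r; exists r => // x.
have : [set: X] `<=` P r by near: r.
by apply.
Unshelve. all: by end_near. Qed.

End BallCharts.

Lemma continuous_pair (R : realType) (T : topologicalType) (f g : T -> R) (t : T) :
  {for t, continuous f} -> {for t, continuous g} -> {for t, continuous (fun s => (f s, g s))}.
Proof.
move=> /cvgrPdist_lt cf /cvgrPdist_lt cg; apply/(@cvgrPdist_lt _ (R * R)%type) => ep ep0.
near=> s; rewrite norm_pair gt_max/=; apply/andP.
by split; near: s; [exact: cf | exact: cg].
Unshelve. all: by end_near. Qed.

Lemma continuous_fst (R : realType) (T : topologicalType) (z : T -> R * R) (t : T) :
  {for t, continuous z} -> {for t, continuous (fun s => (z s).1)}.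
Proof.
move=> /(@cvgrPdist_lt _ (R * R)%type) cz; apply/(@cvgrPdist_lt _ R^o) => ep ep0.
near=> s; have : `|z t - z s| < ep by near: s; exact: cz.
exact: le_lt_trans (norm_fst_le (z t - z s)).
Unshelve. all: by end_near. Qed.

Lemma continuous_snd (R : realType) (T : topologicalType) (z : T -> R * R) (t : T) :
  {for t, continuous z} -> {for t, continuous (fun s => (z s).2)}.
Proof.
move=> /(@cvgrPdist_lt _ (R * R)%type) cz; apply/(@cvgrPdist_lt _ R^o) => ep ep0.
near=> s; have : `|z t - z s| < ep by near: s; exact: cz.
exact: le_lt_trans (norm_snd_le (z t - z s)).
Unshelve. all: by end_near. Qed.

Lemma pt_cvg (R : realType) (T : topologicalType) (l m : T -> R) (z w : T -> R * R) (t : T) :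
  0 <= l t -> 0 <= m t -> 0 < l t + m t -> 0 < (z t).2 -> 0 < (w t).2 ->
  {for t, continuous l} -> {for t, continuous m} -> {for t, continuous z} -> {for t, continuous w} ->
  {for t, continuous (fun s => pt (l s) (m s) (z s) (w s))}.
Proof.
move=> l0 m0 lm0 z0 w0 cl cm cz cw.
have cz1 : (z s).1 @[s --> t] --> (z t).1 by exact: continuous_fst cz.
have cz2 : (z s).2 @[s --> t] --> (z t).2 by exact: continuous_snd cz.
have cw1 : (w s).1 @[s --> t] --> (w t).1 by exact: continuous_fst cw.
have cw2 : (w s).2 @[s --> t] --> (w t).2 by exact: continuous_snd cw.
have zn : (z t).2 != 0 by rewrite gt_eqF.
have wn : (w t).2 != 0 by rewrite gt_eqF.
have cp : l s / (z s).2 + m s / (w s).2 @[s --> t] --> l t / (z t).2 + m t / (w t).2.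
  by apply: cvgD; apply: cvgM => //; exact: cvgV.
have p0 : l t / (z t).2 + m t / (w t).2 != 0.
  rewrite gt_eqF//; have h1 : 0 <= l t / (z t).2 by rewrite divr_ge0// ltW.
  have h2 : 0 <= m t / (w t).2 by rewrite divr_ge0// ltW.
  have [lp|lp] := ltP 0 (l t); first by rewrite ltr_pwDl// divr_gt0.
  by rewrite ltr_wpDl// divr_gt0//; lra.
have cB : hB (z s) (w s) @[s --> t] --> hB (z t) (w t).
  rewrite /hB; apply: cvgM.
    apply: cvgD; last by rewrite expr2; under eq_fun do rewrite expr2; exact: cvgM.
    apply: cvgD; last by rewrite expr2; under eq_fun do rewrite expr2; exact: cvgM.
    by rewrite expr2; under eq_fun do rewrite expr2; apply: cvgM; exact: cvgB.
  apply: cvgV; first by rewrite !mulf_neq0// pnatr_eq0.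
  by apply: cvgM => //; apply: cvgM => //; exact: cvg_cst.
apply: continuous_pair.
  apply: cvgM; last exact: cvgV.
  by apply: cvgD; (apply: cvgM; [exact: cvgM | exact: cvgV]).
apply: cvgM; last exact: cvgV.
apply: (@cvg_comp _ _ _ _ Num.sqrt _ (nbhs (l t ^+ 2 + m t ^+ 2 + 2 * l t * m t * hB (z t) (w t)))); last exact: sqrt_continuous.
apply: cvgD; last by apply: cvgM => //; apply: cvgM => //; apply: cvgM => //; exact: cvg_cst.
by rewrite !expr2; under eq_fun do rewrite !expr2; apply: cvgD; exact: cvgM.
Qed.

Lemma hd_pt_le (R : realType) (l m : R) (z w : R * R) : 0 <= l -> 0 <= m -> 0 < l + m ->
  0 < z.2 -> 0 < w.2 -> hd z (pt l m z w) <= hd z w.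
Proof.
move=> l0 m0 lm0 z0 w0; have p0 := pt_gt0 l0 m0 lm0 z0 w0.
rewrite -ler_cosh ?hd_ge0// !cosh_hd// hBC hB_pt// hBxx// (hBC w z).
have N0 := pt_norm_gt0 l0 m0 lm0 z0 w0; have b1 := hB_ge1 z0 w0.
set b := hB z w in N0 b1 *.
rewrite ler_pdivrMr ?sqrtr_gt0//; apply: sqr_le_le.
  by rewrite mulr_ge0 ?sqrtr_ge0//; lra.
rewrite exprMn sqr_sqrtr ?(ltW N0)//.
have : 0 <= (b ^+ 2 - 1) * (l ^+ 2 + 2 * l * m * b).
  apply: mulr_ge0; first by have : 1 * 1 <= b * b by [apply: ler_pM]; rewrite expr2; lra.
  have b0 : 0 <= b by lra.
  apply: addr_ge0; first exact: sqr_ge0.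
  by apply: mulr_ge0 => //; apply: mulr_ge0 => //; apply: mulr_ge0.
by rewrite !expr2 => h; rewrite -subr_ge0; apply: le_trans h _; rewrite le_eqVlt; apply/orP; left; apply/eqP; ring.
Qed.

(** * The local distance of the surface, its midpoints and short geodesics *)

(** With d the scale, radius 16 d leaves room to recentre the chart at any point within 4 d and keep
    a radius 8 d, the maximal distance of two such points. The bound by 1 makes [cosh 1] a uniform
    bound for [hB] later. *)
Record ballAtlas (R : realType) (X : riemannSurface R) (rho : conformalMetric X) := BallAtlas {
  scale : R;
  ball_log : X -> X -> R * R;
  ball_exp : X -> R * R -> X;
  ball_origin : X -> R * R;
  scale_gt0 : 0 < scale;
  scale_le1 : 16 * scale <= 1;
  atlas_ballchart : forall a, ballchart rho (ball_log a) (ball_exp a) (ball_origin a) (16 * scale);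
  ball_exp_origin : forall a, ball_exp a (ball_origin a) = a
}.

Section LocalMetric.
Variables (R : realType) (X : riemannSurface R) (rho : conformalMetric X) (M : ballAtlas rho).
Local Notation d := (scale M).
Local Notation phi := (ball_log M).
Local Notation e := (ball_exp M).
Local Notation o := (ball_origin M).
Let hX : hausdorff_space X := @surface_hausdorff R X.
Let bc := @atlas_ballchart R X rho M.
Let eo := @ball_exp_origin R X rho M.
Implicit Types (a x y : X) (z w : R * R).

(* Junk value 16 d outside the ball chart at x: only small distances are
   meaningful. *)
Definition ldist x y : R :=
  if `[< hball (o x) (16 * d) (phi x y) /\ e x (phi x y) = y >]
  then hd (o x) (phi x y) else 16 * d.
Local Notation D := ldist.

Let o0 a : 0 < (o a).2. Proof. exact: bc_o (bc a). Qed.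

(** The chart at [a], recentred at z, and the chart at the point [e a z] itself both contain balls
    of radius 8 d; [transport] identifies distances in the two. *)
Lemma ldistE a z w : hball (o a) (4 * d) z -> hball (o a) (4 * d) w -> 
  [/\ hball (o (e a z)) (8 * d) (phi (e a z) (e a w)), e (e a z) (phi (e a z) (e a w)) = e a w,
   hd (o (e a z)) (phi (e a z) (e a w)) = hd z w & D (e a z) (e a w) = hd z w].
Proof.
have d0 := scale_gt0 M.
move=> [z0 zr] [w0 wr];
have zw : hd z w < 8 * d.
  by have := hd_triangle z0 (o0 a) w0; rewrite (hdC z (o a)); lra.
have b1 : ballchart rho (phi a) (e a) z (8 * d) by apply: (sub_ballchart (bc a)) => //; lra.
have b2 : ballchart rho (phi (e a z)) (e (e a z)) (o (e a z)) (8 * d).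
  by apply: (sub_ballchart (bc _)) => //; rewrite ?hdxx//; lra.
have [h1 h2 h3] := transport hX b1 b2 (esym (eo _)) (conj w0 zw).
have [h4 h5] := h1.
split=> //; rewrite /D; case: asboolP => // -[]; split => //; split => //; lra.
Qed.

Lemma ldist_lt x y : D x y < 16 * d ->
  [/\ 0 < (phi x y).2, e x (phi x y) = y & D x y = hd (o x) (phi x y)].
Proof. by rewrite /D; case: asboolP => [[[? ?] ?] _|_]; [split | rewrite ltxx]. Qed.

Lemma ldist_in a x : D a x < 4 * d ->
  [/\ hball (o a) (4 * d) (phi a x), e a (phi a x) = x & D a x = hd (o a) (phi a x)].
Proof.
have d0 := scale_gt0 M.
move=> h; have [h1 h2 h3] := @ldist_lt a x ltac:(lra).
by split=> //; split=> //; rewrite -h3.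
Qed.

Lemma ldist_center a z : hball (o a) (4 * d) z -> D a (e a z) = hd (o a) z.
Proof.
have d0 := scale_gt0 M.
move=> zr;
have cc : hball (o a) (4 * d) (o a) by apply: hball_center => //; lra.
by have [_ _ _] := ldistE cc zr; rewrite eo.
Qed.

Lemma ldist_chart a x y : D a x < 4 * d -> D a y < 4 * d -> D x y = hd (phi a x) (phi a y).
Proof.
have d0 := scale_gt0 M.
by move=> /ldist_in[h1 h2 _] /ldist_in[k1 k2 _]; have [_ _ _] := ldistE h1 k1; rewrite h2 k2.
Qed.

Lemma ldistxx x : D x x = 0.
Proof.
have d0 := scale_gt0 M.
by rewrite -{2}(eo x) ldist_center ?hdxx//; apply: hball_center => //; lra.
Qed.

Lemma ldist_ge0 x y : 0 <= D x y.
Proof.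
have d0 := scale_gt0 M.
by rewrite /D; case: asboolP => [[[? ?] ?]|_]; [rewrite hd_ge0 | lra].
Qed.

Lemma ldistC x y : D x y < 4 * d -> D y x = D x y.
Proof.
have d0 := scale_gt0 M.
move=> h; have xx : D x x < 4 * d by rewrite ldistxx; lra.
by rewrite (ldist_chart h xx) (ldist_chart xx h) hdC.
Qed.

Lemma ldist_triangle y x (z : X) : D x y < 4 * d -> D y z < 4 * d -> D x z <= D x y + D y z.
Proof.
have d0 := scale_gt0 M.
move=> h k; have h' : D y x < 4 * d by rewrite ldistC.
have yy : D y y < 4 * d by rewrite ldistxx; lra.
rewrite (ldist_chart h' k) (ldist_chart h' yy) (ldist_chart yy k).
have [[? _] _ _] := ldist_in h'; have [[? _] _ _] := ldist_in k; have [[? _] _ _] := ldist_in yy.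
exact: hd_triangle.
Qed.

Lemma near_ldist x (ep : R) : 0 < ep -> \forall y \near x, D x y < ep.
Proof.
have d0 := scale_gt0 M.
move=> ep0;
have xr : hball (o x) (Num.min ep (4 * d)) (o x).
  by apply: hball_center => //; rewrite lt_min ep0; lra.
have b : ballchart rho (phi x) (e x) (o x) (Num.min ep (4 * d)).
  apply: (sub_ballchart (bc x)) => //; first by rewrite lt_min ep0; lra.
  by rewrite hdxx//; have : Num.min ep (4 * d) <= 4 * d by [rewrite ge_min lexx orbT]; lra.
have := near_ballchart b xr; rewrite eo; apply: filterS => y [[h1 h2] <-].
move: h2; rewrite lt_min => /andP[h2 h3].
by rewrite ldist_center.
Qed.

Lemma ldist_nbhs x U : nbhs x U -> exists2 ep, 0 < ep & forall y, D x y < ep -> U y.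
Proof.
have d0 := scale_gt0 M.
move=> xU;
have xr : hball (o x) (16 * d) (o x) by apply: hball_center => //; lra.
have := bc_cont (bc x) xr; rewrite /prop_for /continuous_at eo => /(_ U xU).
move=> /near_normP[r r0 Hr]; have [ep ep0 H] := hd_nbhs (o0 x) r0.
exists (Num.min ep (4 * d)); first by rewrite lt_min ep0; lra.
move=> y; rewrite lt_min => /andP[h1 /ldist_in[[h2 h3] E hD]].
by rewrite -E; apply: Hr; apply: H => //; rewrite -hD.
Qed.

Lemma ldist_bilip x i : dom i x -> exists2 K : R, 0 < K &
    \forall y \near x & z \near x,
      `|chart i y - chart i z| <= K * D y z /\ D y z <= K * `|chart i y - chart i z|.
Proof.
have d0 := scale_gt0 M.
move=> dx;
have xr : hball (o x) (16 * d) (o x) by apply: hball_center => //; lra.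
have dx' : dom i (e x (o x)) by rewrite eo.
have [K K0] := bc_lip (bc x) xr dx'; rewrite eo => H.
have N : \forall y \near x & z \near x, D x y < 4 * d /\ D x z < 4 * d.
  by near=> y z => /=; split; [near: y | near: z]; apply: near_ldist; lra.
exists K => //; apply: filterS2 H N => -[y z] /= h [yr zr].
by rewrite (ldist_chart yr zr).
Unshelve. all: by end_near. Qed.

Lemma ldist_speed x i (ep : R) : dom i x -> 0 < ep -> \forall y \near x,
  `|D x y - rho i (chart i x) * modulus (chart i y - chart i x)|
        <= ep * modulus (chart i y - chart i x).
Proof.
have d0 := scale_gt0 M.
move=> dx ep0;
have xr : hball (o x) (16 * d) (o x) by apply: hball_center => //; lra.
have dx' : dom i (e x (o x)) by rewrite eo.
have [_ /(_ ep ep0)] := bc_speed (bc x) xr dx'; rewrite eo => H.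
near=> y.
have yr : D x y < 4 * d by near: y; apply: near_ldist; lra.
have [_ _ ->] := ldist_in yr; rewrite hdC; near: y; exact: H.
Unshelve. all: by end_near. Qed.

Lemma density_gt0 x i : dom i x -> 0 < rho i (chart i x).
Proof.
have d0 := scale_gt0 M.
move=> dx;
have xr : hball (o x) (16 * d) (o x) by apply: hball_center => //; lra.
by have [] := bc_speed (bc x) xr (i := i) ltac:(by rewrite eo); rewrite eo.
Qed.

Lemma ldist_continuous (T : topologicalType) (f g : T -> X) t :
  {for t, continuous f} -> {for t, continuous g} -> D (f t) (g t) < d ->
  {for t, continuous (fun s => D (f s) (g s))}.
Proof.
have d0 := scale_gt0 M.
move=> cf cg h;
apply/(@cvgrPdist_lt _ R^o) => ep ep0; near=> s.
have m0 : 0 < Num.min (ep / 2) d by rewrite lt_min divr_gt0.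
have fs : D (f t) (f s) < Num.min (ep / 2) d.
  by near: s; apply: (@near_continuous _ _ f t (fun y => D (f t) y < Num.min (ep / 2) d)) => //; apply: near_ldist; rewrite lt_min divr_gt0.
have gs : D (g t) (g s) < Num.min (ep / 2) d.
  by near: s; apply: (@near_continuous _ _ g t (fun y => D (g t) y < Num.min (ep / 2) d)) => //; apply: near_ldist; rewrite lt_min divr_gt0.
move: fs gs; rewrite !lt_min => /andP[f1 f2] /andP[g1 g2].
have fC : D (f s) (f t) = D (f t) (f s) by apply: ldistC; lra.
have gC : D (g s) (g t) = D (g t) (g s) by apply: ldistC; lra.
have h1 : D (f s) (g t) <= D (f s) (f t) + D (f t) (g t) by apply: ldist_triangle; lra.
have h2 : D (f s) (g s) <= D (f s) (g t) + D (g t) (g s) by apply: ldist_triangle; lra.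
have h3 : D (f t) (g s) <= D (f t) (f s) + D (f s) (g s) by apply: ldist_triangle; lra.
have h4 : D (f t) (g t) <= D (f t) (g s) + D (g s) (g t) by apply: ldist_triangle; lra.
by rewrite ltr_norml; apply/andP; split; lra.
Unshelve. all: by end_near. Qed.

(** The combination [pt] of two nearby points, read in the chart at the first; by [iptE] every chart
    around gives the same point. *)
Definition ipt (l m : R) x y : X := e x (pt l m (o x) (phi x y)).
Definition lmid := ipt 1 1.
Definition lgeo (s : R) x y : X := e x (geo s (o x) (phi x y)).

Lemma iptE l m a z w : 0 <= l -> 0 <= m -> 0 < l + m -> hball (o a) d z -> hball (o a) d w ->
  ipt l m (e a z) (e a w) = e a (pt l m z w) /\ hball (o a) (4 * d) (pt l m z w).
Proof.
have d0 := scale_gt0 M.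
move=> l0 m0 lm0 [z0 zr] [w0 wr];
have zw : hd z w < 2 * d by have := hd_triangle z0 (o0 a) w0; rewrite (hdC z (o a)); lra.
set q := pt l m z w; have q0 : 0 < q.2 by exact: pt_gt0.
have zq : hd z q <= hd z w by exact: hd_pt_le.
have qr : hball (o a) (4 * d) q by split=> //; have := hd_triangle (o0 a) z0 q0; lra.
have zr4 : hball (o a) (4 * d) z by split=> //; lra.
have wr4 : hball (o a) (4 * d) w by split=> //; lra.
split=> //; set x := e a z; set y := e a w.
have [[y0 _] ye yd _] := ldistE zr4 wr4; rewrite -/x -/y in y0 ye yd.
have [[m0' _] me md mD] := ldistE zr4 qr; rewrite -/x in m0' me md mD.
have xm : D x (e a q) < 4 * d by rewrite mD; lra.
have xy : D x y < 4 * d by have [_ _ _ ->] := ldistE zr4 wr4; lra.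
have qw : hd (phi x (e a q)) (phi x y) = hd q w.
  by rewrite -(ldist_chart xm xy); have [_ _ _ ->] := ldistE qr wr4.
have ox0 := o0 x.
rewrite /ipt -[in RHS]me; congr (e x _); apply/esym/pt_unique => //.
  rewrite hBC -cosh_hd// md cosh_hd// /q hBC !hB_pt// !hBxx//.
  by rewrite -(cosh_hd w0 z0) -(cosh_hd y0 ox0) -(cosh_hd z0 w0) -(cosh_hd ox0 y0) hdC [hd (phi _ _) _]hdC yd.
rewrite -cosh_hd// qw cosh_hd// /q !hB_pt// !hBxx//.
by rewrite -(cosh_hd z0 w0) -(cosh_hd ox0 y0) yd.
Qed.

Lemma ipt_chart l m a x y : 0 <= l -> 0 <= m -> 0 < l + m -> D a x < d -> D a y < d ->
  ipt l m x y = e a (pt l m (phi a x) (phi a y)) /\ hball (o a) (4 * d) (pt l m (phi a x) (phi a y)).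
Proof.
have d0 := scale_gt0 M.
move=> l0 m0 lm0 h k;
have [[h1 _] h2 h3] := @ldist_in a x ltac:(lra); have [[k1 _] k2 k3] := @ldist_in a y ltac:(lra).
rewrite -[in LHS]h2 -[in LHS]k2; apply: iptE => //; split => //; lra.
Qed.

(** The chart used by [ipt] moves with its first argument and need not depend continuously on it;
    near t it is replaced by the fixed chart at [f t]. *)
Lemma ipt_continuous (T : topologicalType) (l m : T -> R) (f g : T -> X) t :
  (forall s, 0 <= l s /\ 0 <= m s /\ 0 < l s + m s) ->
  {for t, continuous l} -> {for t, continuous m} ->
  {for t, continuous f} -> {for t, continuous g} -> D (f t) (g t) < d ->
  {for t, continuous (fun s => ipt (l s) (m s) (f s) (g s))}.
Proof.
have d0 := scale_gt0 M.
move=> lm cl cm cf cg h;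
pose a := f t.
have nf : \forall s \near t, D a (f s) < d.
  by apply: (@near_continuous _ _ f t (fun y => D a y < d)) => //; exact: near_ldist.
have ng : \forall s \near t, D a (g s) < d.
  have cD : {for t, continuous (fun s => D a (g s))}.
    by apply: ldist_continuous => //; exact: cst_continuous.
  by apply: (@near_continuous _ _ _ t (fun y : R => y < d) cD); exact: lt_nbhsl.
have [l0 [m0 lm0]] := lm t.
have aa : D a a < d by rewrite ldistxx.
have [E tr] := ipt_chart l0 m0 lm0 aa h.
have far z : hball (o a) (4 * d) z -> hball (o a) (16 * d) z by move=> [? ?]; split => //; lra.
have cphi x : D a x < d -> {for x, continuous (phi a)}.
  move=> ax; have [z1 z2 _] := @ldist_in a x ltac:(lra).
  by rewrite -{1}z2; apply: (phi_continuous (bc a)); exact: far.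
have C : {for t, continuous (fun s => e a (pt (l s) (m s) (phi a (f s)) (phi a (g s))))}.
  apply: (@continuous_comp _ _ _ (fun s => pt (l s) (m s) (phi a (f s)) (phi a (g s))) (e a)).
    have [[z1 _] _ _] := @ldist_in a (f t) ltac:(by rewrite -/a; lra).
    have [[z2 _] _ _] := @ldist_in a (g t) ltac:(by rewrite /a; lra).
    by apply: pt_cvg => //; apply: continuous_comp => //; exact: cphi.
  by apply: (bc_cont (bc a)); exact: far.
rewrite /prop_for /continuous_at E.
apply: cvg_trans C; apply: near_eq_cvg; near=> s.
have [l0' [m0' lm0']] := lm s.
have fs : D a (f s) < d by near: s.
have gs : D a (g s) < d by near: s.
by have [-> _] := ipt_chart l0' m0' lm0' fs gs.
Unshelve. all: by end_near. Qed.

Lemma ipt_l (l : R) x y : 0 < l -> D x y < d -> ipt l 0 x y = x.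
Proof.
have d0 := scale_gt0 M.
move=> l0 xy; have [[y0 _] _ _] := @ldist_in x y ltac:(lra).
rewrite /ipt -[RHS](eo x); congr (e x _); have ox := o0 x.
have l0' := ltW l0; have l1 : 0 < l + 0 by rewrite addr0.
apply/esym/pt_unique => //; rewrite hB_pt// !mul0r !mulr0 !addr0 ?mul0r !expr2 ?mulr0 ?addr0 -expr2 sqrtr_sqr (gtr0_norm l0) mulrAC mulfV ?mul1r ?hBxx// ?gt_eqF//.
Qed.

Lemma ipt_r (l : R) x y : 0 < l -> D x y < d -> ipt 0 l x y = y.
Proof.
have d0 := scale_gt0 M.
move=> l0 xy; have [[y0 _] ye _] := @ldist_in x y ltac:(lra).
rewrite /ipt -[RHS]ye; congr (e x _); have ox := o0 x.
have l0' := ltW l0; have l1 : 0 < 0 + l by rewrite add0r.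
apply/esym/pt_unique => //; rewrite hB_pt// !mul0r !mulr0 !add0r ?mul0r !expr2 ?mulr0 ?addr0 ?add0r -expr2 sqrtr_sqr (gtr0_norm l0) mulrAC mulfV ?mul1r ?hBxx// ?gt_eqF//.
Qed.

Lemma lgeo0 x y : D x y < 4 * d -> lgeo 0 x y = x.
Proof. by move=> /ldist_in[[y0 _] ye _]; rewrite /lgeo geo0// eo. Qed.

Lemma lgeo1 x y : D x y < 4 * d -> lgeo 1 x y = y.
Proof. by move=> /ldist_in[[y0 _] ye _]; rewrite /lgeo geo1. Qed.

Lemma ldist_lgeo s t x y : D x y < 4 * d -> 0 <= s <= 1 -> 0 <= t <= 1 ->
  D (lgeo s x y) (lgeo t x y) = `|s - t| * D x y.
Proof.
have d0 := scale_gt0 M.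
move=> h s01 t01; have [[y0 yr] ye D1] := ldist_in h.
have K u : 0 <= u <= 1 -> hball (o x) (4 * d) (geo u (o x) (phi x y)).
  move=> u01; split; first exact: geo_gt0.
  rewrite -{1}(geo0 (o0 x) y0) hd_geo ?lexx ?ler01// sub0r normrN.
  case/andP: u01 => u0 u1; rewrite ger0_norm//; apply: le_lt_trans yr.
  by rewrite -[leRHS]mul1r ler_wpM2r// hd_ge0.
by have [_ _ _] := ldistE (K s s01) (K t t01); rewrite hd_geo// D1.
Qed.

(** [hd_mid_convex] and [gram_bound] read in one chart. The centre [a] in the second clause is free
    because two comparisons must later be read in the same chart. *)
Lemma ldist_lmid x0 y0 x1 y1 : D x0 y0 < d / 4 -> D x0 x1 < d / 4 -> D y0 y1 < d / 4 ->
  [/\ D (lmid x0 y0) (lmid x1 y1) <= (D x0 x1 + D y0 y1) / 2,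
      forall a (t k : R), D a x0 < d / 4 -> 0 <= t -> D x0 x1 <= 1 ->
        hB (phi a y0) (phi a x0) <= k -> hB (phi a y0) (phi a x1) <= k ->
        (D x0 x1 + D y0 y1) / 2 - t <= D (lmid x0 y0) (lmid x1 y1) ->
        gram (phi a y0) (phi a x0) (phi a x1) <= 4 * (1 + k) ^+ 2 * (2 * expR 1 ^+ 2 * t) &
      D x0 (lmid x0 y0) <= D x0 y0].
Proof.
have d0 := scale_gt0 M.
move=> h1 h2 h3.
have C a : D a x0 < d / 4 -> [/\ D (lmid x0 y0) (lmid x1 y1) =
    hd (mid (phi a x0) (phi a y0)) (mid (phi a x1) (phi a y1)),
    D x0 x1 = hd (phi a x0) (phi a x1), D y0 y1 = hd (phi a y0) (phi a y1) &
    [/\ 0 < (phi a x0).2, 0 < (phi a y0).2, 0 < (phi a x1).2 & 0 < (phi a y1).2]].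
  move=> ax; rewrite /lmid.
  have ay : D a y0 <= D a x0 + D x0 y0 by apply: ldist_triangle; lra.
  have ax1 : D a x1 <= D a x0 + D x0 x1 by apply: ldist_triangle; lra.
  have ay1 : D a y1 <= D a y0 + D y0 y1 by apply: ldist_triangle; lra.
  have one : 0 < 1 + 1 :> R by lra.
  have [-> m0] := @ipt_chart 1 1 a x0 y0 (@ler01 R) (@ler01 R) one ltac:(lra) ltac:(lra).
  have [-> m1] := @ipt_chart 1 1 a x1 y1 (@ler01 R) (@ler01 R) one ltac:(lra) ltac:(lra).
  have [_ _ _ ->] := ldistE m0 m1.
  have [[? _] _ _] := @ldist_in a x0 ltac:(lra); have [[? _] _ _] := @ldist_in a y0 ltac:(lra).
  have [[? _] _ _] := @ldist_in a x1 ltac:(lra); have [[? _] _ _] := @ldist_in a y1 ltac:(lra).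
  by split => //; apply: ldist_chart; lra.
split.
- have [-> -> -> [? ? ? ?]] := C x0 ltac:(by rewrite ldistxx; lra).
  exact: hd_mid_convex.
- move=> a t k /C[-> -> -> [? ? ? ?]] t0 le1 k1 k2 H.
  exact: gram_bound H.
have [[y0' yr] ye ->] := @ldist_in x0 y0 ltac:(lra).
have one : 0 < 1 + 1 :> R by lra.
have cc : hball (o x0) d (o x0) by exact: hball_center.
have yr' : hball (o x0) d (phi x0 y0).
  by have [_ _ E] := @ldist_in x0 y0 ltac:(lra); split => //; rewrite -E; lra.
have [_ pr] := iptE (@ler01 R) (@ler01 R) one cc yr'.
by rewrite /lmid /ipt ldist_center// hd_pt_le.
Qed.

End LocalMetric.

Lemma exists_ballAtlas (R : realType) (X : riemannSurface R) (rho : conformalMetric X) :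
  hyperbolic_metric rho -> compact [set: X] -> inhabited (ballAtlas rho).
Proof.
move=> hyp cX; have [r r0 H] := uniform_ballchart hyp cX.
have r16 : 0 < Num.min r 1 / 16 by rewrite divr_gt0// lt_min r0 ltr01.
have r1 : 16 * (Num.min r 1 / 16) = Num.min r 1 by field.
have H' a : exists p : (X -> R * R) * (R * R -> X) * (R * R),
    ballchart rho p.1.1 p.1.2 p.2 (16 * (Num.min r 1 / 16)) /\ p.1.2 p.2 = a.
  have [phi [e [z0 [bc eo]]]] := H a; exists (phi, e, z0); split=> //=.
  have z00 := bc_o bc; apply: (sub_ballchart bc) => //; first by rewrite r1 lt_min r0 ltr01.
  by rewrite hdxx// add0r r1 ge_min lexx.
have [f Hf] := choice H'.
have le1 : 16 * (Num.min r 1 / 16) <= 1 by rewrite r1 ge_min lexx orbT.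
exact: inhabits (BallAtlas r16 le1 (fun a => proj1 (Hf a)) (fun a => proj2 (Hf a))).
Qed.

(** * Closed curves and geodesic polygons *)

Section Gluing.
Variable R : realType.
Implicit Types (s t u : R) (k : int).

Lemma paste_continuous (S T : topologicalType) (v : S -> R) (f g : S -> T) (t : S) :
  {for t, continuous v} -> {for t, continuous f} -> {for t, continuous g} ->
  (v t = 0 -> f t = g t) -> {for t, continuous (fun p => if v p < 0 then f p else g p)}.
Proof.
move=> cv cf cg E; have [v0|v0|v0] := ltgtP (v t) 0.
- rewrite /prop_for /continuous_at v0; apply: cvg_trans cf; apply: near_eq_cvg; near=> s.
  have -> // : v s < 0.
  by near: s; apply: (near_continuous (P := fun x : R => x < 0) cv); exact: lt_nbhsl.
- rewrite /prop_for /continuous_at ltNge ltW//=; apply: cvg_trans cg; apply: near_eq_cvg; near=> s.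
  rewrite ltNge ltW//=.
  by near: s; apply: (near_continuous (P := fun x : R => 0 < x) cv); exact: lt_nbhsr.
- rewrite /prop_for /continuous_at v0 ltxx => U gU.
  have fU : nbhs (f t) U by rewrite E.
  have N : \forall p \near t, U (f p) /\ U (g p).
    by near=> p; split; near: p; [exact: cf | exact: cg].
  by apply: filterS N => p [h1 h2] /=; case: ifP.
Unshelve. all: by end_near. Qed.

(** Retraction onto [0, 1]: composing with it makes paths and functions controlled only on [0, 1]
    continuous on the whole line. *)
Definition clamp t : R := Num.max 0 (Num.min 1 t).

Lemma clamp_itv t : 0 <= clamp t <= 1.
Proof. by rewrite le_max lexx ge_max ge_min lexx ler01. Qed.

Lemma clampK t : 0 <= t <= 1 -> clamp t = t.
Proof. by move=> /andP[t0 t1]; rewrite /clamp (min_r t1) (max_r t0). Qed.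

Lemma clamp_lip s t : `|clamp s - clamp t| <= `|s - t|.
Proof.
wlog st : s t / t <= s => [H|].
  by have [/H//|/ltW/H] := leP t s; rewrite distrC (distrC t).
rewrite (ger0_norm (x := s - t)) ?subr_ge0// /clamp.
have m1 : Num.min 1 t <= Num.min 1 s by rewrite le_min !ge_min lexx st orbT.
have m2 : Num.min 1 s - Num.min 1 t <= s - t.
  by case: (leP 1 s); case: (leP 1 t); lra.
have m3 : Num.max 0 (Num.min 1 t) <= Num.max 0 (Num.min 1 s) by rewrite ge_max !le_max lexx m1 orbT.
rewrite ger0_norm ?subr_ge0//.
by move: m1 m2; set a := Num.min 1 s; set b := Num.min 1 t => m1 m2; case: (leP 0 a); case: (leP 0 b); lra.
Qed.

Lemma clamp_continuous : continuous clamp.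
Proof.
move=> t; apply/(@cvgrPdist_lt _ R^o) => ep ep0; near=> s.
apply: le_lt_trans (clamp_lip _ _) _; rewrite distrC; near: s; exact: near_norm_ltR.
Unshelve. all: by end_near. Qed.

(** Closed curves are periodic on the line, so the pieces are indexed by all integers: translating
    the parameter shifts the index and no last piece is special. *)
Definition glue (T : Type) (g : int -> R -> T) u : T := g (Num.floor u) (u - (Num.floor u)%:~R).

Lemma glue_at (T : Type) (g : int -> R -> T) k s :
  g k 1 = g (k + 1) 0 -> 0 <= s <= 1 -> glue g (k%:~R + s) = g k s.
Proof.
move=> E /andP[s0]; rewrite le_eqVlt => /predU1P[->|s1]; rewrite /glue.
  have -> : Num.floor (k%:~R + 1 : R) = k + 1.
    by apply: Num.Theory.floor_def; rewrite !rmorphD/=; apply/andP; split; lra.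
  by rewrite rmorphD/= subrr E.
have -> : Num.floor (k%:~R + s : R) = k.
  by apply: Num.Theory.floor_def; rewrite !rmorphD/=; apply/andP; split; lra.
by rewrite addrAC subrr add0r.
Qed.

Lemma floor_frac u : exists k, exists s, [/\ u = k%:~R + s, 0 <= s < 1 & k = Num.floor u].
Proof.
exists (Num.floor u), (u - (Num.floor u)%:~R); split; [lra| |by[]].
by have := Num.Theory.floor_itv u; rewrite rmorphD/= => /andP[? ?]; apply/andP; split; lra.
Qed.

Lemma glue_continuous (T : topologicalType) (g : int -> R -> T) :
  (forall k, continuous (g k)) -> (forall k, g k 1 = g (k + 1) 0) -> continuous (glue g).
Proof.
move=> cg E u; have [k [s [uE /andP[s0 s1] kE]]] := floor_frac u.
(* On the unit neighbourhood of the integer k only the pieces k - 1 and k occur. *)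
pose G v := if v - k%:~R < 0 then g (k - 1) (v - (k - 1)%:~R) else g k (v - k%:~R).
have N v : k%:~R - 1 <= v -> v < k%:~R + 1 -> G v = glue g v.
  move=> v1 v2; rewrite /G; case: ifPn => h.
    rewrite /glue (_ : Num.floor v = k - 1)//; apply: Num.Theory.floor_def.
    by rewrite !rmorphD !rmorphN/=; apply/andP; split; lra.
  rewrite /glue (_ : Num.floor v = k)//; apply: Num.Theory.floor_def.
  by rewrite !rmorphD/=; move: h; rewrite -leNgt => h; apply/andP; split; lra.
have C : {for u, continuous G}.
  have cs (c : R) : {for u, continuous (fun v => v - c)} by apply: cvgB; [exact: cvg_id | exact: cvg_cst].
  apply: paste_continuous.
  - exact: cs.
  - by apply: continuous_comp; [exact: cs | exact: cg].
  - by apply: continuous_comp; [exact: cs | exact: cg].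
  - move=> h; have -> : u - (k - 1)%:~R = 1 by rewrite rmorphB/=; lra.
    by rewrite h E subrK.
rewrite /continuous_at -N; [|lra..]; apply: cvg_trans C; apply: near_eq_cvg; near=> v.
have vu : `|v - u| < 1 - s by near: v; apply: near_norm_ltR; lra.
by apply: N; move: vu; rewrite ltr_norml => /andP[? ?]; lra.
Unshelve. all: by end_near. Qed.

Lemma glue_shift (T : Type) (g : int -> R -> T) (k : int) u :
  glue g (u + k%:~R) = glue (fun i s => g (i + k) s) u.
Proof.
have [i [s [-> s01 _]]] := floor_frac u; have /andP[s0 s1] := s01.
have F (j : int) : Num.floor (j%:~R + s : R) = j.
  by apply: Num.Theory.floor_def; rewrite !rmorphD/=; apply/andP; split; lra.
by rewrite /glue addrAC -rmorphD/= !F !(addrAC _ s) !subrr.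
Qed.

End Gluing.

Section Homotopy.
Variables (R : realType) (X : riemannSurface R).
Implicit Types (c : R -> X).

Lemma within_comp (T U : topologicalType) (V : topologicalType) (A : set U) (f : U -> V) (g : T -> U) :
  {within A, continuous f} -> continuous g -> (forall x, A (g x)) -> continuous (f \o g).
Proof.
move=> /subspace_continuousP cf cg Ag x W fW; have h : \forall y \near g x, A y -> W (f y) := cf (g x) (Ag x) W fW.
have h' : \forall y \near x, A (g y) -> W (f (g y)) := cg x _ h.
suff : \forall y \near x, W (f (g y)) by [].
by apply: filterS h' => y /= k; exact: (k (Ag y)).
Qed.

Lemma freely_homotopic_trans c0 c1 c2 :
  freely_homotopic c0 c1 -> freely_homotopic c1 c2 -> freely_homotopic c0 c2.
Proof.
move=> [H [cH pH H0 H1]] [K [cK pK K0 K1]].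
have ext (F : R * R -> X) (u : R * R -> R) : {within `[0, 1]%classic `*` setT, continuous F} -> continuous u ->
    continuous (fun z => F (clamp (u z), z.2)).
  move=> cF cu; apply: (@within_comp _ _ _ _ F (fun z => (clamp (u z), z.2)) cF).
    move=> z; apply: (@continuous_pair R _ (fun z => clamp (u z)) snd); last exact: cvg_snd.
    by apply: (@continuous_comp _ _ _ u (@clamp R)); [exact: cu | exact: clamp_continuous].
  by move=> z; split=> //=; rewrite in_itv/= clamp_itv.
have c1' : continuous (fun z : R * R => 2 * z.1 - 1).
  by move=> z; apply: cvgB; [apply: cvgM; [exact: cvg_cst | exact: cvg_fst] | exact: cvg_cst].
have c2' : continuous (fun z : R * R => 2 * z.1).
  by move=> z; apply: cvgM; [exact: cvg_cst | exact: cvg_fst].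
exists (fun z => if 2 * z.1 - 1 < 0 then H (clamp (2 * z.1), z.2) else K (clamp (2 * z.1 - 1), z.2)); split.
- apply: continuous_subspaceT => z.
  apply: (@paste_continuous R (R * R)%type X (fun z : R * R => 2 * z.1 - 1)
    (fun z : R * R => H (clamp (2 * z.1), z.2)) (fun z : R * R => K (clamp (2 * z.1 - 1), z.2)) z).
  + exact: c1'.
  + exact: (ext _ _ cH c2').
  + exact: (ext _ _ cK c1').
  + move=> h; rewrite h (_ : 2 * z.1 = 1); last lra.
    by rewrite !clampK ?lexx ?ler01// H1 K0.
- by move=> s t s01 /=; case: ifP => _; [apply: pH | apply: pK]; exact: clamp_itv.
- by move=> t /=; rewrite mulr0 sub0r ltrN10 clampK ?lexx ?ler01.
- move=> t /=; rewrite mulr1 (_ : 2 - 1 < 0 = false); last by apply/negbTE; rewrite -leNgt; lra.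
  by rewrite (_ : 2 - 1 = 1) ?clampK ?lexx ?ler01//; lra.
Qed.

Lemma reparametrization c (tau : R -> R) : closed_curve c -> continuous tau ->
  (forall t, tau (t + 1) = tau t + 1) -> freely_homotopic c (c \o tau).
Proof.
move=> [cc pc] ct pt; exists (fun z => c ((1 - z.1) * z.2 + z.1 * tau z.2)); split.
- apply: continuous_subspaceT => z.
  apply: (@continuous_comp _ _ _ (fun z : R * R => (1 - z.1) * z.2 + z.1 * tau z.2) c); last exact: cc.
  have f1 : {for z, continuous (fun w : R * R => w.1)} by exact: cvg_fst.
  have f2 : {for z, continuous (fun w : R * R => w.2)} by exact: cvg_snd.
  apply: cvgD; first by apply: cvgM => //; apply: cvgB => //; exact: cvg_cst.
  by apply: cvgM => //; apply: (@continuous_comp _ _ _ (fun w : R * R => w.2) tau) => //; exact: ct.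
- by move=> s t _ /=; rewrite pt -[RHS]pc; congr c; ring.
- by move=> t /=; rewrite subr0 mul1r mul0r addr0.
- by move=> t /=; rewrite subrr mul0r mul1r add0r.
Qed.

Variables (rho : conformalMetric X) (M : ballAtlas rho).
Local Notation d := (scale M).
Local Notation D := (ldist M).

(** Corresponding points are joined by short geodesics, parametrised by the weights 1 - s and s of
    [ipt]: these remain continuous where the curves meet, whereas [lgeo] switches to a separate case
    there. *)
Lemma close_homotopic c0 c1 : closed_curve c0 -> closed_curve c1 ->
  (forall t, D (c0 t) (c1 t) < d) -> freely_homotopic c0 c1.
Proof.
move=> [cc0 p0] [cc1 p1] h.
pose H (z : R * R) := ipt M (Num.max 0 (1 - z.1)) (Num.max 0 z.1) (c0 z.2) (c1 z.2).
exists H; split.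
- apply: continuous_subspaceT => z.
  apply: (@ipt_continuous _ _ _ M (R * R)%type (fun z : R * R => Num.max 0 (1 - z.1)) (fun z : R * R => Num.max 0 z.1)
    (fun z : R * R => c0 z.2) (fun z : R * R => c1 z.2) z).
  + move=> s; rewrite !le_max !lexx; split=> //; split=> //.
    have : 0 <= Num.max 0 (1 - s.1) by rewrite le_max lexx.
    have : 0 <= Num.max 0 s.1 by rewrite le_max lexx.
    have : 1 - s.1 <= Num.max 0 (1 - s.1) by rewrite le_max lexx orbT.
    have : s.1 <= Num.max 0 s.1 by rewrite le_max lexx orbT.
    lra.
  + apply: continuous_max; first exact: cvg_cst.
    by apply: cvgB; [exact: cvg_cst | exact: cvg_fst].
  + by apply: continuous_max; [exact: cvg_cst | exact: cvg_fst].
  + by apply: (@continuous_comp _ _ _ (fun z : R * R => z.2) c0); [exact: cvg_snd | exact: cc0].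
  + by apply: (@continuous_comp _ _ _ (fun z : R * R => z.2) c1); [exact: cvg_snd | exact: cc1].
  + exact: h.
- by move=> s t _; rewrite /H/= p0 p1.
- by move=> t; rewrite /H/= subr0 maxxx max_r ?ler01// ipt_l.
- by move=> t; rewrite /H/= subrr maxxx max_r ?ler01// ipt_r.
Qed.

Lemma closed_curve_cst (x : X) : closed_curve (cst x : R -> X).
Proof. by split=> // t; exact: cst_continuous. Qed.

Lemma lgeo_continuous (x y : X) : D x y < 4 * d -> continuous (fun s => lgeo M (clamp s) x y).
Proof.
move=> xy t U h; have [ep ep0 H] := @ldist_nbhs _ _ _ M _ _ h.
have D0 := ldist_ge0 M x y.
have q0 : 0 < ep / (D x y + 1) by rewrite divr_gt0// ltr_wpDl.
suff : \forall s \near t, U (lgeo M (clamp s) x y) by [].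
near=> s; apply: H.
rewrite ldist_lgeo ?clamp_itv//.
have : `|s - t| < ep / (D x y + 1) by near: s; exact: near_norm_ltR.
rewrite ltr_pdivlMr ?ltr_wpDl// => hs.
apply: le_lt_trans hs; apply: ler_pM => //; last by rewrite lerDl.
by rewrite (distrC s) clamp_lip.
Unshelve. all: by end_near. Qed.

(** Vertices form an N-periodic sequence indexed by the integers, so that closedness is periodicity;
    each side takes time 1 / N. *)
Definition polygon (N : nat) (xi : int -> X) (t : R) : X :=
  glue (fun k s => lgeo M (clamp s) (xi k) (xi (k + 1))) (N%:R * t).

Section Polygon.
Variables (N : nat) (xi : int -> X).
Hypothesis pxi : forall k, xi (k + N%:Z) = xi k.
Hypothesis small : forall k, D (xi k) (xi (k + 1)) < 4 * d.

Lemma polygon_junction k : lgeo M (clamp 1) (xi k) (xi (k + 1)) = lgeo M (clamp 0) (xi (k + 1)) (xi (k + 1 + 1)).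
Proof. by rewrite !clampK ?lexx ?ler01// lgeo1// lgeo0. Qed.

Lemma polygon_closed : closed_curve (polygon N xi).
Proof.
split=> [t|t].
  have cg : continuous (glue (fun k s => lgeo M (clamp s) (xi k) (xi (k + 1)))).
    by apply: glue_continuous; [move=> k; exact: lgeo_continuous | exact: polygon_junction].
  have cN : {for t, continuous (fun t : R => N%:R * t)} by apply: cvgM; [exact: cvg_cst | exact: cvg_id].
  exact: (continuous_comp cN (cg _)).
rewrite /polygon mulrDr mulr1 (_ : N%:R = (N%:Z)%:~R :> R)// glue_shift.
by congr glue; apply/funext => k; apply/funext => s; rewrite addrAC !pxi.
Qed.

Lemma polygon_near t : D (xi (Num.floor (N%:R * t))) (polygon N xi t) <=
  D (xi (Num.floor (N%:R * t))) (xi (Num.floor (N%:R * t) + 1)).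
Proof.
rewrite /polygon /glue; set k := Num.floor _.
rewrite -{1}(lgeo0 (small k)) ldist_lgeo ?lexx ?ler01 ?clamp_itv//.
rewrite -[leRHS]mul1r ler_wpM2r ?ldist_ge0// sub0r normrN.
by have /andP[h1 h2] := clamp_itv (N%:R * t - k%:~R); rewrite ger0_norm.
Qed.

End Polygon.

(** Going through the vertices of the current sides, corresponding points are at distance below 3 d
    / 4. *)
Lemma polygon_polygon N xi et : (forall k, xi (k + N%:Z) = xi k) -> (forall k, et (k + N%:Z) = et k) ->
  (forall k, D (xi k) (xi (k + 1)) < d / 4) -> (forall k, D (et k) (et (k + 1)) < d / 4) ->
  (forall k, D (xi k) (et k) < d / 4) -> freely_homotopic (polygon N xi) (polygon N et).
Proof.
move=> px pe sx se h; have d0 := scale_gt0 M.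
have sx' k : D (xi k) (xi (k + 1)) < 4 * d by have := sx k; lra.
have se' k : D (et k) (et (k + 1)) < 4 * d by have := se k; lra.
apply: close_homotopic => [| |t]; [exact: polygon_closed.. |].
have h1 := polygon_near N sx' t; have h2 := polygon_near N se' t.
set k := Num.floor _ in h1 h2; have k1 := sx k; have k2 := se k; have k3 := h k.
have h1' : D (polygon N xi t) (xi k) = D (xi k) (polygon N xi t) by apply: ldistC; lra.
have t1 : D (xi k) (polygon N et t) <= D (xi k) (et k) + D (et k) (polygon N et t) by apply: ldist_triangle; lra.
have t2 : D (polygon N xi t) (polygon N et t) <= D (polygon N xi t) (xi k) + D (xi k) (polygon N et t).
  by apply: ldist_triangle; lra.
lra.
Qed.

(** The curve is first reparametrised by the piecewise affine map sending k / N to T k; it then runs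
    alongside the polygon, at distance below d / 2 + d / 2. *)
Lemma curve_polygon N xi (T : int -> R) c : (0 < N)%N -> (forall k, xi (k + N%:Z) = xi k) ->
  (forall k, T (k + N%:Z) = T k + 1) -> closed_curve c ->
  (forall k, D (xi k) (xi (k + 1)) < d / 2) ->
  (forall k s, 0 <= s <= 1 -> D (xi k) (c (T k + s * (T (k + 1) - T k))) < d / 2) ->
  freely_homotopic c (polygon N xi).
Proof.
move=> N0 px pT cc sx h; have d0 := scale_gt0 M.
have sx' k : D (xi k) (xi (k + 1)) < 4 * d by have := sx k; lra.
pose g k s := T k + s * (T (k + 1) - T k).
pose tau t := glue g (N%:R * t).
have ct : continuous tau.
  move=> t; have cg : continuous (glue g).
    apply: glue_continuous => [k s|k]; last by rewrite /g mul0r mul1r; ring.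
    by apply: cvgD; [exact: cvg_cst | apply: cvgM; [exact: cvg_id | exact: cvg_cst]].
  have cN : {for t, continuous (fun t : R => N%:R * t)} by apply: cvgM; [exact: cvg_cst | exact: cvg_id].
  exact: (continuous_comp cN (cg _)).
have pt t : tau (t + 1) = tau t + 1.
  rewrite /tau mulrDr mulr1 (_ : N%:R = (N%:Z)%:~R :> R)// glue_shift /glue /g.
  by rewrite pT (addrAC _ _ 1) pT; ring.
apply: freely_homotopic_trans (reparametrization cc ct pt) _.
apply: close_homotopic; [|exact: polygon_closed|].
  split=> [t|t]; first by apply: (@continuous_comp _ _ _ tau c); [exact: ct | exact: cc.1].
  by rewrite /= pt cc.2.
move=> t; have h1 := polygon_near N sx' t; rewrite /= /tau {1}/glue.
set k := Num.floor _ in h1 *.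
have s01 : 0 <= N%:R * t - k%:~R <= 1.
  by have := Num.Theory.floor_itv (N%:R * t); rewrite rmorphD/= -/k => /andP[? ?]; apply/andP; split; lra.
have h2 := h k _ s01; rewrite -/(g _ _) in h2; have k1 := sx k.
have h2' : D (c (g k (N%:R * t - k%:~R))) (xi k) = D (xi k) (c (g k (N%:R * t - k%:~R))) by apply: ldistC; lra.
have t2 : D (c (g k (N%:R * t - k%:~R))) (polygon N xi t) <= D (c (g k (N%:R * t - k%:~R))) (xi k) + D (xi k) (polygon N xi t).
  by apply: ldist_triangle; lra.
lra.
Qed.

End Homotopy.

Lemma closed_disc_compact (R : realType) : compact (closed_disc (R := R)).
Proof.
apply: (@subclosed_compact _ _ (`[(-1 : R), (1 : R)]%classic `*` `[(-1 : R), (1 : R)]%classic)).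
- rewrite /closed_disc (_ : [set z | _] = (fun z : R * R => z.1 ^+ 2 + z.2 ^+ 2) @^-1` [set x | x <= 1]).
    apply: preimage_closed; last exact: closed_le.
    move=> z _; have f1 : {for z, continuous (fun w : R * R => w.1)} by exact: cvg_fst.
    have f2 : {for z, continuous (fun w : R * R => w.2)} by exact: cvg_snd.
    by rewrite /continuous_at; under eq_fun do rewrite !expr2; rewrite !expr2; apply: cvgD; exact: cvgM.
  apply/seteqP; split=> z /=; rewrite -sqr_modulus => h; last first.
    by apply: sqr_le_le => //; rewrite expr1n.
  by rewrite -[leRHS](expr1n _ 2) lerXn2r ?nnegrE ?modulus_ge0.
- by apply: compact_setX; exact: segment_compact.
- move=> z /= h; rewrite !in_itv/= -!ler_norml.
  by split; apply: le_trans h; apply: le_trans (norm_le_modulus z); [exact: norm_fst_le | exact: norm_snd_le].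
Qed.

Lemma compact_riemannSurface (R : realType) (g : nat) (S : topologicalType) (X : teichmuller R S) :
  closed_orientable_surface R g S -> compact [set: X].
Proof.
move=> [_ [q [cq sq _]]]; have [cm [h [_ _ hK]]] := marking_homeo X.
have -> : [set: X] = (@marking R S X) @` [set: S].
  by apply/seteqP; split=> // x _; exists (h x) => //; rewrite hK.
apply: continuous_compact; first exact: continuous_subspaceT.
rewrite -sq; apply: continuous_compact => //; exact: closed_disc_compact.
Qed.

(* No measurability is needed: the integral of a nonnegative function is a
   supremum over the simple functions below it. *)
Lemma ge0_integral_mono d (T : measurableType d) (R : realType) (mu : {measure set T -> \bar R})
    (A B : set T) (f g : T -> \bar R) :
  (forall x, A x -> 0 <= f x)%E -> (forall x, B x -> 0 <= g x)%E ->
  (forall x, A x -> B x /\ (f x <= g x)%E) -> (\int[mu]_(x in A) f x <= \int[mu]_(x in B) g x)%E.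
Proof.
move=> f0 g0 h; rewrite !ge0_integralE//; apply: le_ereal_sup => _ [k hk <-].
exists k => // x; apply: le_trans (hk x) _; rewrite /patch.
case: ifPn => [/set_mem Ax|_]; last by case: ifPn => [/set_mem/g0|].
by have [Bx fg] := h x Ax; rewrite mem_set.
Qed.

(** * Length of curves *)

Section Cells.
Variables (R : realType) (X : riemannSurface R).
Implicit Types (i j : 'I_(nb_charts X)).

Lemma cell_dom i (x : X) : cell i x -> dom i x.
Proof. by case. Qed.

Lemma cell_unique i j (x : X) : cell i x -> cell j x -> i = j.
Proof.
move=> [di mi] [dj mj]; apply/val_inj => /=.
by have [h|h|//] := ltngtP i j; [case: (mj i h) | case: (mi j h)].
Qed.

Lemma cell_cover (x : X) : exists i, cell i x.
Proof.
have [i di] := dom_cover x.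
have di' : `[< dom i x >] by apply/asboolP.
case: (@arg_minnP _ i (fun j => `[< dom j x >]) (fun j => j : nat) di') => j /asboolP dj mj.
exists j; split=> // k kj dk; have := mj k (asboolT dk); by rewrite leqNgt kj.
Qed.

Lemma preimage_cell_measurable (d : measure_display) (W : measurableType d) (c : W -> X) i :
  (forall j, measurable (c @^-1` dom j)) -> measurable (c @^-1` cell i).
Proof.
move=> mc.
have -> : c @^-1` cell i = c @^-1` dom i `\` \bigcup_(j in [set j : 'I_(nb_charts X) | (j < i)%N]) c @^-1` dom j.
  apply/seteqP; split=> t /=.
    by move=> [di mi]; split=> // -[j /= ji]; exact: mi.
  by move=> [di mi]; split=> // j ji dj; apply: mi; exists j.
apply: measurableD => //; apply: fin_bigcup_measurable => //.
Qed.

End Cells.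

Section Velocity.
Variable R : realType.
Implicit Types (t h : R) (z l : R * R).

Lemma modulusZ h z : modulus (h *: z) = `|h| * modulus z.
Proof.
rewrite /modulus /= !exprMn -mulrDr sqrtrM ?sqr_ge0// sqrtr_sqr.
by [].
Qed.

Lemma derivable_pair (f g : R -> R) t :
  derivable f t 1 -> derivable g t 1 -> derivable ((fun s => (f s, g s)) : R^o -> R * R) t 1.
Proof.
move=> /cvg_ex[/= l1 h1] /cvg_ex[/= l2 h2]; apply/cvg_ex; exists (l1, l2) => /=.
rewrite (_ : (fun h => _) = fun h => (h^-1 *: ((f \o shift t) (h *: 1) - f t), h^-1 *: ((g \o shift t) (h *: 1) - g t))).
  exact: cvg_pair h1 h2.
by apply/funext => h.
Qed.

Lemma derivable_estimate (V : normedModType R) (f : R -> V) t (ep : R) : derivable (f : R^o -> V) t 1 -> 0 < ep ->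
  exists2 de, 0 < de & forall h, `|h| < de -> `|f (t + h) - f t - h *: 'D_1 (f : R^o -> V) t| <= ep * `|h|.
Proof.
move=> df ep0; have := df; rewrite /derivable => /cvgrPdist_le/(_ _ ep0).
rewrite -/(derive _ _ _) => -[de /= de0 H]; exists de => // h hd.
have [->|hn0] := eqVneq h 0; first by rewrite addr0 subrr scale0r subr0 !normr0 mulr0.
have := H h; rewrite /= sub0r normrN => /(_ hd hn0).
rewrite [h *: 1]mulr1 (addrC h) => H1.
rewrite (_ : _ - _ = - (h *: ('D_1 (f : R^o -> V) t - h^-1 *: (f (t + h) - f t)))).
  by rewrite normrN normrZ mulrC ler_wpM2r.
by rewrite scalerBr scalerA mulfV// scale1r opprB.
Qed.

End Velocity.

Section Curves.
Variables (R : realType) (X : riemannSurface R) (rho : conformalMetric X) (M : ballAtlas rho).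
Local Notation d := (scale M).
Local Notation D := (ldist M).
Local Notation mu := (@lebesgue_measure R).
Variable c : R -> X.
Hypothesis cc : closed_curve c.
Implicit Types (i j : 'I_(nb_charts X)) (s t u h : R).

Lemma closed_curve_int t (k : int) : c (t + k%:~R) = c t.
Proof.
have nat_case s (n : nat) : c (s + n%:R) = c s.
  by elim: n => [|n IH]; rewrite ?addr0// -natr1 addrA cc.2.
case: k => n; first by rewrite -pmulrn.
by rewrite NegzE mulrNz -pmulrn -[in RHS](subrK n.+1%:R t) nat_case.
Qed.

Definition speed i t : R := rho i (chart i (c t)) * modulus ('D_1 ((chart i \o c) : R^o -> R * R) t).

(** The speed computed in a chart is the metric derivative of the curve, hence does not depend on
    the chart. *)
Lemma speed_estimate i t (ep : R) : dom i (c t) -> derivable ((chart i \o c) : R^o -> R * R) t 1 -> 0 < ep ->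
  exists2 de, 0 < de & forall h, `|h| < de -> `|D (c t) (c (t + h)) - speed i t * `|h| | <= ep * `|h|.
Proof.
move=> dt df ep0; rewrite /speed; set l := 'D_1 _ t; set A := rho _ _.
have A0 : 0 < A by exact: (density_gt0 M dt).
have m0 : 0 <= modulus l by exact: modulus_ge0.
have q0 : 0 < modulus l + 2 + 2 * A by lra.
pose e1 := Num.min 1 (ep / (modulus l + 2 + 2 * A)).
have e10 : 0 < e1 by rewrite lt_min ltr01 divr_gt0.
have e1ep : e1 * (modulus l + 2 + 2 * A) <= ep by rewrite -ler_pdivlMr// ge_min lexx orbT.
have e11 : e1 <= 1 by rewrite ge_min lexx.
have [de de0 H] := derivable_estimate df e10.
have S := ldist_speed M dt e10.
have : \forall s \near t, `|D (c t) (c s) - A * modulus (chart i (c s) - chart i (c t))| <= e1 * modulus (chart i (c s) - chart i (c t)) by exact: (cc.1 t _ S).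
move=> /near_normRP[de2 de20 S2].
exists (Num.min de de2); first by rewrite lt_min de0.
move=> h; rewrite lt_min => /andP[h1 h2].
have K1 := H h h1; have K2 := S2 (t + h) ltac:(by rewrite addrC addKr).
rewrite /= -/l in K1; set De := chart i (c (t + h)) - chart i (c t) in K1 K2.
have k1 : modulus (De - h *: l) <= 2 * e1 * `|h|.
  by apply: le_trans (modulus_le_norm _) _; rewrite -mulrA ler_pM2l.
have k2 : `|modulus De - modulus l * `|h| | <= 2 * e1 * `|h|.
  rewrite (mulrC (modulus l)) -modulusZ ler_norml; apply/andP; split.
    have := ler_modulusD De (- (De - h *: l)).
    by rewrite modulusN opprB addrC subrK; lra.
  by have := ler_modulusD (De - h *: l) (h *: l); rewrite subrK; lra.
have H0 : 0 <= `|h| by [].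
have e1h : e1 * `|h| <= `|h| by rewrite -[leRHS]mul1r ler_wpM2r.
have k3 : modulus De <= (modulus l + 2) * `|h|.
  by move: k2; rewrite ler_norml => /andP[_]; lra.
have k4 : e1 * modulus De <= e1 * ((modulus l + 2) * `|h|) by rewrite ler_pM2l.
have k5 : `|A * modulus De - A * modulus l * `|h| | <= A * (2 * e1 * `|h|).
  by rewrite -mulrA -mulrBr normrM gtr0_norm// ler_pM2l.
have k6 : e1 * (modulus l + 2 + 2 * A) * `|h| <= ep * `|h| by rewrite ler_wpM2r.
rewrite -(subrK (A * modulus De) (D _ _)) -addrA; apply: le_trans (ler_normD _ _) _.
apply: le_trans (lerD K2 k5) _; lra.
Unshelve. all: by end_near. Qed.

Hypothesis lc : lipschitz_curve c.

Lemma curve_lip : exists K et : R, [/\ 0 < K, 0 < et & forall s t, `|s - t| < et ->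
  D (c s) (c t) <= K * `|s - t| /\ D (c s) (c t) < d].
Proof.
have d0 := scale_gt0 M.
(* One parameter serves as radius and, inverted, as Lipschitz constant, so a single compactness
   argument makes both uniform. *)
pose P (et t : R) := 0 < et /\ forall s u, `|s - t| < et -> `|u - t| < et -> D (c s) (c u) <= et^-1 * `|s - u| /\ D (c s) (c u) < d.
have /compact_near_coveringP cI := @segment_compact R 0 1.
have loc t : `[0, 1]%classic t -> \forall t' \near t & et \near (0 : R)^'+, P et t'.
  move=> _; have [i dt] := dom_cover (c t).
  have [K1 K10 B] := ldist_bilip M dt; have [k Lk] := lc dt.
  have B' : \forall s \near t & u \near t, D (c s) (c u) <= K1 * `|chart i (c s) - chart i (c u)|.
    have [[U V]/= [cU cV] UV] := B.
    exists (c @^-1` U, c @^-1` V) => /=; first by split; exact: cc.1.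
    by move=> [s u] /= [Us Vu]; have [] := UV (c s, c u) (conj Us Vu).
  have [[U V]/= [tU tV] UV] : \forall s \near t & u \near t, D (c s) (c u) <= K1 * (k * `|s - u|).
    apply: filterS2 B' Lk => -[s u] /= h1 h2; apply: le_trans h1 _; by rewrite ler_pM2l.
  have nd : \forall s \near t, D (c t) (c s) < d / 2.
    by apply: (@near_continuous _ _ c t (fun x => D (c t) x < d / 2) (cc.1 t)); apply: near_ldist; lra.
  have /near_normRP[r r0 Hr] : \forall s \near t, [/\ U s, V s & D (c t) (c s) < d / 2].
    by near=> s; split; near: s.
  have K0 : 0 < K1 * (`|k| + 1) by rewrite mulr_gt0// ltr_wpDl.
  near=> t' et => /=.
  have et0 : 0 < et by near: et; exact: nbhs_right_gt.
  split=> // s u st ut.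
  have t't : `|t' - t| < r / 2 by near: t'; apply: near_norm_ltR; rewrite divr_gt0.
  have er : et <= r / 2 by near: et; apply: nbhs_right_le; rewrite divr_gt0.
  have B1 x : `|x - t'| < et -> `|x - t| < r.
    by move=> h; rewrite -(subrK t' x) -addrA; apply: le_lt_trans (ler_normD _ _) _; lra.
  have [Us _ sd] := Hr s (B1 s st); have [_ Vu ud] := Hr u (B1 u ut).
  have stC : D (c s) (c t) = D (c t) (c s) by apply: ldistC; lra.
  split; last first.
    have : D (c s) (c u) <= D (c s) (c t) + D (c t) (c u) by apply: ldist_triangle; lra.
    by lra.
  have /= h := UV (s, u) (conj Us Vu); apply: le_trans h _; rewrite mulrA ler_wpM2r//.
  have eK : et <= (K1 * (`|k| + 1))^-1 by near: et; apply: nbhs_right_le; rewrite invr_gt0.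
  apply: (@le_trans _ _ (K1 * (`|k| + 1))).
    by rewrite ler_pM2l//; have := ler_norm k; lra.
  by rewrite -[leLHS]invrK lef_pV2 ?posrE ?invr_gt0.
have near_et : \forall et \near (0 : R)^'+, `[0, 1]%classic `<=` P et by exact: cI.
near (0 : R)^'+ => et.
have et0 : 0 < et by near: et; exact: nbhs_right_gt.
exists et^-1, et; rewrite invr_gt0; split=> // s t st.
have : `[0, 1]%classic `<=` P et by near: et.
have [k [f [tE /andP[f0 f1] _]]] := floor_frac t.
move=> /(_ f); rewrite /= in_itv/= f0 (ltW f1) => /(_ isT)[_ /(_ (s - k%:~R) f)].
rewrite subrr normr0 et0 -addrA -opprD -tE => /(_ st isT).
by rewrite -(closed_curve_int f k) (addrC f) -tE -(closed_curve_int (s - k%:~R) k) subrK.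
Unshelve. all: by end_near. Qed.

Definition derivable_in_charts t : Prop :=
  forall i, dom i (c t) -> derivable ((chart i \o c) : R^o -> R * R) t 1.

(** In one chart both coordinates are Lipschitz, hence differentiable outside a null set by
    [lipschitz_ftc]; the other charts follow by composition with the transition maps. *)
Lemma ae_derivable_local t0 : exists2 de, 0 < de & exists N : set R, [/\ measurable N, mu N = 0%E &
  forall t, `|t - t0| < de -> ~ N t -> derivable_in_charts t].
Proof.
have [i dt] := dom_cover (c t0); have [k Lk] := lc dt.
have nd : \forall s \near t0, dom i (c s).
  by apply: (@near_continuous _ _ c t0 (dom i) (cc.1 t0)); exact: near_dom.
have [[U V]/= [tU tV] UV] := Lk.
have /near_normRP[r r0 Hr] : \forall s \near t0, [/\ U s, V s & dom i (c s)].
  by near=> s; split; near: s.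
pose de := r / 2; have de0 : 0 < de by rewrite divr_gt0.
(* Retraction onto [t0 - de, t0 + de], which makes the coordinates Lipschitz on the whole line, as
   [lipschitz_ftc] demands. *)
pose cl s := t0 - de + 2 * de * clamp ((s - (t0 - de)) / (2 * de)).
have q0 : 0 < 2 * de by rewrite mulr_gt0.
have cl_lip s u : `|cl s - cl u| <= `|s - u|.
  have -> : cl s - cl u = 2 * de * (clamp ((s - (t0 - de)) / (2 * de)) - clamp ((u - (t0 - de)) / (2 * de))).
    by rewrite /cl; ring.
  rewrite normrM (gtr0_norm q0) mulrC -ler_pdivlMr//.
  apply: le_trans (clamp_lip _ _) _; rewrite -mulrBl normrM (gtr0_norm (x := _^-1)) ?invr_gt0//.
  by rewrite (_ : s - (t0 - de) - _ = s - u)//; ring.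
have cl_in s : `|cl s - t0| < r.
  have /andP[h1 h2] := clamp_itv ((s - (t0 - de)) / (2 * de)).
  have h3 : 2 * de * clamp ((s - (t0 - de)) / (2 * de)) <= 2 * de by rewrite -[leRHS]mulr1 ler_pM2l.
  have h4 : 0 <= 2 * de * clamp ((s - (t0 - de)) / (2 * de)) by rewrite mulr_ge0// ltW.
  rewrite /cl ltr_norml; apply/andP; split; rewrite /de in h3 h4 *; lra.
have cl_id s : `|s - t0| <= de -> cl s = s.
  rewrite ler_norml => /andP[h1 h2]; rewrite /cl clampK; first by field; rewrite gt_eqF.
  by rewrite divr_ge0 ?ler_pdivrMr ?mul1r//; lra.
pose g := chart i \o c.
have gl s u : `|g (cl s) - g (cl u)| <= (`|k| + 1) * `|s - u|.
  have [Us _ _] := Hr _ (cl_in s); have [_ Vu _] := Hr _ (cl_in u).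
  have /= h := UV (cl s, cl u) (conj Us Vu); apply: le_trans h _.
  apply: (@le_trans _ _ ((`|k| + 1) * `|cl s - cl u|)); last by rewrite ler_wpM2l// addr_ge0.
  by rewrite ler_wpM2r//; have := ler_norm k; lra.
have lip1 s u : `|(g (cl s)).1 - (g (cl u)).1| <= (`|k| + 1) * `|s - u|.
  by apply: le_trans (gl s u); exact: (norm_fst_le (g (cl s) - g (cl u))).
have lip2 s u : `|(g (cl s)).2 - (g (cl u)).2| <= (`|k| + 1) * `|s - u|.
  by apply: le_trans (gl s u); exact: (norm_snd_le (g (cl s) - g (cl u))).
have ab : t0 - de < t0 + de by lra.
have [N1 [mN1 N10 D1 _]] := lipschitz_ftc lip1 ab.
have [N2 [mN2 N20 D2 _]] := lipschitz_ftc lip2 ab.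
exists de => //; exists (N1 `|` N2); split; [exact: measurableU | exact: null_set_setU|].
move=> t td nN j dj.
have nN1 : ~ N1 t by move=> h; apply: nN; left.
have nN2 : ~ N2 t by move=> h; apply: nN; right.
have tab : t0 - de < t < t0 + de by move: td; rewrite ltr_norml => /andP[? ?]; apply/andP; split; lra.
have nt : \forall s \near t, `|s - t0| < de.
  near=> s; have : `|s - t| < de - `|t - t0| by near: s; apply: near_norm_ltR; rewrite subr_gt0.
  by move=> h; rewrite -(subrK t s) -addrA; apply: le_lt_trans (ler_normD _ _) _; lra.
have dg : derivable (g : R^o -> R * R) t 1.
  apply: near_eq_derivable (derivable_pair (D1 t tab nN1) (D2 t tab nN2)).
  near=> s; have sd : `|s - t0| < de by near: s.
  by rewrite (cl_id s (ltW sd)) -surjective_pairing.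
have di : dom i (c t) by have [] := Hr t ltac:(by rewrite /de in td; lra).
have dT : differentiable (chart j \o param i) (g t) by have [] := transition_holomorphic di dj.
have : derivable (((chart j \o param i) \o g) : R^o -> R * R) t 1.
  by apply/derivable1_diffP; apply: differentiable_comp => //; exact/derivable1_diffP.
apply: near_eq_derivable; near=> s.
have : dom i (c s) by near: s; apply: (@near_continuous _ _ c t (dom i) (cc.1 t)); exact: near_dom.
by move=> ds; rewrite /g /= chartK.
Unshelve. all: by end_near. Qed.

(** Continuity induction on the length of the initial segment: each step unites just two null
    sets. *)
Lemma ae_derivable : exists N : set R, [/\ measurable N, mu N = 0%E &
  forall t, 0 <= t <= 1 -> ~ N t -> derivable_in_charts t].
Proof.
pose P (t : R) := exists N : set R, [/\ measurable N, mu N = 0%E &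
  forall s, 0 <= s <= t -> ~ N s -> derivable_in_charts s].
suff : P 1 by [].
apply: real_induction; last by rewrite ler01 lexx.
  move=> t /andP[t0 t1] IH; have [de de0 [N [mN N0 H]]] := ae_derivable_local t.
  pose s0 := Num.max 0 (t - de / 2).
  have [tz|tz] := eqVneq t 0.
    exists N; split=> // s /andP[s0' st]; apply: H.
    by rewrite (_ : s - t = 0) ?normr0//; lra.
  have s0t : 0 <= s0 < t by rewrite le_max lexx gt_max lt_neqAle eq_sym tz t0/=; lra.
  have [N' [mN' N'0 H']] := IH s0 s0t.
  exists (N' `|` N); split; [exact: measurableU | exact: null_set_setU |].
  move=> s /andP[s1 s2] nN; have [ss|ss] := leP s s0.
    by apply: H'; [rewrite s1 ss | move=> h; apply: nN; left].
  apply: H; last by move=> h; apply: nN; right.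
  have : t - de / 2 <= s0 by rewrite le_max lexx orbT.
  by move=> h; rewrite ler0_norm; lra.
move=> t /andP[t0 t1] IH; have [de de0 [N [mN N0 H]]] := ae_derivable_local t.
have [N' [mN' N'0 H']] := IH t ltac:(by rewrite t0 lexx).
exists de => // s /andP[ts sd].
exists (N' `|` N); split; [exact: measurableU | exact: null_set_setU |].
move=> u /andP[u0 us] nN; have [ut|ut] := leP u t.
  by apply: H'; [rewrite u0 ut | move=> h; apply: nN; left].
apply: H; last by move=> h; apply: nN; right.
by rewrite ger0_norm; lra.
Qed.

(** The speed is the limit of the quotients of [D (c t) (c (t + 1/n))] by 1/n, which are continuous
    in t; this gives its measurability without a measurable choice of charts. *)
Lemma metric_speed : exists (N : set R) (w : R -> R) (K : R), [/\ measurable N, mu N = 0%E,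
  N 0 /\ N 1, measurable_fun (`[0, 1]%classic `\` N) w &
  forall t, 0 <= t <= 1 -> ~ N t -> [/\ derivable_in_charts t,
    forall i, dom i (c t) -> speed i t = w t, 0 <= w t <= K &
    forall ep, 0 < ep -> exists2 de, 0 < de & forall h, `|h| < de -> `|D (c t) (c (t + h)) - w t * `|h| | <= ep * `|h|]].
Proof.
have [N0 [mN0 N00 HN0]] := ae_derivable; have [K [et [K0 et0 HK]]] := curve_lip.
pose N := N0 `|` ([set 0] `|` [set 1]).
have mN : measurable N by apply: measurableU => //; exact: measurableU.
have muN : mu N = 0%E.
  by apply: null_set_setU => //; [exact: measurableU | apply: null_set_setU => //; exact: lebesgue_measure_set1].
(* Starting at n0 keeps the increments so short that the distances are below d, where [ldist] is
   continuous. *)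
have [n0 n0et] : exists n0 : nat, forall n : nat, (n + n0).+1%:R^-1 < et.
  exists (Num.bound et^-1) => n; rewrite -[ltRHS]invrK ltf_pV2 ?posrE ?invr_gt0//.
  apply: lt_le_trans (archi_boundP _) _; first by rewrite invr_ge0 ltW.
  by rewrite ler_nat leqW// leq_addl.
pose f (n : nat) t : R := (n + n0).+1%:R * D (c t) (c (t + (n + n0).+1%:R^-1)).
pose w t : R := limn (fun n => f n t).
have cvf t : 0 <= t <= 1 -> ~ N t -> forall i, dom i (c t) -> f ^~ t @ \oo --> speed i t.
  move=> t01 nN i di; have dt := HN0 t t01 (fun hN : N0 t => nN (or_introl hN)).
  apply/cvgrPdist_le => ep ep0; have [de de0 H] := speed_estimate di (dt i di) ep0.
  exists (Num.bound de^-1) => // n /= nb.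
  have n1 : 0 < (n + n0).+1%:R^-1 :> R by rewrite invr_gt0.
  have nde : (n + n0).+1%:R^-1 < de.
    rewrite -[ltRHS]invrK ltf_pV2 ?posrE ?invr_gt0//.
    apply: lt_le_trans (archi_boundP _) _; first by rewrite invr_ge0 ltW.
    by rewrite ler_nat leqW// (leq_trans nb)// leq_addr.
  have := H (n + n0).+1%:R^-1; rewrite gtr0_norm// => /(_ nde).
  rewrite /f; set q := (n + n0).+1%:R; have q0 : 0 < q :> R by rewrite ltr0Sn.
  move=> /(ler_wpM2l (ltW q0)).
  rewrite (_ : speed i t - _ = - (q * (D (c t) (c (t + q^-1)) - speed i t / q))).
    by rewrite normrN normrM (gtr0_norm q0) mulrCA mulfV ?mulr1// gt_eqF.
  by field; rewrite gt_eqF.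
have wE t : 0 <= t <= 1 -> ~ N t -> forall i, dom i (c t) -> w t = speed i t.
  by move=> t01 nN i di; apply: cvg_lim => //; exact: cvf.
have est t : 0 <= t <= 1 -> ~ N t -> forall ep, 0 < ep -> exists2 de, 0 < de &
    forall h, `|h| < de -> `|D (c t) (c (t + h)) - w t * `|h| | <= ep * `|h|.
  move=> t01 nN ep ep0; have [i di] := dom_cover (c t).
  by rewrite (wE t t01 nN i di); apply: speed_estimate => //; apply: HN0 => // h; apply: nN; left.
exists N, w, K; split=> //.
- by split; right; [left | right].
- apply: (@measurable_fun_cvg _ _ _ _ f) => [m|t [/=]].
    apply: (measurable_funS measurableT) => //; apply: continuous_measurable_fun => t.
    have ca : {for t, continuous (fun s => c (s + (m + n0).+1%:R^-1))}.
      apply: (@continuous_comp _ _ _ (fun s : R => s + (m + n0).+1%:R^-1) c); last exact: cc.1.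
      by apply: cvgD; [exact: cvg_id | exact: cvg_cst].
    apply: cvgM; first exact: cvg_cst.
    apply: ldist_continuous => //; first exact: cc.1.
    have := HK t (t + (m + n0).+1%:R^-1); rewrite opprD addNKr normrN gtr0_norm ?invr_gt0//.
    by move=> /(_ (n0et m))[].
  rewrite in_itv/= => t01 nN; have [i di] := dom_cover (c t).
  by rewrite (wE t t01 nN i di); exact: cvf.
move=> t t01 nN; split.
- by apply: HN0 => // h; apply: nN; left.
- by move=> i di; rewrite (wE t t01 nN i di).
- apply/andP; split.
    have [i di] := dom_cover (c t); rewrite (wE t t01 nN i di) /speed mulr_ge0 ?modulus_ge0//.
    exact/ltW/(density_gt0 M di).
  apply/ler_addgt0Pr => ep ep0; have [de de0 H] := est t t01 nN ep ep0.
  pose h := Num.min de et / 2.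
  have m0 : 0 < Num.min de et by rewrite lt_min de0.
  have h0 : 0 < h by rewrite divr_gt0.
  have mde : Num.min de et <= de by rewrite ge_min lexx.
  have met : Num.min de et <= et by rewrite ge_min lexx orbT.
  have := H h; rewrite gtr0_norm// => /(_ ltac:(rewrite /h; lra)); rewrite ler_norml => /andP[_ h1].
  have := HK t (t + h); rewrite opprD addNKr normrN gtr0_norm// => /(_ ltac:(rewrite /h; lra))[h2 _].
  have := H h; rewrite gtr0_norm// => /(_ ltac:(rewrite /h; lra)); rewrite ler_norml => /andP[_ h3].
  have := H h; rewrite gtr0_norm// => /(_ ltac:(rewrite /h; lra)); rewrite ler_norml => /andP[h4 _].
  rewrite -(ler_pM2r h0) mulrDl; lra.
- exact: est.
Qed.

End Curves.

(** [La] is the primitive of the metric speed. The last clause covers any metric that is at least k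
    times rho along the curve: it is applied to rho itself and to the damped metric. *)
Lemma metric_length01 (R : realType) (X : riemannSurface R) (rho : conformalMetric X) (M : ballAtlas rho) (c : R -> X) :
  closed_curve c -> lipschitz_curve c -> exists (La : R -> R) (K et : R), [/\ 0 <= K, 0 < et & [/\ La 0 = 0,
    forall a b, 0 <= a -> a <= b -> b <= 1 -> 0 <= La b - La a <= K * (b - a),
    forall a b, 0 <= a -> a <= b -> b <= 1 -> b - a < et -> ldist M (c a) (c b) <= La b - La a &
    forall (rho' : conformalMetric X) (k : R), 0 <= k ->
      (forall (t : R) (i : 'I_(nb_charts X)), dom i (c t) -> k * rho i (chart i (c t)) <= rho' i (chart i (c t))) ->
      ((k * La 1)%:E <= curve_length rho' c)%E]].
Proof.
move=> cc lc; have d0 := scale_gt0 M.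
have [N [w [K [mN muN [N0 N1] mw HN]]]] := metric_speed M cc lc.
have [K1 [et' [K10 et'0 HK1]]] := curve_lip M cc lc.
pose et := Num.min et' 1.
have et0 : 0 < et by rewrite lt_min et'0 ltr01.
have et1 : et <= 1 by rewrite ge_min lexx orbT.
have HK s t : `|s - t| < et -> ldist M (c s) (c t) <= K1 * `|s - t| /\ ldist M (c s) (c t) < scale M.
  by move=> h; apply: HK1; apply: lt_le_trans h _; rewrite ge_min lexx.
pose I a b : \bar R := (\int[lebesgue_measure]_(x in `]a, b]%classic `\` N) (w x)%:E)%E.
have inG a b : 0 <= a -> b <= 1 -> `]a, b]%classic `\` N `<=` `[0, 1]%classic `\` N.
  move=> a0 b1 x [/=]; rewrite in_itv/= => /andP[ax xb] nN; split=> //=.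
  by rewrite in_itv/=; apply/andP; split; lra.
have mG : measurable (`[0, 1]%classic `\` N) by exact: measurableD.
have mI a b : measurable (`]a, b]%classic `\` N) by exact: measurableD.
have GH x : (`[0, 1]%classic `\` N) x -> 0 <= x <= 1 /\ ~ N x by move=> [/=]; rewrite in_itv.
have w0 x : (`[0, 1]%classic `\` N) x -> 0 <= w x <= K.
  by move=> /GH[x01 nN]; have [_ _ ? _] := HN x x01 nN.
have mwE : measurable_fun (`[0, 1]%classic `\` N) (EFin \o w) by exact/measurable_EFinP.
have I_ge0 a b : 0 <= a -> b <= 1 -> (0 <= I a b)%E.
  move=> a0 b1; apply: integral_ge0 => x /(inG a b a0 b1)/w0/andP[? _]; by rewrite lee_fin.
have I_le a b : 0 <= a -> a <= b -> b <= 1 -> (I a b <= (`|K| * (b - a))%:E)%E.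
  move=> a0 ab b1.
  apply: (@le_trans _ _ (\int[lebesgue_measure]_(x in `]a, b]%classic) (cst (`|K|%:E) x))%E).
    apply: ge0_integral_mono => x.
    - by move=> /(inG a b a0 b1)/w0/andP[? _]; rewrite lee_fin.
    - by rewrite lee_fin.
    - move=> xab; split; first by case: xab.
      move: (xab) => /(inG a b a0 b1)/w0/andP[_ h]; by rewrite lee_fin (le_trans h)// ler_norm.
  have e2 : lebesgue_measure (`]a, b]%classic : set R) = (b - a)%:E.
    by rewrite lebesgue_measure_itv/= lte_fin; case: ltP => h //; rewrite (_ : a = b) ?subrr//; lra.
  rewrite EFinM -e2 le_eqVlt; apply/orP; left; apply/eqP.
  by apply: integral_cst.
have I_add a b e : 0 <= a -> a <= b -> b <= e -> e <= 1 -> (I a b + I b e = I a e)%E.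
  move=> a0 ab be e1; rewrite /I.
  have E : `]a, e]%classic `\` N = (`]a, b]%classic `\` N) `|` (`]b, e]%classic `\` N).
    rewrite -setDUl; congr (_ `\` _); apply/seteqP; split=> x /=; rewrite !in_itv/=.
      by move=> /andP[h1 h2]; have [h|h] := leP x b; [left; rewrite h1 | right].
    by move=> [/andP[h1 h2]|/andP[h1 h2]]; apply/andP; split; lra.
  rewrite E ge0_integral_setU; [by []|exact: mI|exact: mI|..].
  - rewrite -E; exact: measurable_funS (inG a e a0 e1) mwE.
  - by move=> x; rewrite -E => /(inG a e a0 e1)/w0/andP[? _]; rewrite lee_fin.
  - apply/disj_setPS => x [[/= + _] [/= + _]]; rewrite !in_itv/= => /andP[h1 h2] /andP[h3 h4]; lra.
have I_D a b : 0 <= a -> a <= b -> b <= 1 -> b - a < et -> ((ldist M (c a) (c b))%:E <= I a b)%E.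
  move=> a0 ab b1 bae.
  have [->|neq] := eqVneq a b; first by rewrite ldistxx; apply: I_ge0 => //; lra.
  have ab' : a < b by rewrite lt_neqAle neq.
  pose q := b - a; have q0 : 0 < q by rewrite subr_gt0.
  pose cl s := a + q * clamp ((s - a) / q).
  have cl_lip s t : `|cl s - cl t| <= `|s - t|.
    have -> : cl s - cl t = q * (clamp ((s - a) / q) - clamp ((t - a) / q)) by rewrite /cl; ring.
    rewrite normrM (gtr0_norm q0) mulrC -ler_pdivlMr//.
    apply: le_trans (clamp_lip _ _) _; rewrite -mulrBl normrM (gtr0_norm (x := _^-1)) ?invr_gt0//.
    by rewrite (_ : s - a - _ = s - t)//; ring.
  have cl_in s : a <= cl s <= b.
    have /andP[h1 h2] := clamp_itv ((s - a) / q).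
    have h3 : q * clamp ((s - a) / q) <= q by rewrite -[leRHS]mulr1 ler_pM2l.
    have h4 : 0 <= q * clamp ((s - a) / q) by rewrite mulr_ge0// ltW.
    by rewrite /cl; apply/andP; split; rewrite /q in h3 h4 *; lra.
  have cl_id s : a <= s <= b -> cl s = s.
    move=> /andP[h1 h2]; rewrite /cl clampK; first by field; rewrite gt_eqF.
    by rewrite divr_ge0 ?ler_pdivrMr ?mul1r//= /q; lra.
  have near_ab s t : a <= s <= b -> a <= t <= b -> `|s - t| < et.
    by move=> /andP[? ?] /andP[? ?]; rewrite ltr_norml; apply/andP; split; lra.
  have aab : a <= a <= b by rewrite lexx.
  have tri s t : a <= s <= b -> a <= t <= b -> ldist M (c a) (c s) <= ldist M (c a) (c t) + ldist M (c t) (c s).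
    move=> h1 h2; have [_ k1] := HK a t (near_ab a t aab h2); have [_ k2] := HK t s (near_ab t s h2 h1).
    by apply: ldist_triangle; lra.
  (* By the triangle inequality this Lipschitz function grows no faster than the metric speed, so
     [lipschitz_ftc] bounds its total increment by the integral of the speed. *)
  pose v s := ldist M (c a) (c (cl s)).
  have v_lip s t : `|v s - v t| <= K1 * `|s - t|.
    have h1 := tri _ _ (cl_in s) (cl_in t); have h2 := tri _ _ (cl_in t) (cl_in s).
    have [k1 _] := HK (cl s) (cl t) (near_ab _ _ (cl_in s) (cl_in t)).
    have [k2 _] := HK (cl t) (cl s) (near_ab _ _ (cl_in t) (cl_in s)).
    have k3 : K1 * `|cl s - cl t| <= K1 * `|s - t| by rewrite ler_pM2l.
    rewrite distrC in k2; rewrite /v ler_norml; apply/andP; split; lra.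
  have [N' [mN' muN' dv ftc]] := lipschitz_ftc v_lip ab'.
  have muNN : lebesgue_measure (N `|` N') = 0%E by exact: null_set_setU.
  have mNN : measurable (N `|` N') by exact: measurableU.
  have sub : `]a, b[%classic `\` (N `|` N') `<=` `]a, b]%classic `\` N.
    move=> x [/= xab nN]; split; last by move=> h; apply: nN; left.
    by move: xab; rewrite /= !in_itv/= => /andP[-> /ltW].
  have mwab : measurable_fun (`]a, b]%classic `\` N) w by exact: measurable_funS (inG a b a0 b1) mw.
  have := ftc (N `|` N') w mNN muNN ltac:(by move=> x; right) (measurable_funS (mI a b) sub mwab).
  have va : v a = 0 by rewrite /v cl_id ?lexx// ldistxx.
  have vb : v b = ldist M (c a) (c b) by rewrite /v cl_id// lexx andbT.
  rewrite va vb subr0 => /(_ _)/le_trans; apply; last first.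
    apply: ge0_subset_integral; [by apply: measurableD|exact: mI|by apply/measurable_EFinP| |by []].
    by move=> x /(inG a b a0 b1)/w0/andP[? _]; rewrite lee_fin.
  move=> x xab nN; have /andP[ax xb] := xab.
  have x01 : 0 <= x <= 1 by apply/andP; split; lra.
  have nNx : ~ N x by move=> h; apply: nN; left.
  have [_ _ /andP[wx0 _] est] := HN x x01 nNx; split=> //.
  have dvx := dv x xab (fun h : N' x => nN (or_intror h)).
  apply/ler_addgt0Pr => ep ep0; have ep2 : 0 < ep / 2 by rewrite divr_gt0.
  have [d1 d10 H1] := est _ ep2; have [d2 d20 H2] := derivable_estimate dvx ep2.
  pose m := Num.min (Num.min d1 d2) (b - x); pose hh := m / 2.
  have m0 : 0 < m by rewrite !lt_min d10 d20 subr_gt0.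
  have hh0 : 0 < hh by rewrite divr_gt0.
  have m1 : m <= d1 by rewrite !ge_min lexx.
  have m2 : m <= d2 by rewrite !ge_min lexx orbT.
  have m3 : m <= b - x by rewrite !ge_min lexx orbT.
  have hm : hh < m by rewrite /hh; lra.
  have := H1 hh; have := H2 hh; rewrite gtr0_norm// => /(_ (lt_le_trans hm m2)) h2 /(_ (lt_le_trans hm m1)).
  move: h2; rewrite !ler_norml => /andP[h2 _] /andP[_ h1].
  have xab' : a <= x <= b by rewrite !ltW.
  have xhab : a <= x + hh <= b by clear -ax xb m3 hm hh0; apply/andP; split; lra.
  move: h2; set y := 'D_1 _ x; have -> : hh *: y = y * hh by exact: mulrC.
  have := tri _ _ xhab xab'; rewrite /v !cl_id// -(ler_pM2r hh0 y) mulrDl => h3 h2.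
  by clear -h1 h2 h3; lra.
pose F a b := fine (I a b).
have FE a b : 0 <= a -> a <= b -> b <= 1 -> I a b = (F a b)%:E.
  move=> a0 ab b1; rewrite /F fineK// ge0_fin_numE; last exact: I_ge0.
  exact: le_lt_trans (I_le a b a0 ab b1) (ltry _).
have F_ge0 a b : 0 <= a -> a <= b -> b <= 1 -> 0 <= F a b.
  by move=> a0 ab b1; rewrite -lee_fin -FE// I_ge0.
have F_le a b : 0 <= a -> a <= b -> b <= 1 -> F a b <= `|K| * (b - a).
  by move=> a0 ab b1; rewrite -lee_fin -FE// I_le.
have F_add a b e : 0 <= a -> a <= b -> b <= e -> e <= 1 -> F a b + F b e = F a e.
  move=> a0 ab be e1; have := I_add a b e a0 ab be e1.
  by rewrite !FE//; try lra; rewrite -EFinD => -[].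
have F_D a b : 0 <= a -> a <= b -> b <= 1 -> b - a < et -> ldist M (c a) (c b) <= F a b.
  by move=> a0 ab b1 h; rewrite -lee_fin -FE// I_D.
have F00 : F 0 0 = 0.
  by apply/le_anti; rewrite F_ge0 ?lexx ?ler01// andbT (le_trans (F_le 0 0 _ _ _)) ?lexx ?ler01// subrr mulr0.
have Fdiff a b : 0 <= a -> a <= b -> b <= 1 -> F 0 b - F 0 a = F a b.
  by move=> a0 ab b1; rewrite -(F_add 0 a b)//; ring.
exists (F 0), `|K|, et; split=> //; split=> //.
- by move=> a b a0 ab b1; rewrite Fdiff// F_ge0// F_le.
- by move=> a b a0 ab b1 h; rewrite Fdiff// F_D.
move=> rho' k k0 Hrho.
have -> : (k * F 0 1)%:E = (\int[lebesgue_measure]_(x in `]0%R, 1%R]%classic `\` N) (k * w x)%:E)%E.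
  rewrite EFinM -(FE 0 1)// -ge0_integralZl; [by []|exact: mI| | |by rewrite lee_fin].
  - exact: measurable_funS (inG 0 1 (lexx _) (lexx _)) mwE.
  - by move=> x /(inG 0 1 (lexx _) (lexx _))/w0/andP[? _]; rewrite lee_fin.
have sG := inG 0 1 (lexx _) (lexx _).
pose Fi (i : 'I_(nb_charts X)) := (`]0, 1]%classic `\` N) `&` (c @^-1` cell i).
have mc (j : 'I_(nb_charts X)) : measurable (c @^-1` dom j).
  by apply: open_measurable; apply: open_comp => [x _|]; [exact: cc.1 | exact: dom_open].
(* Splitting by the cell that contains [c t] matches the integrals in [curve_length]. *)
have E : `]0, 1]%classic `\` N = \big[setU/set0]_(i < nb_charts X) Fi i.
  rewrite -bigcup_seq; apply/seteqP; split=> x.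
    by move=> xG; have [i ci] := cell_cover (c x); exists i => //=; rewrite mem_index_enum.
  by move=> [i _ []].
have mF i : measurable (Fi i).
  apply: measurableI; first exact: mI.
  exact: (@preimage_cell_measurable R X _ (measurableTypeR R) c i mc).
rewrite {1}E ge0_integral_bigsetU//; first last.
- by move=> x; rewrite -E => /sG/w0/andP[? _]; rewrite lee_fin mulr_ge0.
- rewrite -E; apply/measurable_EFinP; apply: measurable_funM; first exact: measurable_cst.
  exact: measurable_funS sG mw.
- by move=> i j _ _ [x [[_ ci] [_ cj]]]; exact: cell_unique ci cj.
- exact: index_enum_uniq.
apply: lee_sum => i _; apply: ge0_integral_mono => t.
- by move=> [/sG/w0/andP[? _] _]; rewrite lee_fin mulr_ge0.
- move=> [_ /cell_dom di _]; rewrite lee_fin mulr_ge0 ?modulus_ge0//.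
  by apply: le_trans (Hrho t i di); rewrite mulr_ge0// ltW// (density_gt0 M di).
- move=> [/sG tG ci]; have [t01 nN] := GH t tG; have di := cell_dom ci.
  have [dt sp _ _] := HN t t01 nN; split; first by split; [case: tG | exact: ci | exact: dt].
  rewrite lee_fin -(sp i di) /speed mulrA ler_wpM2r ?modulus_ge0//; exact: Hrho.
Qed.

(** [La] is continued to the line by adding L per turn. Smallness of t - s is replaced by smallness
    of the length between s and t, the condition that survives when small steps are added up. *)
Lemma metric_length (R : realType) (X : riemannSurface R) (rho : conformalMetric X) (M : ballAtlas rho) (c : R -> X) :
  closed_curve c -> lipschitz_curve c -> exists (L : R) (La : R -> R),
  [/\ continuous La, {homo La : s t / s <= t}, forall t, La (t + 1) = La t + L,
    forall s t, s <= t -> La t - La s < scale M -> ldist M (c s) (c t) <= La t - La s &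
    forall (rho' : conformalMetric X) (k : R), 0 <= k ->
      (forall (t : R) (i : 'I_(nb_charts X)), dom i (c t) -> k * rho i (chart i (c t)) <= rho' i (chart i (c t))) ->
      ((k * L)%:E <= curve_length rho' c)%E].
Proof.
move=> cc lc; have d0 := scale_gt0 M.
have [La0 [K [et' [K0 et'0 [F00 HK0 HD0 len]]]]] := metric_length01 M cc lc.
have [K1 [et'' [K10 et''0 HK1]]] := curve_lip M cc lc.
pose et := Num.min (Num.min et' et'') 1.
have et0 : 0 < et by rewrite !lt_min et'0 et''0 ltr01.
have et1 : et <= 1 by rewrite ge_min lexx orbT.
have HK s t : s <= t -> t - s < et -> ldist M (c s) (c t) < scale M.
  move=> st h; have [|//] := HK1 s t; rewrite distrC ger0_norm ?subr_ge0//.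
  by apply: lt_le_trans h _; rewrite !ge_min lexx orbT.
have HD a b : 0 <= a -> a <= b -> b <= 1 -> b - a < et -> ldist M (c a) (c b) <= La0 b - La0 a.
  by move=> a0 ab b1 h; apply: HD0 => //; apply: lt_le_trans h _; rewrite !ge_min lexx.
pose L := La0 1.
pose g (k : int) s := L * k%:~R + La0 (clamp s).
have junction k : g k 1 = g (k + 1) 0.
  by rewrite /g !clampK ?lexx ?ler01// F00 rmorphD/= -/L; ring.
have cg k : continuous (g k).
  move=> s; apply: cvgD; first exact: cvg_cst.
  have lip t u : `|La0 (clamp t) - La0 (clamp u)| <= K * `|t - u|.
    wlog tu : t u / clamp u <= clamp t => [H|].
      by have [/H//|/ltW/H] := leP (clamp u) (clamp t); rewrite distrC (distrC t).
    have /andP[? ?] := clamp_itv t; have /andP[? ?] := clamp_itv u.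
    have /andP[h1 h2] : 0 <= La0 (clamp t) - La0 (clamp u) <= K * (clamp t - clamp u) by apply: HK0.
    rewrite ger0_norm//; apply: le_trans h2 _.
    by rewrite ler_wpM2l// (le_trans (ler_norm _))// clamp_lip.
  apply/(@cvgrPdist_lt _ R^o) => ep ep0.
  have q0 : 0 < ep / (K + 1) by rewrite divr_gt0// ltr_wpDl.
  near=> t; apply: le_lt_trans (lip _ _) _.
  have : `|t - s| < ep / (K + 1) by near: t; exact: near_norm_ltR.
  rewrite ltr_pdivlMr ?ltr_wpDl// => h; apply: le_lt_trans h.
  by rewrite mulrC distrC ler_wpM2l// lerDl.
pose La := glue g.
have La_at k s : 0 <= s <= 1 -> La (k%:~R + s) = L * k%:~R + La0 s.
  by move=> s01; rewrite /La (glue_at (junction k)) // /g clampK.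
have in_one k a b : 0 <= a -> a <= b -> b <= 1 ->
   [/\ La (k%:~R + a) <= La (k%:~R + b) & b - a < et -> ldist M (c (k%:~R + a)) (c (k%:~R + b)) <= La (k%:~R + b) - La (k%:~R + a)].
  move=> a0 ab b1; rewrite !La_at; try by apply/andP; split; lra.
  have /andP[h0 _] := HK0 a b a0 ab b1.
  split; first by clear -h0; lra.
  by move=> h; rewrite ![k%:~R + _]addrC !(closed_curve_int cc); have := HD a b a0 ab b1 h; clear; lra.
(* A step shorter than et <= 1 contains at most one integer in its interior, and is cut there. *)
have local s t : s <= t -> t - s < et -> La s <= La t /\ ldist M (c s) (c t) <= La t - La s.
  move=> st tse; have [k [f [sE /andP[f0 f1] _]]] := floor_frac s.
  have [h|h] := leP t (k%:~R + 1).
    have tE : t = k%:~R + (t - k%:~R) by ring.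
    have ft : f <= t - k%:~R by clear -sE st; lra.
    have t1 : t - k%:~R <= 1 by clear -h; lra.
    have [] := in_one k f (t - k%:~R) f0 ft t1.
    rewrite -tE -sE => k1 k2; split=> //; apply: k2; clear -sE tse; lra.
  have [h1 h2] := in_one k f 1 f0 (ltW f1) (lexx _).
  have tE : t = (k + 1)%:~R + (t - (k + 1)%:~R) by ring.
  have kE : (k + 1)%:~R = k%:~R + 1 :> R by rewrite rmorphD.
  have t0 : 0 <= t - (k + 1)%:~R by rewrite kE; clear -h; lra.
  have t1 : t - (k + 1)%:~R <= 1 by rewrite kE; clear -tse sE f1 et1; lra.
  have [h3 h4] := in_one (k + 1) 0 (t - (k + 1)%:~R) (lexx _) t0 t1.
  rewrite -tE addr0 kE in h3 h4; rewrite -sE in h1 h2.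
  have f1e : 1 - f < et by clear -tse sE h; lra.
  have t1e : t - (k%:~R + 1) - 0 < et by clear -tse sE f1; lra.
  have h2' := h2 f1e; have h4' := h4 t1e.
  split; first exact: le_trans h1 h3.
  have sk : s <= k%:~R + 1 by clear -sE f1; lra.
  have ske : k%:~R + 1 - s < et by clear -tse h; lra.
  have k1 := HK s (k%:~R + 1) sk ske.
  have k2 := HK (k%:~R + 1) t (ltW h) ltac:(clear -t1e; lra).
  have k3 : ldist M (c s) (c t) <= ldist M (c s) (c (k%:~R + 1)) + ldist M (c (k%:~R + 1)) (c t).
    by apply: ldist_triangle; clear -k1 k2 d0; lra.
  by clear -k3 h2' h4'; lra.
(* Induction on the number of steps of length et / 2; monotonicity of La keeps every partial length
   below the scale, so the triangle inequality stays available. *)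
have global n s t : s <= t -> t - s <= n%:R * (et / 2) -> La s <= La t /\ (La t - La s < scale M -> ldist M (c s) (c t) <= La t - La s).
  elim: n s t => [|n IH] s t st h.
    have -> : s = t by clear -st h; lra.
    by rewrite lexx subrr ldistxx.
  have [h1|h1] := leP (t - s) (et / 2).
    by have [] := local s t st ltac:(clear -h1 et0; lra).
  have h2 : t - et / 2 - s <= n%:R * (et / 2) by move: h; rewrite -natr1 mulrDl mul1r; clear; lra.
  have [k1 k2] := IH s (t - et / 2) ltac:(clear -h1; lra) h2.
  have [k3 k4] := local (t - et / 2) t ltac:(clear -et0; lra) ltac:(clear -et0; lra).
  split; first exact: le_trans k1 k3.
  move=> lt; have k2' := k2 ltac:(clear -k3 lt; lra).
  have k5 : ldist M (c s) (c t) <= ldist M (c s) (c (t - et / 2)) + ldist M (c (t - et / 2)) (c t).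
    by apply: ldist_triangle; clear -k2' k4 k1 k3 lt d0; lra.
  by clear -k5 k2' k4; lra.
have all s t : s <= t -> La s <= La t /\ (La t - La s < scale M -> ldist M (c s) (c t) <= La t - La s).
  move=> st; have q0 : 0 <= (t - s) / (et / 2) by rewrite divr_ge0 ?subr_ge0// divr_ge0// ltW.
  apply: (global (Num.bound ((t - s) / (et / 2)))) => //.
  by rewrite -ler_pdivrMr ?divr_gt0//; exact/ltW/archi_boundP.
exists L, La; split.
- exact: glue_continuous cg junction.
- by move=> s t /all[].
- move=> t; have := glue_shift g 1 t; rewrite /La => ->.
  by rewrite /glue /g rmorphD/=; ring.
- by move=> s t /all[].
by [].
Unshelve. all: by end_near. Qed.

(** * Lipschitz bound and length of geodesic polygons *)

Section PolygonLength.
Variables (R : realType) (X : riemannSurface R) (rho : conformalMetric X) (M : ballAtlas rho).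
Local Notation d := (scale M).
Local Notation D := (ldist M).
Local Notation mu := (@lebesgue_measure R).
Variables (N : nat) (xi : int -> X).
Hypothesis N0 : (0 < N)%N.
Hypothesis pxi : forall k, xi (k + N%:Z) = xi k.
Hypothesis small : forall k, D (xi k) (xi (k + 1)) < d.

Let Nr0 : 0 < N%:R :> R. Proof. by rewrite ltr0n. Qed.

Let small4 k : D (xi k) (xi (k + 1)) < 4 * d.
Proof. by have := small k; have := scale_gt0 M; lra. Qed.

Lemma polygon_edge k s t : 0 <= s <= 1 -> 0 <= t <= 1 ->
  D (polygon M N xi ((k%:~R + s) / N%:R)) (polygon M N xi ((k%:~R + t) / N%:R)) =
  `|s - t| * D (xi k) (xi (k + 1)).
Proof.
move=> s01 t01; rewrite /polygon ![N%:R * _]mulrC !divfK ?gt_eqF//.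
have J k' := polygon_junction small4 k'.
rewrite !(glue_at (J _))// !clampK//; apply: ldist_lgeo => //; exact: small4.
Qed.

(** Increments to the right only: then t may be a vertex, and the floor selects the side that starts
    there. *)
Lemma polygon_speed t : exists2 de, 0 < de & forall h, 0 <= h -> h < de ->
  D (polygon M N xi t) (polygon M N xi (t + h)) =
  h * (N%:R * D (xi (Num.floor (N%:R * t))) (xi (Num.floor (N%:R * t) + 1))).
Proof.
have [k [f [E /andP[f0 f1] <-]]] := floor_frac (N%:R * t).
exists ((1 - f) / N%:R); first by rewrite divr_gt0// subr_gt0.
move=> h h0; rewrite ltr_pdivlMr// => h1.
have hN : 0 <= h * N%:R by rewrite mulr_ge0// ltW.
have tE : t = (k%:~R + f) / N%:R by rewrite -E mulrC mulKf// gt_eqF.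
have thE : t + h = (k%:~R + (f + h * N%:R)) / N%:R.
  by rewrite addrA mulrDl -tE mulfK// gt_eqF.
rewrite thE {1}tE polygon_edge; [|by rewrite f0 ltW|by apply/andP; split; lra].
by rewrite opprD addNKr normrN ger0_norm// mulrA.
Qed.

Lemma polygon_lip s t : `|s - t| < N%:R^-1 ->
  D (polygon M N xi s) (polygon M N xi t) <= N%:R * d * `|s - t|.
Proof.
have d0 := scale_gt0 M.
wlog st : s t / s <= t => [H|].
  have [/H//|/ltW ts] := leP s t; rewrite distrC => h.
  have := H t s ts h; have h2 : D (polygon M N xi t) (polygon M N xi s) <= N%:R * d * `|t - s| by exact: H.
  move=> _; rewrite ldistC//; apply: le_lt_trans h2 _.
  have : N%:R * `|t - s| < 1 by rewrite mulrC -ltr_pdivlMr// div1r.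
  move=> hN; have : d * (N%:R * `|t - s|) < d * 1 by rewrite ltr_pM2l.
  by rewrite mulr1 (mulrC N%:R d) -mulrA; lra.
rewrite distrC ger0_norm ?subr_ge0// -[X in _ < X]div1r ltr_pdivlMr// => h.
have [k [f [E /andP[f0 f1] _]]] := floor_frac (N%:R * s).
have sE : s = (k%:~R + f) / N%:R by rewrite -E mulrC mulKf// gt_eqF.
have edge_le k' a b : 0 <= a -> a <= b -> b <= 1 -> D (polygon M N xi ((k'%:~R + a) / N%:R)) (polygon M N xi ((k'%:~R + b) / N%:R)) <= d * (b - a) /\
  D (polygon M N xi ((k'%:~R + a) / N%:R)) (polygon M N xi ((k'%:~R + b) / N%:R)) < 4 * d.
  move=> a0 ab b1; rewrite polygon_edge; [|by apply/andP; split; lra..].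
  rewrite distrC ger0_norm ?subr_ge0// mulrC; have := ltW (small k'); have := ldist_ge0 M (xi k') (xi (k' + 1)).
  set e := D _ _ => e0 ed; have h1 : e * (b - a) <= d * (b - a) by rewrite ler_wpM2r// subr_ge0.
  have h2 : d * (b - a) <= d * 1 by rewrite ler_pM2l//; lra.
  by split=> //; lra.
have NE : N%:R * d * (t - s) = d * (N%:R * t - (k%:~R + f)) by rewrite -E; ring.
rewrite NE.
have vE : N%:R * t = k%:~R + (N%:R * t - k%:~R) by ring.
have hv : N%:R * t - k%:~R < f + 1 by move: h; rewrite mulrBl (mulrC t) (mulrC s) E; lra.
have fv : f <= N%:R * t - k%:~R by have : N%:R * s <= N%:R * t by [rewrite ler_pM2l]; rewrite E; lra.
have tE : t = (k%:~R + (N%:R * t - k%:~R)) / N%:R by rewrite -vE mulrC mulKf// gt_eqF.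
have [h1|h1] := leP (N%:R * t - k%:~R) 1.
  have [k1 _] := edge_le k _ _ f0 fv h1; rewrite -tE -sE in k1; lra.
have [k1 k1'] := edge_le k _ _ f0 (ltW f1) (lexx 1).
have [k2 k2'] := edge_le (k + 1) 0 (N%:R * t - k%:~R - 1) (lexx 0) ltac:(lra) ltac:(lra).
rewrite -sE in k1 k1'; rewrite addr0 rmorphD/= (_ : _ + (_ - 1) = k%:~R + (N%:R * t - k%:~R)) -?tE in k2 k2'; last by ring.
have := ldist_triangle k1' k2'; lra.
Qed.

Lemma polygon_lipschitz : lipschitz_curve (polygon M N xi).
Proof.
have d0 := scale_gt0 M.
move=> i t dt; have [K K0 B] := ldist_bilip M dt.
have [cP _] := polygon_closed pxi small4.
exists (K * (N%:R * d)).
have [[U V]/= [cU cV] UV] := B.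
have nU : \forall s \near t, U (polygon M N xi s) by exact: cP.
have nV : \forall s \near t, V (polygon M N xi s) by exact: cP.
have N2 : 0 < N%:R^-1 / 2 :> R by rewrite divr_gt0// invr_gt0.
near=> s u => /=.
have Us : U (polygon M N xi s) by near: s.
have Vu : V (polygon M N xi u) by near: u.
have [h _] := UV (polygon M N xi s, polygon M N xi u) (conj Us Vu).
apply: le_trans h _; rewrite -mulrA ler_pM2l//; apply: polygon_lip.
have h1 : `|s - t| < N%:R^-1 / 2 by near: s; exact: near_norm_ltR.
have h2 : `|u - t| < N%:R^-1 / 2 by near: u; exact: near_norm_ltR.
rewrite -(subrK t s) -addrA; apply: le_lt_trans (ler_normD _ _) _.
by rewrite (distrC t); lra.
Unshelve. all: by end_near. Qed.

Lemma polygon_speedE i t : dom i (polygon M N xi t) ->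
  derivable ((chart i \o polygon M N xi) : R^o -> R * R) t 1 ->
  speed rho (polygon M N xi) i t = N%:R * D (xi (Num.floor (N%:R * t))) (xi (Num.floor (N%:R * t) + 1)).
Proof.
move=> di df; set A := N%:R * _.
apply/eqP; rewrite -subr_eq0 -normr_le0; apply/ler_addgt0Pr => ep ep0; rewrite add0r.
have [d1 d10 H1] := speed_estimate M (polygon_closed pxi small4) di df ep0.
have [d2 d20 H2] := polygon_speed t.
pose h := Num.min d1 d2 / 2.
have m0 : 0 < Num.min d1 d2 by rewrite lt_min d10.
have m1 : Num.min d1 d2 <= d1 by rewrite ge_min lexx.
have m2 : Num.min d1 d2 <= d2 by rewrite ge_min lexx orbT.
have h0 : 0 < h by rewrite divr_gt0.
have hd1 : h < d1 by rewrite /h; lra.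
have hd2 : h < d2 by rewrite /h; lra.
have := H1 h; rewrite gtr0_norm// H2 ?(ltW h0)// => /(_ hd1).
rewrite -/A (mulrC h) -mulrBl normrM (gtr0_norm h0) ler_pM2r// distrC; exact.
Qed.

Lemma polygon_length : (curve_length rho (polygon M N xi) <=
  (\sum_(k < N) D (xi (k : nat)%:Z) (xi ((k : nat)%:Z + 1)))%:E)%E.
Proof.
have [cP pP] := polygon_closed pxi small4.
pose E (k : nat) : set R := `[k%:R / N%:R, (k%:R + 1) / N%:R]%classic `&` `[0, 1]%classic.
pose a (k : nat) : R := N%:R * D (xi k%:Z) (xi (k%:Z + 1)).
have a0 k : 0 <= a k by rewrite mulr_ge0 ?ldist_ge0// ltW.
(* The extra index N accounts for t = 1, where the floor is N; the set [E N] is the single point 1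
   and contributes nothing. *)
pose hh (t : R) : \bar R := (\sum_(k < N.+1) (a k)%:E * (\1_(E k) t)%:E)%E.
have term0 (k : nat) (t : R) : (0 <= (a k)%:E * (\1_(E k) t)%:E)%E.
  by rewrite -EFinM lee_fin mulr_ge0// indicE ler0n.
have hh0 t : (0 <= hh t)%E by apply: sume_ge0 => k _; exact: term0.
have mE k : measurable (E k) by apply: measurableI.
have mterm (k : nat) : measurable_fun [set: R] (fun t : R => (a k)%:E * (\1_(E k) t)%:E)%E.
  under eq_fun do rewrite -EFinM; apply/measurable_EFinP; apply: measurable_funM; first exact: measurable_cst.
  exact: measurable_indic.
have mhh : measurable_fun [set: R] hh.
  apply: emeasurable_sum => k _; exact: mterm.
have mcell i : measurable (polygon M N xi @^-1` cell i).
  apply: (@preimage_cell_measurable R X _ (measurableTypeR R)) => j.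
  by apply: open_measurable; apply: open_comp => [x _|]; [exact: cP | exact: dom_open].
pose C i := `[0%R, 1%R]%classic `&` (polygon M N xi @^-1` cell i).
have mC i : measurable (C i) by apply: measurableI.
apply: (@le_trans _ _ (\sum_(i < nb_charts X) \int[mu]_(t in C i) hh t)%E).
  apply: lee_sum => i _; apply: ge0_integral_mono => t.
  - move=> [_ /cell_dom di _]; rewrite lee_fin mulr_ge0 ?modulus_ge0//; exact/ltW/(density_gt0 M di).
  - by [].
  move=> [t01 ci dt]; split=> //.
  have := polygon_speedE (cell_dom ci) dt; rewrite /speed => ->.
  have [k [f [kE /andP[f0 f1] <-]]] := floor_frac (N%:R * t).
  have /andP[t0 t1] : 0 <= t <= 1 by move: t01; rewrite /= in_itv.
  have Nt0 : 0 <= N%:R * t by rewrite mulr_ge0// ltW.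
  have Nt1 : N%:R * t <= N%:R by rewrite -[leRHS]mulr1 ler_pM2l.
  have k0 : -1 < k by rewrite -(ltr_int R) mulrN1z; lra.
  have kN : k <= N by rewrite -(ler_int R) -pmulrn; lra.
  case: k k0 kN kE => [k|k]; last by [].
  rewrite lez_nat -pmulrn => _ kN kE.
  have kN' : (k < N.+1)%N by [].
  rewrite /hh (bigD1 (Ordinal kN'))//=; apply: (@le_trans _ _ ((a k)%:E * (\1_(E k) t)%:E)%E).
    rewrite indicE mem_set ?mule1//; split; last exact: t01.
    by rewrite /= in_itv/= ler_pdivrMr// ler_pdivlMr// mulrC kE; apply/andP; split; lra.
  by rewrite leeDl//; apply: sume_ge0.
have EC : `[0%R, 1%R]%classic = \big[setU/set0]_(i < nb_charts X) C i.
  rewrite -bigcup_seq; apply/seteqP; split=> x.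
    by move=> xG; have [i ci] := cell_cover (polygon M N xi x); exists i => //=; rewrite mem_index_enum.
  by move=> [i _ []].
rewrite -ge0_integral_bigsetU//; first last.
- exact: measurable_funS mhh.
- by move=> i j _ _ [x [[_ ci] [_ cj]]]; exact: cell_unique ci cj.
- exact: index_enum_uniq.
rewrite -EC /hh ge0_integral_sum//; last by move=> k; exact: measurable_funS (mterm k).
have int1 (k : nat) : (\int[mu]_(t in `[0%R, 1%R]) ((a k)%:E * (\1_(E k) t)%:E) = (a k)%:E * mu (E k))%E.
  rewrite ge0_integralZl//; last 2 first.
  - have mi : measurable_fun [set: R] (fun x => (\1_(E k) x : R)%:E).
      by apply/measurable_EFinP; exact: measurable_indic (mE k).
    exact: measurable_funS mi.
  - by rewrite lee_fin.
  rewrite integral_indic; [|by []|exact: mE]; congr (_ * _)%E; congr (mu _).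
  by apply/seteqP; split=> x []; rewrite /E/= => // -[].
under eq_bigr do rewrite int1.
rewrite big_ord_recr/=.
have -> : mu (E N) = 0%E.
  apply/eqP; rewrite eq_le measure_ge0 andbT -(lebesgue_measure_set1 (1 : R)).
  apply: le_measure; rewrite ?inE; [exact: mE|by []|].
  move=> x [/=]; rewrite !in_itv/= ler_pdivrMr// => /andP[h1 _] /andP[_ h2].
  have h3 : N%:R * 1 <= N%:R * x by rewrite mulr1 mulrC.
  by apply/le_anti; rewrite h2 -(ler_pM2l Nr0).
rewrite mule0 adde0 -sumEFin; apply: lee_sum => k _.
have h : (mu (E k) <= (N%:R^-1)%:E)%E.
  have -> : (N%:R^-1)%:E = mu (`[k%:R / N%:R, (k%:R + 1) / N%:R]%classic : set R).
    rewrite lebesgue_measure_itv/= lte_fin ltr_pM2r ?invr_gt0// ltrDl ltr01 -EFinD; congr EFin; field.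
    by rewrite gt_eqF.
  by apply: le_measure; rewrite ?inE; [exact: mE|by []|move=> x []].
apply: le_trans (lee_wpmul2l _ h) _; first by rewrite lee_fin.
by rewrite -EFinM lee_fin /a mulrAC mulfV ?mul1r// gt_eqF.
Qed.

End PolygonLength.

(** * Curves avoiding a ball *)

Section HyperbolicAlgebra.
Variable R : realType.
Implicit Types (u v w q : R * R).

(** A linear relation between determinants in the three-dimensional space of the hyperboloid model.
    If B and C are nearly collinear with A and q, and A is not too close to q, then A, B and C are
    nearly collinear. *)
Lemma hdet_scale_eq A B C q : 0 < A.2 -> 0 < B.2 -> 0 < C.2 -> 0 < q.2 ->
  let W u v w := hdet u v w / (2 * u.2 * v.2 * w.2) in
  W A B C * (hB A q ^+ 2 - 1) =
  W C A q * (hB A q * hB B A - hB B q) - W B A q * (hB A q * hB C A - hB C q).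
Proof.
case: A => a1 a2; case: B => b1 b2; case: C => c1 c2; case: q => q1 q2 /= a0 b0 c0 q0.
rewrite /hdet /hB /=; field.
by rewrite !gt_eqF.
Qed.

Lemma hdet_small A B C q (k e : R) : 0 < A.2 -> 0 < B.2 -> 0 < C.2 -> 0 < q.2 ->
  hB A q <= k -> hB B A <= k -> hB B q <= k -> hB C A <= k -> hB C q <= k ->
  gram B A q <= e -> gram C A q <= e ->
  (hdet A B C / (2 * A.2 * B.2 * C.2) * (hB A q ^+ 2 - 1)) ^+ 2 <= 4 * e * k ^+ 4.
Proof.
move=> a0 b0 c0 q0 k1 k2 k3 k4 k5; rewrite !gramE// => g1 g2.
have := hdet_scale_eq a0 b0 c0 q0; cbv zeta => ->.
have h1 := hB_ge1 a0 q0; have h2 := hB_ge1 b0 a0; have h3 := hB_ge1 b0 q0.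
have h4 := hB_ge1 c0 a0; have h5 := hB_ge1 c0 q0.
set b := hB A q in k1 h1 *; set be := hdet C A q / _ in g2 *; set al := hdet B A q / _ in g1 *.
have K1 : 1 <= k by lra.
have kk : k <= k ^+ 2 by rewrite expr2 -[leLHS]mulr1 ler_wpM2l//; lra.
(* Both coefficients are at most k^2 in absolute value; with (x - y)^2 <= 2 x^2 + 2 y^2 this yields
   4 e k^4. *)
have sq (h h' : R) : 1 <= h -> h <= k -> 1 <= h' -> h' <= k -> (b * h - h') ^+ 2 <= (k ^+ 2) ^+ 2.
  move=> ? ? ? ?; rewrite -[leLHS]real_normK ?num_real// lerXn2r ?nnegrE ?sqr_ge0//.
  have m1 : b * h <= k * k by apply: ler_pM; lra.
  have m2 : 1 * 1 <= b * h by apply: ler_pM; lra.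
  by rewrite -expr2 in m1; rewrite ler_norml; apply/andP; split; lra.
have s1 := sq _ _ h2 k2 h3 k3; have s2 := sq _ _ h4 k4 h5 k5.
set x := b * hB B A - _ in s1 *; set y := b * hB C A - _ in s2 *.
have e0 : 0 <= e by apply: le_trans g2; exact: sqr_ge0.
have p1 : be ^+ 2 * x ^+ 2 <= e * (k ^+ 2) ^+ 2 by apply: ler_pM => //; exact: sqr_ge0.
have p2 : al ^+ 2 * y ^+ 2 <= e * (k ^+ 2) ^+ 2 by apply: ler_pM => //; exact: sqr_ge0.
have -> : k ^+ 4 = (k ^+ 2) ^+ 2 by rewrite -exprM.
have : 0 <= (be * x + al * y) ^+ 2 by exact: sqr_ge0.
have -> : (be * x + al * y) ^+ 2 = 2 * (be ^+ 2 * x ^+ 2) + 2 * (al ^+ 2 * y ^+ 2) - (be * x - al * y) ^+ 2 by ring.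
lra.
Qed.

(** On a horizontal line, a horocycle, x^2 + y^2 may be replaced by x^2 and the determinant becomes
    that of Vandermonde. *)
Lemma hdet_horocycle o (t1 t2 t3 : R) :
  hdet (o + (t1, 0)) (o + (t2, 0)) (o + (t3, 0)) = (t2 - t1) * (t3 - t1) * (t3 - t2).
Proof. by case: o => o1 o2; rewrite /hdet/= !addr0; ring. Qed.

Lemma hdet_horocycle_ge o (t : R) (i j k : nat) : 0 < o.2 -> 0 < t -> i != j -> i != k -> j != k ->
  (t ^+ 3 / (2 * o.2 * o.2 * o.2)) ^+ 2 <=
  (hdet (o + (i%:R * t, 0)) (o + (j%:R * t, 0)) (o + (k%:R * t, 0)) /
    (2 * (o.2 + 0) * (o.2 + 0) * (o.2 + 0))) ^+ 2.
Proof.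
move=> o0 t0 ij ik jk; rewrite hdet_horocycle /= !addr0.
have y0 : 0 < 2 * o.2 * o.2 * o.2 by apply: mulr_gt0 => //; apply: mulr_gt0 => //; apply: mulr_gt0.
have sq (a b : nat) : a != b -> t ^+ 2 <= (b%:R * t - a%:R * t) ^+ 2.
  move=> ab.
  have h : 1 <= `|b%:R - a%:R| :> R.
    case: (ltngtP a b) => [h|h|h]; last by rewrite h eqxx in ab.
      have : (a.+1)%:R <= b%:R :> R by rewrite ler_nat.
      by rewrite -natr1 => h'; apply: le_trans (ler_norm _); lra.
    have : (b.+1)%:R <= a%:R :> R by rewrite ler_nat.
    by rewrite -natr1 distrC => h'; apply: le_trans (ler_norm _); lra.
  have h2 : 1 <= (b%:R - a%:R) ^+ 2 :> R.
    by rewrite -real_normK ?num_real// -[leLHS](expr1n _ 2) lerXn2r ?nnegrE.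
  have -> : (b%:R * t - a%:R * t) ^+ 2 = (b%:R - a%:R) ^+ 2 * t ^+ 2 by ring.
  by rewrite ler_peMl ?sqr_ge0.
rewrite !expr_div_n ler_pM2r ?invr_gt0 ?(exprn_gt0 2 y0)//.
have -> : (t ^+ 3) ^+ 2 = t ^+ 2 * t ^+ 2 * t ^+ 2 by ring.
have t2 : 0 <= t ^+ 2 by exact: sqr_ge0.
rewrite !exprMn; apply: ler_pM; [exact: mulr_ge0 | by [] | | exact: sq].
by apply: ler_pM => //; exact: sq.
Qed.

End HyperbolicAlgebra.

(** * Almost shortest polygons in a free homotopy class *)

Section Gap.
Variables (R : realType) (X : riemannSurface R) (rho : conformalMetric X) (M : ballAtlas rho).
Local Notation d := (scale M).
Local Notation D := (ldist M).
Hypothesis cX : compact [set: X].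
Implicit Types (c : R -> X) (xi et : int -> X).

Lemma finite_net (r : R) : 0 < r -> exists m (ctr : 'I_m -> X), forall x, exists j, D (ctr j) x < r.
Proof.
move=> r0.
(* Eventually along F means for all lists containing a certain finite one; near-covering compactness
   for this filter is the extraction of a finite subcover. *)
pose F : set_system (seq X) := [set P : set (seq X) | exists s0 : seq X, forall s : seq X, {subset s0 <= s} -> P s].
have FF : Filter F.
  split; first by exists [::].
    move=> P Q [s1 h1] [s2 h2]; exists (s1 ++ s2) => s hs; split; [apply: h1 | apply: h2] => x xs;
      by apply: hs; rewrite mem_cat xs ?orbT.
  by move=> P Q PQ [s0 h0]; exists s0 => s /h0/PQ.
have /compact_near_coveringP/(_ (seq X) F (fun s x => exists2 y, y \in (s : seq X) & D y x < r) FF) := cX.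
case=> [x _|s0 H].
  have xn : \forall y \near x, D x y < r by exact: near_ldist.
  exists ([set y | D x y < r], [set s : seq X | x \in s]) => /=.
    by split=> //; exists [:: x] => s; apply; rewrite inE.
  by move=> [y s] /= [h1 h2]; exists x.
exists (size s0), (fun j => tnth (in_tuple s0) j) => x.
have [y ys yx] := H s0 (fun _ h => h) x I.
have ys' : (index y s0 < size s0)%N by rewrite index_mem.
by exists (Ordinal ys'); rewrite (tnth_nth y) nth_index.
Qed.

Lemma curve_uniform c (ep : R) : closed_curve c -> 0 < ep ->
  exists2 et, 0 < et & forall s t, `|s - t| < et -> D (c s) (c t) < ep.
Proof.
move=> cc ep0; have d0 := scale_gt0 M.
pose P (et t : R) := forall s u, `|s - t| < et -> `|u - t| < et -> D (c s) (c u) < ep.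
have /compact_near_coveringP cI := @segment_compact R 0 1.
have loc (t : R) : `[0, 1]%classic t -> \forall t' \near t & et \near (0 : R)^'+, P et t'.
  move=> _; pose q := Num.min (ep / 2) d.
  have q0 : 0 < q by rewrite lt_min divr_gt0.
  have /near_normRP[r r0 Hr] : \forall s \near t, D (c t) (c s) < q.
    by apply: (@near_continuous _ _ c t (fun x => D (c t) x < q) (cc.1 t)); exact: near_ldist.
  near=> t' et => /= s u st ut.
  have t't : `|t' - t| < r / 2 by near: t'; apply: near_norm_ltR; rewrite divr_gt0.
  have er : et <= r / 2 by near: et; apply: nbhs_right_le; rewrite divr_gt0.
  have B1 x : `|x - t'| < et -> `|x - t| < r.
    by move=> h; rewrite -(subrK t' x) -addrA; apply: le_lt_trans (ler_normD _ _) _; lra.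
  have := Hr s (B1 s st); have := Hr u (B1 u ut); rewrite !lt_min => /andP[u1 u2] /andP[s1 s2].
  have stC : D (c s) (c t) = D (c t) (c s) by apply: ldistC; lra.
  have : D (c s) (c u) <= D (c s) (c t) + D (c t) (c u) by apply: ldist_triangle; lra.
  by lra.
have near_et : \forall et \near (0 : R)^'+, `[0, 1]%classic `<=` P et by exact: cI.
near (0 : R)^'+ => et.
have et0 : 0 < et by near: et; exact: nbhs_right_gt.
exists et => // s t st.
have : `[0, 1]%classic `<=` P et by near: et.
have [k [f [tE /andP[f0 f1] _]]] := floor_frac t.
move=> /(_ f); rewrite /= in_itv/= f0 (ltW f1) => /(_ isT)/(_ (s - k%:~R) f).
rewrite subrr normr0 et0 -addrA -opprD -tE => /(_ st isT).
by rewrite -(closed_curve_int cc f k) (addrC f) -tE -(closed_curve_int cc (s - k%:~R) k) subrK.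
Unshelve. all: by end_near. Qed.

Lemma class_length_polygon c (N : nat) xi : (0 < N)%N -> (forall k, xi (k + N%:Z) = xi k) ->
  (forall k, D (xi k) (xi (k + 1)) < d) -> freely_homotopic c (polygon M N xi) ->
  (class_length rho c <= (\sum_(k < N) D (xi (k : nat)%:Z) (xi ((k : nat)%:Z + 1)))%:E)%E.
Proof.
move=> N0 px sx h; apply: le_trans (polygon_length N0 px sx).
have d0 := scale_gt0 M.
apply: ereal_inf_lbound; exists (polygon M N xi) => //; split=> //.
  by apply: polygon_closed => // k; have := sx k; lra.
exact: polygon_lipschitz.
Qed.

(** The curve is merely continuous; a fine inscribed polygon is a Lipschitz curve in its class, so
    the infimum is not taken over the empty set. *)
Lemma class_length_fin c : closed_curve c -> (class_length rho c < +oo)%E.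
Proof.
move=> cc; have d0 := scale_gt0 M.
have [et et0 U] := curve_uniform cc (ep := d / 2) ltac:(by rewrite divr_gt0).
pose N := (Num.bound et^-1).+1; have Nr0 : 0 < N%:R :> R by rewrite ltr0n.
have Net : N%:R^-1 < et.
  rewrite -[ltRHS]invrK ltf_pV2 ?posrE ?invr_gt0//.
  apply: lt_le_trans (archi_boundP _) _; first by rewrite invr_ge0 ltW.
  by rewrite ler_nat.
pose T (k : int) : R := k%:~R / N%:R.
have TD k : T (k + 1) - T k = N%:R^-1 by rewrite /T rmorphD/=; field; rewrite gt_eqF.
have TN k : T (k + N%:Z) = T k + 1.
  by rewrite /T rmorphD/= -pmulrn; field; rewrite gt_eqF.
have px k : c (T (k + N%:Z)) = c (T k) by rewrite TN cc.2.
have step k s : 0 <= s <= 1 -> D (c (T k)) (c (T k + s * (T (k + 1) - T k))) < d / 2.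
  move=> /andP[s0 s1]; apply: U; rewrite opprD addNKr normrN TD ger0_norm ?divr_ge0// ?(ltW Nr0)//.
  by apply: le_lt_trans Net; rewrite -[leRHS]mul1r ler_wpM2r// invr_ge0 ltW.
have edge k : D (c (T k)) (c (T (k + 1))) < d / 2.
  by have := step k 1; rewrite mul1r addrC subrK lexx ler01; exact.
have N0 : (0 < N)%N by [].
apply: le_lt_trans (class_length_polygon N0 px _ _) (ltry _).
  by move=> k; have := edge k; lra.
exact: curve_polygon N0 px TN cc edge step.
Qed.

(** What the polygons need to know about a length. [metric_length] provides it for Lipschitz curves,
    with an L that is at most the length of the curve. *)
Definition metric_len c (L : R) : Prop := exists La : R -> R,
  [/\ continuous La, {homo La : s t / s <= t}, forall t, La (t + 1) = La t + L &
    forall s t, s <= t -> La t - La s < d -> D (c s) (c t) <= La t - La s].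

(** A curve with L < d stays within d of its base point, hence is homotopic to a constant. *)
Lemma metric_len_ge c g L : closed_curve c -> nontrivial g -> freely_homotopic g c -> metric_len c L -> d <= L.
Proof.
move=> cc ng gc [La [_ mono shift Lip]]; have d0 := scale_gt0 M.
rewrite leNgt; apply/negP => Ld; apply: ng; exists (c 0).
apply: freely_homotopic_trans gc _; apply: (close_homotopic (M := M)) => //; first exact: closed_curve_cst.
move=> t; have [k [f [-> /andP[f0 f1] _]]] := floor_frac t.
rewrite addrC (closed_curve_int cc).
have h1 := mono 0 f f0; have h2 := mono f 1 (ltW f1); have := shift 0; rewrite add0r => h3.
have h4 := Lip 0 f f0 ltac:(lra).
by rewrite /cst/= ldistC; lra.
Qed.

Lemma class_length_ge g : nontrivial g -> (d%:E <= class_length rho g)%E.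
Proof.
move=> ng; apply: le_ereal_inf_tmp => _ [c [cc lc gc] <-].
have [L [La [h1 h2 h3 h4 h5]]] := metric_length M cc lc.
have ml : metric_len c L by exists La.
have Ld := metric_len_ge cc ng gc ml.
have := h5 rho 1 ler01; rewrite mul1r => /(_ ltac:(by move=> t i _; rewrite mul1r))/(le_trans _); apply.
by rewrite lee_fin.
Qed.

(** Vertices are taken on c at equal increments L / n of La, starting at the parameter t; the vertex
    c t is then moved to p, which costs at most de at either end of a side. *)
Lemma near_minimal_polygon g c L (n : nat) p t (de : R) : (0 < n)%N -> closed_curve c -> freely_homotopic g c ->
  metric_len c L -> 0 < L -> D p (c t) < de -> L / n%:R + 2 * de < d / 4 ->
  exists xi, [/\ forall k, xi (k + n%:Z) = xi k, forall k, D (xi k) (xi (k + 1)) <= L / n%:R + 2 * de,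
    xi 0 = p & freely_homotopic g (polygon M n xi)].
Proof.
move=> n0 cc gc [La [cLa mono shift Lip]] L0 pc small; have d0 := scale_gt0 M.
have de0 : 0 < de by apply: le_lt_trans pc; exact: ldist_ge0.
have nr0 : 0 < n%:R :> R by rewrite ltr0n.
have Ln0 : 0 < L / n%:R by rewrite divr_gt0.
have shift_int s (k : int) : La (s + k%:~R) = La s + k%:~R * L.
  have nat_case u (m : nat) : La (u + m%:R) = La u + m%:R * L.
    by elim: m => [|m IH]; rewrite ?addr0 ?mul0r ?addr0// -natr1 addrA shift IH; ring.
  case: k => m; first by rewrite -pmulrn nat_case.
  rewrite NegzE mulrNz -pmulrn; have := nat_case (s - m.+1%:R) m.+1; rewrite subrK => ->; ring.
have nodes (j : nat) : exists u, (j < n)%N -> (j = 0%N -> u = t) /\ La u = La t + j%:R * (L / n%:R).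
  case: j => [|j]; first by exists t => _; rewrite mul0r addr0.
  have [jn|jn] := ltnP j.+1 n; last by exists 0.
  have t1 : t <= t + 1 by rewrite lerDl.
  have ci : {within `[t, t + 1], continuous La} by exact: continuous_subspaceT.
  have le1 : (j.+1)%:R <= n%:R :> R by rewrite ler_nat ltnW.
  have h0 : 0 <= j.+1%:R * (L / n%:R) by rewrite mulr_ge0// ltW.
  have h1 : j.+1%:R * (L / n%:R) <= L by rewrite mulrCA ler_piMr ?(ltW L0)// ler_pdivrMr ?mul1r.
  have [|u _ uE] := @IVT R La t (t + 1) (La t + j.+1%:R * (L / n%:R)) t1 ci.
    by rewrite shift (min_l _) ?(max_r _); [apply/andP; split; lra|lra..].
  by exists u.
have [f Hf] := choice nodes.
have n0' : n%:Z != 0 by rewrite eqz_nat -lt0n.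
(* The n nodes of one turn are extended to all integers by division with remainder. *)
pose T (k : int) : R := f `|(k %% n)%Z|%N + ((k %/ n)%Z)%:~R.
have modP k : exists j : nat, [/\ (j < n)%N, (k %% n)%Z = j & k = (k %/ n)%Z * n + j].
  have := divz_eq k n; have := modz_ge0 k n0'; have := ltz_pmod k (n0 : 0 < n%:Z).
  by case: (k %% n)%Z => [j|j]//; exists j.
have LaT k : La (T k) = La t + k%:~R * (L / n%:R).
  have [j [jn jE kE]] := modP k; rewrite /T jE/= shift_int (Hf j jn).2 {2}kE rmorphD rmorphM/= -!pmulrn.
  by field; rewrite gt_eqF.
have TN k : T (k + n%:Z) = T k + 1 by rewrite /T modzDr divzDr ?dvdzz// divzz n0' rmorphD/= addrA.
have Tlt k : T k <= T (k + 1).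
  rewrite leNgt; apply/negP => /ltW/mono; rewrite !LaT rmorphD/=.
  by rewrite leNgt => /negP; apply; rewrite ltrD2l ltr_pM2r// ltrDl.
have Tdiff k u : T k <= u -> u <= T (k + 1) -> D (c (T k)) (c u) <= L / n%:R.
  move=> h1 h2; have := mono _ _ h2; have := mono _ _ h1; rewrite !LaT rmorphD/= mulrDl mul1r => h3 h4.
  by have := Lip _ _ h1; rewrite LaT => /(_ ltac:(lra)); lra.
pose xi (k : int) := if (k %% n)%Z == 0 then p else c (T k).
have xiT k : D (xi k) (c (T k)) < de.
  rewrite /xi; case: eqP => [kn|_]; last by rewrite ldistxx.
  by rewrite /T kn /= (closed_curve_int cc) (Hf 0%N n0).1.
have TxiC k : D (c (T k)) (xi k) < de by rewrite ldistC ?xiT//; have := xiT k; lra.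
have edge k : D (xi k) (xi (k + 1)) <= L / n%:R + 2 * de.
  have h1 := xiT k; have h2 := TxiC (k + 1); have h3 := Tdiff k (T (k + 1)) (Tlt k) (lexx _).
  have h4 : D (xi k) (c (T (k + 1))) <= D (xi k) (c (T k)) + D (c (T k)) (c (T (k + 1))) by apply: ldist_triangle; lra.
  have : D (xi k) (xi (k + 1)) <= D (xi k) (c (T (k + 1))) + D (c (T (k + 1))) (xi (k + 1)) by apply: ldist_triangle; lra.
  lra.
have px k : xi (k + n%:Z) = xi k by rewrite /xi modzDr TN cc.2.
exists xi; split=> //; first by rewrite /xi mod0z.
apply: freely_homotopic_trans gc _; apply: (curve_polygon (T := T)) => // [k|k s /andP[s0 s1]].
  by have := edge k; lra.
have q0 : 0 <= T (k + 1) - T k by rewrite subr_ge0.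
have h1 : 0 <= s * (T (k + 1) - T k) by rewrite mulr_ge0.
have h2 : s * (T (k + 1) - T k) <= T (k + 1) - T k by rewrite ler_piMl.
have h3 := Tdiff k (T k + s * (T (k + 1) - T k)) ltac:(lra) ltac:(lra).
have h4 := xiT k.
have : D (xi k) (c (T k + s * (T (k + 1) - T k))) <= D (xi k) (c (T k)) + D (c (T k)) (c (T k + s * (T (k + 1) - T k))).
  by apply: ldist_triangle; lra.
lra.
Qed.

(* The polygon of midpoints is homotopic to both polygons, so the convexity of
   the distance is almost an equality on each edge. *)
Lemma near_minimal_gram g (l ep : R) (n : nat) xi et a : (0 < n)%N -> class_length rho g = l%:E ->
  (forall k, xi (k + n%:Z) = xi k) -> (forall k, et (k + n%:Z) = et k) ->
  (forall k, D (xi k) (xi (k + 1)) < d / 4) -> (forall k, D (et k) (et (k + 1)) < d / 4) ->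
  (forall k, D (xi k) (et k) < d / 4) -> freely_homotopic g (polygon M n xi) ->
  (forall k, D (xi k) (xi (k + 1)) <= (l + ep) / n%:R) ->
  (forall k, D (et k) (et (k + 1)) <= (l + ep) / n%:R) ->
  D a (xi 0) < d / 4 ->
  [/\ 0 <= ep, hB (ball_log M a (et 0)) (ball_log M a (xi 0)) <= cosh 1,
      hB (ball_log M a (et 0)) (ball_log M a (xi 1)) <= cosh 1 &
      gram (ball_log M a (et 0)) (ball_log M a (xi 0)) (ball_log M a (xi 1)) <=
        4 * (1 + cosh 1) ^+ 2 * (2 * expR 1 ^+ 2 * ep)].
Proof.
move=> n0 gl px pe sx se sxe gx bx be ax; have d0 := scale_gt0 M; have d1 := scale_le1 M.
have nr0 : 0 < n%:R :> R by rewrite ltr0n.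
pose m k := lmid M (xi k) (et k).
have mP k := ldist_lmid (sxe k) (sx k) (se k).
have pm k : m (k + n%:Z) = m k by rewrite /m px pe.
have m1 k : D (m k) (m (k + 1)) <= (D (xi k) (xi (k + 1)) + D (et k) (et (k + 1))) / 2 by have [] := mP k.
have sm k : D (m k) (m (k + 1)) < d / 4 by have := m1 k; have := sx k; have := se k; lra.
have xm k : D (xi k) (m k) < d / 4 by have [_ _ h] := mP k; apply: le_lt_trans h _.
have gm := freely_homotopic_trans gx (polygon_polygon px pm sx sm xm).
have sm' k : D (m k) (m (k + 1)) < d by have := sm k; lra.
have := class_length_polygon n0 pm sm' gm; rewrite gl lee_fin => lsum.
(* Shortfall of a side of the midpoint polygon. Each is nonnegative, and their sum is at most ep
   since that polygon lies in the class and has length at least l; hence each single one is at most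
   ep. *)
pose def (k : nat) := (l + ep) / n%:R - D (m k%:Z) (m (k%:Z + 1)).
have def0 k : 0 <= def k.
  by rewrite /def; have := m1 k%:Z; have := bx k%:Z; have := be k%:Z; lra.
have sumdef : \sum_(k < n) def k <= ep.
  rewrite /def sumrB sumr_const card_ord -[X in X - _ <= _]mulr_natr divfK ?gt_eqF//; lra.
have defle : def 0%N <= ep.
  apply: le_trans sumdef; rewrite (bigD1 (Ordinal n0))//= lerDl; exact: sumr_ge0.
have ep0 : 0 <= ep := le_trans (def0 0%N) defle.
have [_ h _] := mP 0.
have ae : D a (et 0) <= D a (xi 0) + D (xi 0) (et 0) by apply: ldist_triangle; have := sxe 0; lra.
have ax1 : D a (xi 1) <= D a (xi 0) + D (xi 0) (xi (0 + 1)) by apply: ldist_triangle; have := sx 0; lra.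
have s1 := sxe 0; have s2 := sx 0; rewrite add0r in s2 ax1.
have exC : D (et 0) (xi 0) = D (xi 0) (et 0) by apply: ldistC; lra.
have ex1 : D (et 0) (xi 1) <= D (et 0) (xi 0) + D (xi 0) (xi 1) by apply: ldist_triangle; lra.
have [[p1 _] _ _] := @ldist_in _ _ _ M a (xi 0) ltac:(lra).
have [[p2 _] _ _] := @ldist_in _ _ _ M a (et 0) ltac:(lra).
have [[p3 _] _ _] := @ldist_in _ _ _ M a (xi 1) ltac:(lra).
have c1 : hB (ball_log M a (et 0)) (ball_log M a (xi 0)) <= cosh 1.
  rewrite -cosh_hd// ler_cosh ?hd_ge0// -(ldist_chart (M := M)); lra.
have c2 : hB (ball_log M a (et 0)) (ball_log M a (xi 1)) <= cosh 1.
  rewrite -cosh_hd// ler_cosh ?hd_ge0// -(ldist_chart (M := M)); lra.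
split=> //; have := h a ep (cosh 1) ax ep0; rewrite add0r; apply => //; first lra.
move: defle; rewrite /def add0r -/(m 0) -/(m 1).
by have := bx 0; have := be 0; rewrite !add0r; lra.
Qed.

(** The residue j serves all periodic sequences at once, so two polygons are compared at the same
    vertex. *)
Lemma periodic_mod (n : nat) xi (k : int) : (0 < n)%N -> (forall k, xi (k + n%:Z) = xi k) ->
  exists2 j : nat, (j < n)%N & forall et, (forall k, et (k + n%:Z) = et k) -> et k = et j%:Z.
Proof.
move=> n0 _; have n0' : n%:Z != 0 by rewrite eqz_nat -lt0n.
have := divz_eq k n; have := modz_ge0 k n0'; have := ltz_pmod k (n0 : 0 < n%:Z).
case: (k %% n)%Z => [j|j]//; rewrite ltz_nat => jn _ ->; exists j => // et pe.
have nat_case (i : int) (q : nat) : et (i + q%:Z * n%:Z) = et i.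
  by elim: q => [|q IH]; rewrite ?mul0r ?addr0// -addn1 PoszD mulrDl mul1r addrA pe.
rewrite addrC; case: (k %/ n)%Z => q; first exact: nat_case.
by rewrite NegzE mulNr -[LHS](nat_case _ q.+1) subrK.
Qed.

End Gap.

(* If the conclusion failed near every point of a horocycle arc, the pigeonhole
   principle would give three points on it and three almost shortest polygons
   through them, of the same class and with corresponding vertices close to each
   other. By [near_minimal_gram] the three points would be almost collinear, but
   no geodesic meets a horocycle three times. *)
Lemma gap (R : realType) (X : riemannSurface R) (rho : conformalMetric X) (M : ballAtlas rho)
    (m : nat) (g : 'I_m.+1 -> R -> X) (l : 'I_m.+1 -> R) : compact [set: X] ->
  (forall i, closed_curve (g i)) -> (forall i, nontrivial (g i)) ->
  (forall i, class_length rho (g i) = (l i)%:E) ->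
  exists p de, 0 < de /\ forall i c L t, closed_curve c -> freely_homotopic (g i) c ->
    metric_len M c L -> ldist M p (c t) < de -> l i + de <= L.
Proof.
move=> cX cg ng gl; have d0 := scale_gt0 M; have d1 := scale_le1 M.
have ld i : scale M <= l i by rewrite -lee_fin -gl; exact: class_length_ge.
pose lm := \sum_i l i.
have lml i : l i <= lm.
  by rewrite /lm (bigD1 i)//= lerDl; apply: sumr_ge0 => j _; exact: le_trans (ltW d0) (ld j).
have lm0 : 0 < lm by have := ld ord0; have := lml ord0; lra.
(* One number of vertices for all classes, making the sides of almost shortest polygons shorter than
   d / 16. *)
pose n := (Num.bound (16 * (lm + 1) / scale M)).+1.
have n0 : (0 < n)%N by [].
have nr0 : 0 < n%:R :> R by rewrite ltr0n.
have nr1 : 1 <= n%:R :> R by rewrite ler1n.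
have nP : (lm + 1) / n%:R < scale M / 16.
  have : 16 * (lm + 1) / scale M < n%:R.
    apply: lt_le_trans (archi_boundP _) _; last by rewrite ler_nat.
    by rewrite divr_ge0 ?ltW// mulr_gt0//; lra.
  rewrite ltr_pdivrMr// ltr_pdivrMr// => h; lra.
(* Lower bound, proved below, for the side that starts at vertex 0; it keeps the factor hB^2 - 1 of
   [hdet_small] above s0. *)
pose ka := scale M / (2 * n%:R).
have ka0 : 0 < ka by rewrite divr_gt0// mulr_gt0.
have s00 : 0 < cosh ka ^+ 2 - 1 by rewrite cosh_sqr addrC addKr exprn_gt0// sinh_gt0.
set s0 := cosh ka ^+ 2 - 1 in s00.
pose k := cosh (1 : R); have k1 : 1 <= k by exact: cosh_ge1.
pose C := 4 * (1 + k) ^+ 2 * (2 * expR 1 ^+ 2) : R.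
have C0 : 0 < C.
  rewrite /C; apply: mulr_gt0; apply: mulr_gt0 => //; apply: exprn_gt0; lra.
have [mm [ctr net]] := finite_net M cX (r := scale M / 16) ltac:(by rewrite divr_gt0).
have [ix Hix] := choice net.
(* A colour records the class and, for each vertex, a net point within d / 16. Equal colours thus
   mean the same class and vertices close to each other. *)
pose T := ('I_m.+1 * {ffun 'I_n -> 'I_mm})%type.
pose J := (2 * #|{: T}|).+1.
pose a := g ord0 0; pose o := ball_origin M a.
have o0 : 0 < o.2 := bc_o (atlas_ballchart M a).
have [r r0 Hr] := hd_small o0 (e := scale M / 16) ltac:(by rewrite divr_gt0).
pose tau := r / J%:R.
have Jr0 : 0 < J%:R :> R by rewrite ltr0n.
have tau0 : 0 < tau by rewrite divr_gt0.
(* Equally spaced points of the horocycle through o centred at infinity; tau keeps them all within d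
   / 16 of o. *)
pose pts (j : 'I_J) : R * R := o + ((j : nat)%:R * tau, 0).
have ptsP j : 0 < (pts j).2 /\ hd o (pts j) < scale M / 16.
  have h : `|pts j - o| < r.
    have jt : 0 <= (j : nat)%:R * tau by apply: mulr_ge0 => //; exact: ltW.
    rewrite /pts addrAC subrr add0r norm_pair/= normr0 gt_max r0 andbT (ger0_norm jt).
    by rewrite /tau mulrA ltr_pdivrMr// (mulrC r J%:R) ltr_pM2r// ltr_nat.
  by have [_ ? ?] := Hr o (pts j) ltac:(by rewrite subrr normr0) h.
pose p j := ball_exp M a (pts j).
have ball4 j : hball o (4 * scale M) (pts j) by have [? ?] := ptsP j; split => //; lra.
have pD j : ldist M a (p j) < scale M / 16 by rewrite /p ldist_center//; exact: (ptsP j).2.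
have pphi j : ball_log M a (p j) = pts j.
  apply: (bcK (atlas_ballchart M a)); have [? ?] := ptsP j; split => //; rewrite -/o; lra.
pose w0 := tau ^+ 3 / (2 * o.2 * o.2 * o.2).
have y0 : 0 < 2 * o.2 * o.2 * o.2 by apply: mulr_gt0 => //; apply: mulr_gt0 => //; apply: mulr_gt0.
have w00 : 0 < w0 := divr_gt0 (exprn_gt0 3 tau0) y0.
pose B := w0 ^+ 2 * s0 ^+ 2; have B0 : 0 < B := mulr_gt0 (exprn_gt0 2 w00) (exprn_gt0 2 s00).
have k40 : 0 < k ^+ 4 by rewrite exprn_gt0//; lra.
(* The three bounds keep the sides short, keep the first side longer than ka, and push the upper
   bound of [hdet_small] below the Vandermonde bound B. *)
pose ep := Num.min (Num.min (scale M / 16) ka) (B / (8 * C * k ^+ 4)).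
have ep0 : 0 < ep.
  by rewrite !lt_min ka0 divr_gt0//= divr_gt0// mulr_gt0// mulr_gt0.
have epd : ep <= scale M / 16 by rewrite !ge_min lexx.
have epka : ep <= ka by rewrite !ge_min lexx orbT.
have epB : 4 * (C * ep) * k ^+ 4 < B.
  have : ep <= B / (8 * C * k ^+ 4) by rewrite !ge_min lexx orbT.
  have c1 : 0 < 8 * C * k ^+ 4 by apply: mulr_gt0 => //; apply: mulr_gt0.
  rewrite (ler_pdivlMr _ _ c1) => h.
  have -> : 4 * (C * ep) * k ^+ 4 = ep * (8 * C * k ^+ 4) / 2 by field.
  lra.
(* If L < l + de, a side of length at most L / n + 2 de is at most (l + ep) / n. *)
pose de := ep / (2 * n%:R + 1).
have q0 : 0 < 2 * n%:R + 1 :> R by lra.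
have de0 : 0 < de by rewrite divr_gt0.
have deE : (2 * n%:R + 1) * de = ep by rewrite /de mulrC divfK// gt_eqF.
have deep : de <= ep by rewrite -deE ler_peMl ?(ltW de0)//; lra.
apply: contrapT => H.
have edge_bound i : (l i + ep) / n%:R < scale M / 16.
  by apply: le_lt_trans nP; rewrite ler_pM2r ?invr_gt0//; have := lml i; lra.
have data j : exists F : 'I_m.+1 * (int -> X),
    [/\ forall k, F.2 (k + n%:Z) = F.2 k, forall k, ldist M (F.2 k) (F.2 (k + 1)) <= (l F.1 + ep) / n%:R,
      F.2 0 = p j & freely_homotopic (g F.1) (polygon M n F.2)].
  apply: contrapT => nF; apply: H; exists (p j), de; split=> // i c L t cc gc ml pt.
  rewrite leNgt; apply/negP => Ll; apply: nF.
  have L0 : 0 < L by apply: lt_le_trans d0 _; exact: metric_len_ge cc (ng i) gc ml.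
  have Le : L / n%:R + 2 * de <= (l i + ep) / n%:R.
    by rewrite ler_pdivlMr// mulrDl divfK ?gt_eqF// -deE; lra.
  have small : L / n%:R + 2 * de < scale M / 4 by have := edge_bound i; lra.
  have [xi [h1 h2 h3 h4]] := near_minimal_polygon n0 cc gc ml L0 pt small.
  by exists (i, xi); split=> //= k'; exact: le_trans (h2 k') Le.
have [F HF] := choice data.
pose color j : T := ((F j).1, [ffun v : 'I_n => ix ((F j).2 (v : nat)%:Z)]).
have [|j1 [j2 [j3 [n12 n13 n23 c12 c13]]]] := @pigeonhole3 'I_J T color.
  by rewrite card_ord.
have sF j v : ldist M ((F j).2 v) ((F j).2 (v + 1)) < scale M / 4.
  by have [_ h _ _] := HF j; apply: le_lt_trans (h v) _; have := edge_bound (F j).1; clear -d0; lra.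
have close j j' v : color j = color j' -> ldist M ((F j).2 v) ((F j').2 v) < scale M / 4.
  move=> [_ cE]; have [pj _ _ _] := HF j; have [pj' _ _ _] := HF j'.
  have [u un Hu] := periodic_mod v n0 pj; rewrite !Hu//.
  have := congr1 (fun f : {ffun 'I_n -> 'I_mm} => f (Ordinal un)) cE; rewrite !ffunE/= => E.
  have h1 := Hix ((F j).2 u); have h2 := Hix ((F j').2 u); rewrite -E in h2.
  have h3 : ldist M ((F j).2 u) (ctr (ix ((F j).2 u))) = ldist M (ctr (ix ((F j).2 u))) ((F j).2 u) by apply: ldistC; clear -h1 d0; lra.
  have h4 : ldist M ((F j).2 u) ((F j').2 u) <= ldist M ((F j).2 u) (ctr (ix ((F j).2 u))) + ldist M (ctr (ix ((F j).2 u))) ((F j').2 u).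
    by apply: ldist_triangle; rewrite ?h3; clear -h1 h2 d0; lra.
  by rewrite h3 in h4; clear -h1 h2 h4 d0; lra.
have [px1 bx1 x10 gx1] := HF j1; have [px2 bx2 x20 gx2] := HF j2; have [px3 bx3 x30 gx3] := HF j3.
have e12 : (F j2).1 = (F j1).1 by case: c12.
have e13 : (F j3).1 = (F j1).1 by case: c13.
rewrite e12 in bx2; rewrite e13 in bx3.
have ax : ldist M a ((F j1).2 0) < scale M / 4 by rewrite x10; have := pD j1; clear -d0; lra.
have [_ q1 q2 q3] := near_minimal_gram n0 (gl _) px1 px2 (sF j1) (sF j2) (fun v => close j1 j2 v c12) gx1 bx1 bx2 ax.
have [_ r1 r2 r3] := near_minimal_gram n0 (gl _) px1 px3 (sF j1) (sF j3) (fun v => close j1 j3 v c13) gx1 bx1 bx3 ax.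
have s1 := sF j1 0; rewrite add0r in s1.
have ax1 : ldist M a ((F j1).2 1) <= ldist M a ((F j1).2 0) + ldist M ((F j1).2 0) ((F j1).2 1) by apply: ldist_triangle; clear -ax s1 d0; lra.
have [[p1 _] _ _] := @ldist_in _ _ _ M a ((F j1).2 1) ltac:(clear -ax s1 ax1 d0; lra).
rewrite x10 x20 pphi pphi in q1 q2 q3; rewrite x10 x30 pphi pphi in r1 r2 r3.
set q := ball_log M a ((F j1).2 1) in p1 q2 q3 r2 r3.
have [z1 _] := ptsP j1; have [z2 _] := ptsP j2; have [z3 _] := ptsP j3.
have hdq : hd (pts j1) q = ldist M ((F j1).2 0) ((F j1).2 1).
  by rewrite -(pphi j1) -x10; apply/esym/ldist_chart; clear -ax ax1 s1 d0; lra.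
have k4 : hB (pts j1) q <= k by rewrite -cosh_hd// ler_cosh ?hd_ge0// hdq; clear -s1 d1 d0; lra.
have := hdet_small z1 z2 z3 p1 k4 q1 q2 r1 r2 (e := C * ep).
have Ce : 4 * (1 + cosh 1) ^+ 2 * (2 * expR 1 ^+ 2 * ep) = C * ep by rewrite /C /k; ring.
rewrite Ce in q3 r3; move=> /(_ q3 r3) big.
have def0 v : 0 <= (l (F j1).1 + ep) / n%:R - ldist M ((F j1).2 v) ((F j1).2 (v + 1)) by rewrite subr_ge0.
(* The sides sum to at least l and each is at most (l + ep) / n, so none falls short of this by more
   than ep; with l >= d and ep <= ka, at least 2 ka - ka is left. *)
have Dka : ka <= ldist M ((F j1).2 0) ((F j1).2 1).
  have sm v : ldist M ((F j1).2 v) ((F j1).2 (v + 1)) < scale M by have := sF j1 v; clear -d0; lra.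
  have := class_length_polygon n0 px1 sm gx1; rewrite gl lee_fin => lsum.
  have : \sum_(v < n) ((l (F j1).1 + ep) / n%:R - ldist M ((F j1).2 (v : nat)%:Z) ((F j1).2 ((v : nat)%:Z + 1))) <= ep.
    rewrite sumrB sumr_const card_ord -[X in X - _ <= _]mulr_natr divfK ?gt_eqF//; clear -lsum; lra.
  rewrite (bigD1 (Ordinal n0))//= add0r => h0.
  have h' : 0 <= \sum_(v < n | v != Ordinal n0) ((l (F j1).1 + ep) / n%:R - ldist M ((F j1).2 (v : nat)%:Z) ((F j1).2 ((v : nat)%:Z + 1))).
    by apply: sumr_ge0.
  have h1 : scale M / n%:R <= (l (F j1).1 + ep) / n%:R by rewrite ler_pM2r ?invr_gt0//; have := ld (F j1).1; clear -ep0; lra.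
  have E : scale M / n%:R = 2 * ka by rewrite /ka; field; rewrite gt_eqF.
  by rewrite E in h1; clear -h0 h' h1 epka; lra.
have bka : cosh ka <= hB (pts j1) q by rewrite -cosh_hd// hdq ler_cosh ?ldist_ge0// ltW.
have s0b : s0 <= hB (pts j1) q ^+ 2 - 1.
  by rewrite /s0 lerD2r lerXn2r ?nnegrE// ?(le_trans _ bka) ?cosh_ge0.
set W := hdet _ _ _ / _ in big.
have W0 : w0 ^+ 2 <= W ^+ 2.
  by apply: hdet_horocycle_ge; rewrite ?(inj_eq val_inj).
have : B <= (W * (hB (pts j1) q ^+ 2 - 1)) ^+ 2.
  rewrite exprMn /B; apply: ler_pM => //; try exact: sqr_ge0.
  by rewrite lerXn2r ?nnegrE ?(ltW s00)// (le_trans (ltW s00)).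
by move=> /le_trans/(_ big); rewrite leNgt epB.
Qed.

(** * Damping the metric *)

Section PlaneMeasure.
Variable R : realType.
Local Notation plane := (measurableTypeR R * measurableTypeR R)%type.

Definition rectangle (q : rat * rat * rat) : set (R * R) :=
  `]ratr q.1.1 - ratr q.2, ratr q.1.1 + ratr q.2[%classic `*` `]ratr q.1.2 - ratr q.2, ratr q.1.2 + ratr q.2[%classic.

Lemma rectangle_measurable q : @measurable _ plane (rectangle q).
Proof. by apply: measurableX; exact: measurable_itv. Qed.

Lemma rectangle_nbhs (U : set (R * R)) z : nbhs z U -> exists q, [/\ 0 < q.2, rectangle q z & rectangle q `<=` U].
Proof.
move=> /near_normP[e e0 HU].
have [q3 /andP[q30 q3e]] : exists q : rat, 0 < (ratr q : R) < e / 2.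
  have [q] := @rat_in_itvoo R 0 (e / 2) ltac:(by rewrite divr_gt0).
  by rewrite in_itv/=; exists q.
have app (x : R) : exists q : rat, x - ratr q3 < ratr q < x + ratr q3.
  have [q] := @rat_in_itvoo R (x - ratr q3) (x + ratr q3) ltac:(lra).
  by rewrite in_itv/=; exists q.
have [q1 /andP[a1 b1]] := app z.1; have [q2 /andP[a2 b2]] := app z.2.
exists (q1, q2, q3); split=> /=; first by rewrite -(ltr0q R).
  by split; rewrite /= in_itv/=; apply/andP; split; lra.
move=> w [/=]; rewrite !in_itv/= => /andP[c1 c2] /andP[c3 c4]; apply: HU.
by rewrite norm_pair gt_max/= !ltr_norml; apply/andP; split; apply/andP; split; lra.
Qed.

(** Measurability refers to the product structure of the plane; an open set belongs to it as a
    countable union of rational squares. *)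
Lemma open_plane_measurable (U : set (R * R)) : open U -> @measurable _ plane U.
Proof.
move=> oU; pose F q := if `[< rectangle q `<=` U >] then rectangle q else set0.
have -> : U = \bigcup_q F q.
  apply/seteqP; split=> [z Uz|z [q _]]; last by rewrite /F; case: asboolP => // h /h.
  have [q [_ qz qU]] := rectangle_nbhs (open_nbhs_nbhs (conj oU Uz)).
  by exists q => //; rewrite /F; case: asboolP.
apply: countable_bigcupT_measurable => [|q]; first exact: countableP.
by rewrite /F; case: asboolP => _; [exact: rectangle_measurable | exact: measurable0].
Qed.

Lemma plane_measure_open (U : set (R * R)) z : open U -> U z -> (0 < @plane_measure R U)%E.
Proof.
move=> oU Uz; have [q [q0 _ qU]] := rectangle_nbhs (open_nbhs_nbhs (conj oU Uz)).
have q0' : 0 < ratr q.2 :> R by rewrite ltr0q.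
apply: (@lt_le_trans _ _ (@plane_measure R (rectangle q))); last first.
  apply: le_measure => //; rewrite inE; [exact: rectangle_measurable | exact: open_plane_measurable].
pose I (x : R) : set R := `]x - ratr q.2, x + ratr q.2[%classic.
have m x : lebesgue_measure (I x) = (2 * ratr q.2)%:E.
  by rewrite lebesgue_measure_itv/= lte_fin ifT; [rewrite -EFinD; congr EFin; ring | lra].
have -> : @plane_measure R (rectangle q) = ((2 * ratr q.2)%:E * (2 * ratr q.2)%:E)%E.
  transitivity (lebesgue_measure (I (ratr q.1.1)) * lebesgue_measure (I (ratr q.1.2)))%E.
    by apply: product_measure1E; exact: measurable_itv.
  by congr (_ * _)%E; exact: m.
have h : 0 < 2 * ratr q.2 :> R by rewrite mulr_gt0.
by apply: mule_gt0; rewrite lte_fin.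
Qed.

End PlaneMeasure.

Section Perturbation.
Variables (R : realType) (X : riemannSurface R) (rho : conformalMetric X) (V : set X) (k : R).
Local Notation plane := (measurableTypeR R * measurableTypeR R)%type.
Local Notation mu := (@plane_measure R).
Hypothesis k0 : 0 < k.
Hypothesis k1 : k < 1.
Hypothesis oV : open V.
Hypothesis rho0 : forall i x, dom i x -> 0 < rho i (chart i x).
Implicit Types (i j : 'I_(nb_charts X)).

Definition damping (x : X) : R := if `[< V x >] then k else 1.

Lemma dampingP x : [/\ k <= damping x, damping x <= 1 & ~ V x -> damping x = 1].
Proof. by rewrite /damping; case: asboolP => h; split=> //; exact: ltW. Qed.

Lemma damped_change i j x : dom i x -> dom j x ->
  rho i (chart i x) * damping (param i (chart i x)) =
  rho j (chart j x) * damping (param j (chart j x)) * modulus (cderiv (chart j \o param i) (chart i x)).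
Proof. by move=> dx dy; rewrite !chartK// (density_change rho dx dy) mulrAC. Qed.

Definition damped : conformalMetric X := 
  @ConformalMetric R X (fun i z => rho i z * damping (param i z)) damped_change.

Lemma dampedE i x : dom i x -> damped i (chart i x) = rho i (chart i x) * damping x.
Proof. by move=> dx; rewrite /= chartK. Qed.

Lemma image_open i (W : set X) : open W -> open (chart i @` (dom i `&` W)).
Proof.
move=> oW; have -> : chart i @` (dom i `&` W) = chart_image i `&` param i @^-1` W.
  apply/seteqP; split=> [_ [x [dx Wx] <-]|z [[x dx <-]]].
    by split; [exact: chart_in | rewrite /= chartK].
  by rewrite /= chartK// => Wx; exists x.
rewrite openE => z [iz Wz]; apply: filterI; first exact: near_chart_image.
by apply: (param_cvg iz); apply: open_nbhs_nbhs.
Qed.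

Lemma chart_image_measurable i : @measurable _ plane (chart_image i).
Proof. by apply: open_plane_measurable; exact: chart_image_open. Qed.

Lemma cell_image_measurable i : @measurable _ plane (chart i @` cell i).
Proof.
have -> : chart i @` cell i = chart_image i `\`
    \bigcup_(j in [set j : 'I_(nb_charts X) | (j < i)%N]) (chart i @` (dom i `&` dom j)).
  apply/seteqP; split=> [_ [x [dx mx] <-]|z [[x dx <-] nz]].
    split; first exact: chart_in.
    move=> [j /= ji [y [dy dj] yx]]; apply: (mx j ji).
    by rewrite -(chartK dx) -yx chartK.
  by exists x => //; split=> // j ji dj; apply: nz; exists j => //; exists x.
apply: measurableD; first exact: chart_image_measurable.
apply: fin_bigcup_measurable => [|j _]; first exact: finite_finset.
by apply: open_plane_measurable; apply: image_open; exact: dom_open.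
Qed.

Lemma cell_image_sub i : chart i @` cell i `<=` chart_image i.
Proof. by move=> _ [x [dx _] <-]; exact: chart_in. Qed.

Hypothesis al : allowable rho.

Lemma sqr_measurable i (A : set (R * R)) : A `<=` chart_image i ->
  @measurable_fun _ _ plane _ A (fun z => ((rho i z) ^+ 2)%:E).
Proof.
case: al => mr _ _ _ h; apply: (measurable_funS (chart_image_measurable i) h).
apply/measurable_EFinP; apply: measurable_funX; exact: mr.
Qed.

Lemma damped_borel i : borel_density (chart_image i) (damped i).
Proof.
case: al => mr _ _ _; rewrite /borel_density /=; apply: measurable_funM; first exact: mr.
pose W := chart i @` (dom i `&` V).
have mW : @measurable _ plane W by apply: open_plane_measurable; exact: image_open.
apply: (@eq_measurable_fun _ _ plane _ _ (fun z => 1 - (1 - k) * \1_W z)).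
  move=> _ /set_mem [x dx <-]; rewrite chartK// /damping indicE; case: asboolP => Vx.
    by rewrite mem_set ?mulr1 ?opprB 1?addrC ?subrK//; exists x.
  rewrite memNset ?mulr0 ?subr0// => -[y [dy Vy] yx].
  by apply: Vx; rewrite -(chartK dx) -yx chartK.
apply: measurable_funB; first exact: measurable_cst.
apply: measurable_funM; first exact: measurable_cst.
exact: measurable_indic.
Qed.

Lemma damped_ge i x : dom i x -> k * rho i (chart i x) <= damped i (chart i x).
Proof. by move=> dx; rewrite dampedE// mulrC; have [h _ _] := dampingP x; rewrite ler_pM2l ?rho0. Qed.

Lemma damped_le i x : dom i x -> 0 <= damped i (chart i x) <= rho i (chart i x).
Proof.
move=> dx; have h0 := rho0 dx; apply/andP; split.
  by apply: le_trans (damped_ge dx); rewrite mulr_ge0// ltW.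
by rewrite dampedE// -[leRHS]mulr1; have [_ h _] := dampingP x; rewrite ler_pM2l ?rho0.
Qed.

Lemma damped_sqr_le i x : dom i x -> damped i (chart i x) ^+ 2 <= rho i (chart i x) ^+ 2.
Proof. by move=> /damped_le/andP[h1 h2]; rewrite lerXn2r ?nnegrE// (le_trans h1). Qed.

Lemma damped_area_le : (area damped <= area rho)%E.
Proof.
apply: lee_sum => i _; apply: ge0_integral_mono => z.
- by rewrite lee_fin sqr_ge0.
- by rewrite lee_fin sqr_ge0.
by move=> [x cx <-]; split; [exists x | rewrite lee_fin; exact: damped_sqr_le (cell_dom cx)].
Qed.

(** The damped density is at least k times the given one, so its area is at least k^2 times as
    large. *)
Lemma damped_area_gt0 : (0 < area damped)%E.
Proof.
have [_ _ _ /andP[a0 _]] := al.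
have h : ((k ^+ 2)%:E * area rho <= area damped)%E.
  rewrite /area ge0_sume_distrr; last first.
    by move=> i _; apply: integral_ge0 => z _; rewrite lee_fin sqr_ge0.
  apply: lee_sum => i _; rewrite -ge0_integralZl; first last.
  - by rewrite lee_fin sqr_ge0.
  - by move=> z _; rewrite lee_fin sqr_ge0.
  - by apply: sqr_measurable; exact: cell_image_sub.
  - exact: cell_image_measurable.
  apply: ge0_integral_mono => z.
  - by rewrite -EFinM lee_fin mulr_ge0 ?sqr_ge0.
  - by rewrite lee_fin sqr_ge0.
  move=> [x cx <-]; split; first by exists x.
  have dx := cell_dom cx; rewrite -EFinM lee_fin -exprMn.
  rewrite lerXn2r ?nnegrE ?damped_ge//; first by rewrite mulr_ge0// ltW// rho0.
  by have /andP[] := damped_le dx.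
by apply: lt_le_trans h; apply: mule_gt0 => //; rewrite lte_fin exprn_gt0.
Qed.

Lemma damped_allowable : allowable damped.
Proof.
have [_ _ fin /andP[a0 afin]] := al; split.
- exact: damped_borel.
- by move=> i _ [x dx <-]; have /andP[] := damped_le dx.
- move=> i K cK KU; apply: le_lt_trans (fin i K cK KU); apply: ge0_integral_mono => z.
  + by rewrite lee_fin sqr_ge0.
  + by rewrite lee_fin sqr_ge0.
  + by move=> Kz; split=> //; have [x dx <-] := KU z Kz; rewrite lee_fin damped_sqr_le.
- by rewrite damped_area_gt0 (le_lt_trans damped_area_le).
Qed.

Lemma damped_area_lt p : V p -> (area damped < area rho)%E.
Proof.
move=> Vp; have [_ _ _ /andP[a0 afin]] := al.
have [i0 di0] := dom_cover p.
have Pi0 : `[< dom i0 `&` V !=set0 >] by apply/asboolP; exists p.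
(* For the least index whose chart domain meets V, the part of V in that domain lies entirely in the
   cell, so damping affects an open set of the domain of integration. *)
case: (@arg_minnP _ i0 (fun j => `[< dom j `&` V !=set0 >]) (fun j => j : nat) Pi0) => i /asboolP[x [dx Vx]] mi.
pose U := chart i @` (dom i `&` V); pose A := chart i @` cell i.
have oU : open U by exact: image_open.
have mU : @measurable _ plane U by exact: open_plane_measurable.
have mA : @measurable _ plane A by exact: cell_image_measurable.
have UA : U `<=` A.
  move=> _ [y [dy Vy] <-]; exists y => //; split=> // j ji dj.
  by have := mi j; rewrite leqNgt ji => /(_ _)/notF; apply; apply/asboolP; exists y.
have Ai : A `<=` chart_image i by exact: cell_image_sub.
have mAU : @measurable _ plane (A `\` U) by exact: measurableD.
have AE : A = (A `\` U) `|` U by rewrite setUC setDUK.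
have dis : [disjoint A `\` U & U] by apply/disj_setPS => z [[_ nz] Uz].
pose f z := ((rho i z) ^+ 2)%:E; pose f' z := ((damped i z) ^+ 2)%:E.
have f0 z : (0 <= f z)%E by rewrite lee_fin sqr_ge0.
have f'0 z : (0 <= f' z)%E by rewrite lee_fin sqr_ge0.
have mf : @measurable_fun _ _ plane _ A f by exact: sqr_measurable.
have mf' : @measurable_fun _ _ plane _ A f'.
  apply: (measurable_funS (chart_image_measurable i) Ai).
  by apply/measurable_EFinP; apply: measurable_funX; exact: damped_borel.
set IU := (\int[mu]_(z in U) f z)%E.
set IR := (\int[mu]_(z in A `\` U) f z)%E.
have E1 : (\int[mu]_(z in A) f z = IR + IU)%E.
  rewrite {1}AE ge0_integral_setU; [by []|exact: mAU|exact: mU|by rewrite -AE|by []|exact: dis].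
have E2 : (\int[mu]_(z in A) f' z = IR + (k ^+ 2)%:E * IU)%E.
  rewrite {1}AE ge0_integral_setU; [|exact: mAU|exact: mU|by rewrite -AE|by []|exact: dis].
  congr (_ + _)%E.
    apply: eq_integral => z /set_mem[[y cy <-] nU]; rewrite /f' /f dampedE; last exact: cell_dom cy.
    have [_ _ ->] := dampingP y; first by rewrite mulr1.
    by move=> Vy; apply: nU; exists y => //; split=> //; exact: cell_dom cy.
  rewrite /IU -ge0_integralZl; [|exact: mU|exact: measurable_funS mA UA mf|by []|by rewrite lee_fin sqr_ge0].
  apply: eq_integral => z /set_mem[y [dy Vy] <-]; rewrite /f' /f dampedE// -EFinM -exprMn mulrC.
  by rewrite /damping; case: asboolP.
(* The density is positive on U, a nonempty open set, which has positive measure. *)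
have IU0 : (0 < IU)%E.
  rewrite lt_neqAle integral_ge0// andbT; apply/negP => /eqP IUz.
  have mfU : @measurable_fun _ _ plane _ U f by exact: measurable_funS mA UA mf.
  have : (\int[mu]_(z in U) `|f z| = 0)%E.
    by rewrite IUz; apply: eq_integral => z _; rewrite gee0_abs.
  move=> /(ae_eq_integral_abs mu mU mfU)[N [mN N0 sub]].
  have UN : U `<=` N.
    move=> z Uz; apply: sub => /(_ Uz)/eqP; rewrite /f /= eqe sqrf_eq0.
    by have [y [dy _] <-] := Uz; rewrite gt_eqF// rho0.
  have := plane_measure_open oU (ex_intro2 _ _ x (conj dx Vx) erefl : U (chart i x)).
  rewrite ltNge => /negP; apply; rewrite -N0; apply: le_measure; rewrite ?inE//.
pose P := (\sum_(j < nb_charts X | j != i) \int[mu]_(z in chart j @` cell j) ((rho j z) ^+ 2)%:E)%E.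
pose P' := (\sum_(j < nb_charts X | j != i) \int[mu]_(z in chart j @` cell j) ((damped j z) ^+ 2)%:E)%E.
have areaE : (area rho = (IR + P) + IU)%E by rewrite /area (bigD1 i)//= -/P [X in (X + _)%E]E1 addeAC.
have areaE' : (area damped = (IR + P') + (k ^+ 2)%:E * IU)%E by rewrite /area (bigD1 i)//= -/P' [X in (X + _)%E]E2 addeAC.
have P'P : (P' <= P)%E.
  apply: lee_sum => j _; apply: ge0_integral_mono => z; rewrite ?lee_fin ?sqr_ge0//.
  by move=> [y cy <-]; split; [exists y | exact: damped_sqr_le (cell_dom cy)].
have IR0 : (0 <= IR)%E by exact: integral_ge0.
have P0 : (0 <= P)%E by apply: sume_ge0 => j _; apply: integral_ge0 => z _; rewrite lee_fin sqr_ge0.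
have IRPfin : (IR + P)%E \is a fin_num.
  rewrite (ge0_fin_numE (adde_ge0 IR0 P0)); apply: le_lt_trans afin; rewrite areaE leeDl//; exact: ltW.
have IUfin : IU \is a fin_num.
  rewrite (ge0_fin_numE (ltW IU0)); apply: le_lt_trans afin; rewrite areaE leeDr//; exact: adde_ge0.
rewrite areaE areaE'; apply: (@le_lt_trans _ _ ((IR + P) + (k ^+ 2)%:E * IU)%E).
  by rewrite leeD2r// leeD2l.
rewrite lteD2lE// -(fineK IUfin) -EFinM lte_fin -[ltRHS]mul1r ltr_pM2r.
  by rewrite expr_lt1// ltW.
by rewrite fine_gt0// IU0 /= -ge0_fin_numE// ltW.
Qed.

End Perturbation.

(** * Comparison of the hyperbolic metric with the damped one *)

Theorem corollaryA3 (R : realType) (g : nat) (S : topologicalType)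
    (g_ge2 : (2 <= g)%N) (S_genus_g : closed_orientable_surface R g S)
    (X : teichmuller R S) (rhoX : conformalMetric X)
    (rhoX_hyperbolic : hyperbolic_metric rhoX)
    (c : weightedMulticurve X) :
  ~ extremal_metric rhoX c.
Proof.
move=> [al ext].
have cX := compact_riemannSurface (X := X) S_genus_g.
have [M] := exists_ballAtlas rhoX_hyperbolic cX.
have d0 := scale_gt0 M.
have cc := @component_closed R X c; have nt := @component_nontrivial R X c.
have ge i := class_length_ge M (nt i); have fin i := class_length_fin M (cc i).
have lE (i : 'I_(last_index c).+1) : class_length rhoX (component i) = (fine (class_length rhoX (component i)))%:E.
  by rewrite fineK// ge0_fin_numE// (le_trans _ (ge i))// lee_fin ltW.
pose l i := fine (class_length rhoX (@component R X c i)).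
have l0 i : 0 < l i by rewrite -lte_fin -lE; apply: lt_le_trans (ge i); rewrite lte_fin.
have [p [de [de0 G]]] := @gap _ _ _ M _ _ l cX cc nt lE.
pose lm := \sum_i l i.
have lml i : l i <= lm by rewrite /lm (bigD1 i)//= lerDl; apply: sumr_ge0 => j _; exact: ltW.
have lm0 : 0 < lm := lt_le_trans (l0 ord0) (lml ord0).
have q0 : 0 < lm + de by exact: addr_gt0.
(* Since l i <= lm, this k satisfies k (l i + de) >= l i for every component. *)
pose k := lm / (lm + de).
have k0 : 0 < k by rewrite divr_gt0.
have k1 : k < 1 by rewrite ltr_pdivrMr// mul1r ltrDl.
pose V := [set x | ldist M p x < de]°.
have Vp : V p by exact: near_ldist.
have oV : open V by exact: open_interior.
have rho0 i x : dom i x -> 0 < rhoX i (chart i x) by move=> dx; exact: (density_gt0 M dx).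
pose rho' := damped rhoX V k.
have al' : allowable rho' by exact: damped_allowable.
have lt_area : (area rho' < area rhoX)%E by exact: damped_area_lt Vp.
have len (i : 'I_(last_index c).+1) : ((l i)%:E <= class_length rho' (component i))%E.
  apply: le_ereal_inf_tmp => _ [c' [cc' lc' hc'] <-].
  (* A curve through V is longer than its class by de, which compensates the factor k; a curve that
     avoids V keeps its length. *)
  have [[t Vt]|nV] := pselect (exists t, V (c' t)).
    have [L [La [h1 h2 h3 h4 h5]]] := metric_length M cc' lc'.
    have Lge : l i + de <= L.
      apply: (G i c' L t cc' hc'); first by exists La.
      exact: (interior_subset Vt).
    have := h5 rho' k (ltW k0) ltac:(by move=> u j dj; exact: damped_ge).
    apply: le_trans; rewrite lee_fin; apply: (@le_trans _ _ (k * (l i + de))); last by rewrite ler_pM2l.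
    rewrite /k mulrAC ler_pdivlMr// mulrDr mulrDr (mulrC lm (l i)) lerD2l ler_pM2r//.
  have -> : curve_length rho' c' = curve_length rhoX c'.
    apply: eq_bigr => j _; apply: eq_integral => t /set_mem[_ ct _].
    rewrite dampedE; last exact: cell_dom ct.
    have [_ _ ->] := dampingP V k1 (c' t); first by rewrite mulr1.
    by move=> Vt; apply: nV; exists t.
  by rewrite -lE; apply: ereal_inf_lbound; exists c'.
have w0 i := @weight_gt0 R X c i.
pose W := \sum_i @weight R X c i * l i.
have W0 : 0 < W.
  rewrite /W (bigD1 ord0)//= ltr_pwDl ?mulr_gt0//; apply: sumr_ge0 => i _.
  by rewrite mulr_ge0 ?ltW.
have WE : multicurve_length rhoX c = W%:E.
  by rewrite /multicurve_length /W -sumEFin; apply: eq_bigr => i _; rewrite lE EFinM.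
have Wle : (W%:E <= multicurve_length rho' c)%E.
  rewrite /W -sumEFin; apply: lee_sum => i _; rewrite EFinM; apply: lee_wpmul2l => //.
  by rewrite lee_fin ltW.
have [_ _ _ /andP[a0 afin]] := al; have [_ _ _ /andP[a0' afin']] := al'.
have aE : area rhoX = (fine (area rhoX))%:E by rewrite fineK// ge0_fin_numE// ltW.
have aE' : area rho' = (fine (area rho'))%:E by rewrite fineK// ge0_fin_numE// ltW.
set a := fine (area rhoX) in aE; set a' := fine (area rho') in aE'.
have p0 : 0 < a by rewrite -lte_fin -aE.
have p0' : 0 < a' by rewrite -lte_fin -aE'.
have aa : a' < a by rewrite -lte_fin -aE -aE'.
have : (extremal_ratio rhoX c < extremal_ratio rho' c)%E.
  rewrite /extremal_ratio WE aE aE' !inver !gt_eqF//.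
  apply: (@lt_le_trans _ _ (W%:E * W%:E * (a'^-1)%:E)%E).
    by rewrite -!EFinM lte_fin ltr_pM2l ?mulr_gt0// ltf_pV2 ?posrE.
  apply: lee_wpmul2r; first by rewrite lee_fin invr_ge0 ltW.
  by apply: lee_pmul => //; rewrite lee_fin ltW.
rewrite -ext ltNge => /negP; apply.
by apply: ereal_sup_ubound; exists rho'.
Qed.
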